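(* Let $a_1,a_2\in(0,1)$, $T>0$, $0<t_1<t_2\le T$, and let $u_0\in L^2(a_1,1)$, $\widetilde u_0\in L^2(a_2,1)$. Let $u^{a_1}$ and $u^{a_2}$ be the solutions of $$\partial_t u-\partial_x((x-a)\partial_x u)=0 \ \text{ in } (a,1)\times(0,T),\quad u(1,t)=0,\quad (x-a)\partial_x u(x,t)\big|_{x=a}=0$$ with $a=a_1$ and initial value $u_0$, and with $a=a_2$ and initial value $\widetilde u_0$, respectively. Assume that $$\partial_xu^{a_1}(1,t)=\partial_xu^{a_2}(1,t)\quad\text{for } t_1<t<t_2,$$ and that $u^{a_1}\not\equiv0$ in $(a_1,1)\times(0,T)$ or $u^{a_2}\not\equiv0$ in $(a_2,1)\times(0,T)$. Then there exist $m_1,m_2\in\mathbb N$ such that $$\frac{1-a_1}{j_{m_1}^2}=\frac{1-a_2}{j_{m_2}^2}.$$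
   Context: $0<j_1<j_2<\cdots$ are the positive zeros of the Bessel function of the first kind $J_0(z)=\sum_{k\ge0}\frac{(-1)^k}{(k!)^2}(z/2)^{2k}$, and $\mathbb N=\{1,2,\dots\}$. The solution with initial value $v\in L^2(a,1)$ is $e^{tA}v$, where $A u=\partial_x((x-a)\partial_x u)$ on $L^2(a,1)$ has domain consisting of those $u\in L^2(a,1)$ with $\int_a^1(x-a)|\partial_xu|^2dx<\infty$, $u(1)=0$ and $(x-a)\partial_x u\in H^1(a,1)$. $A$ generates an analytic contraction semigroup; for $t>0$ the equation and boundary conditions hold classically. *)

(* Defs.v *)
From HB Require Import structures.
From mathcomp Require Import all_boot all_order all_algebra.
From mathcomp Require Import all_classical all_reals all_analysis.

Set Implicit Arguments.
Unset Strict Implicit.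
Unset Printing Implicit Defensive.

Import Order.TTheory GRing.Theory Num.Theory.
Import numFieldNormedType.Exports.

Local Open Scope classical_set_scope.
Local Open Scope ring_scope.

Section BesselZeros.
Context {R : realType}.

Definition bessel0_coeff (z : R) : R^nat := fun k =>
  (-1) ^+ k / (k`!%:R) ^+ 2 * (z / 2) ^+ (2 * k).

Definition bessel0 (z : R) : R := limn (series (bessel0_coeff z)).

(* Enumeration starts at index 1: the value [j 0] is irrelevant. *)
Definition bessel0_zeros (j : nat -> R) : Prop :=
  (forall m n, (0 < m)%N -> (m < n)%N -> j m < j n) /\
  j @` [set n | (0 < n)%N] = [set z | 0 < z /\ bessel0 z = 0].

End BesselZeros.

Section DegenerateOperator.
Context {R : realType}.
Implicit Types (a t h k : R) (f g u v w p phi U : R -> R).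

Local Notation leb := (@lebesgue_measure R).

(* Elements of L^2(a,1) are represented by functions on the whole line, which
   are identified when they agree almost everywhere for the restriction to
   ]a, 1[ of the Lebesgue measure; values outside ]a, 1[ are irrelevant. *)
Definition leb1 a : {measure set (measurableTypeR R) -> \bar R} :=
  mrestr leb (measurable_itv `]a, 1[).

Definition L2 a : {pred R -> R} := Lfun (leb1 a) 2%:E.

Definition L2norm a f : \bar R := 'N[leb1 a]_2%:E[EFin \o f]%E.

Definition test_function a phi : Prop :=
  [/\ forall x, derivable phi x 1,
      continuous (derive1 phi) &
      exists c d, [/\ a < c, d < 1 & forall x, x \notin `[c, d] -> phi x = 0]].

(* Test functions are C^1 with compact support, as in Brezis' definition of
   W^{1,p}(I); using C^oo test functions gives the same notion. *)
Definition weak_derivative a f g : Prop :=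
  [/\ locally_integrable `]a, 1[ f,
      locally_integrable `]a, 1[ g &
      forall phi, test_function a phi ->
        \int[leb]_(x in `]a, 1[) (f x * derive1 phi x) =
        - \int[leb]_(x in `]a, 1[) (g x * phi x)].

(* [U] is the representative of [f] that is continuous on ]a, 1]; it is unique
   there, and [U 1] is the trace of [f] at 1. *)
Definition continuous_representative a f U : Prop :=
  U = f %[ae leb1 a] /\ {within `]a, 1], continuous U}.

(* [degenerate_op a u w]: u belongs to D(A) and A u = w. Here p is the weak
   derivative of u, and the last two clauses with u, w in L^2 say in particular
   that (x - a) p belongs to H^1(a,1). *)
Definition degenerate_op a u w : Prop :=
  u \in L2 a /\ w \in L2 a /\
  exists p,
    [/\ weak_derivative a u p,
        (\int[leb]_(x in `]a, 1%R[) ((x - a) * `|p x| ^+ 2)%:E < +oo)%E,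
        exists U, continuous_representative a u U /\ U 1 = 0,
        (fun x => (x - a) * p x) \in L2 a &
        weak_derivative a (fun x => (x - a) * p x) w].

(* Strongly continuous semigroup of bounded linear operators on L^2(a,1). *)
Record C0_semigroup a (S : R -> (R -> R) -> (R -> R)) : Prop := {
  semigroup_L2 : forall t f, 0 <= t -> f \in L2 a -> S t f \in L2 a ;
  semigroup_ae : forall t f g, 0 <= t -> f \in L2 a -> g \in L2 a ->
    f = g %[ae leb1 a] -> S t f = S t g %[ae leb1 a] ;
  semigroup_linear : forall t k f g, 0 <= t -> f \in L2 a -> g \in L2 a ->
    S t (fun x => k * f x + g x) =
    (fun x => k * S t f x + S t g x) %[ae leb1 a] ;
  semigroup_bounded : forall t, 0 <= t -> exists M : R, forall f, f \in L2 a ->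
    (L2norm a (S t f) <= M%:E * L2norm a f)%E ;
  semigroup0 : forall f, f \in L2 a -> S 0 f = f %[ae leb1 a] ;
  semigroupD : forall s t f, 0 <= s -> 0 <= t -> f \in L2 a ->
    S (s + t) f = S s (S t f) %[ae leb1 a] ;
  semigroup_cvg0 : forall f, f \in L2 a ->
    L2norm a (fun x => S t f x - f x) @[t --> 0^'+] --> 0%E }.

(* f belongs to the domain of the infinitesimal generator, with value g. *)
Definition semigroup_generator a (S : R -> (R -> R) -> (R -> R)) f g : Prop :=
  [/\ f \in L2 a, g \in L2 a &
      L2norm a (fun x => (S h f x - f x) / h - g x) @[h --> 0^'+] --> 0%E].

(* S t = e^{tA} *)
Definition degenerate_semigroup a (S : R -> (R -> R) -> (R -> R)) : Prop :=
  C0_semigroup a S /\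
  forall f g, semigroup_generator a S f g <-> degenerate_op a f g.

(* [u x t] is e^{tA} v, taken for every t in ]0, T[ as the representative that
   is continuous up to x = 1, so that pointwise values are meaningful. *)
Definition degenerate_solution a (T : R) v (u : R -> R -> R) : Prop :=
  exists S, degenerate_semigroup a S /\
    forall t, 0 < t < T ->
      continuous_representative a (S t v) (fun x => u x t).

Definition dx_at1 (u : R -> R -> R) t : R :=
  lim ((u x t - u 1 t) / (x - 1) @[x --> 1^'-]).

End DegenerateOperator.

(* Main.v *)
From HB Require Import structures.
From mathcomp Require Import all_boot all_order all_algebra.
From mathcomp Require Import all_classical all_reals all_analysis.
From mathcomp Require Import measurable_realfun ring lra.
Require Import Defs.

Set Implicit Arguments.
Unset Strict Implicit.
Unset Printing Implicit Defensive.

Import Order.TTheory GRing.Theory Num.Theory.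
Import numFieldNormedType.Exports.

Local Open Scope classical_set_scope.
Local Open Scope ring_scope.

(** Substituting [z = 2 sqrt s] turns the Bessel function [J_0] into an entire
    function, [bes 0], with [s f'' + f' + f = 0]. Hence
    [theta a l x = bes 0 (l * (x - a))] satisfies
    [((x - a) theta')' = - l theta] and is regular at [a]; it vanishes at 1
    exactly when [l * (1 - a)] is one of the numbers [j_n ^ 2 / 4]. The
    eigenvalues of [- A] are therefore [lam n = j_(n+1) ^ 2 / (4 (1 - a))], with
    eigenfunctions [psi n], and the conclusion of the theorem says that the two
    operators have an eigenvalue in common.

    Suppose that they have none. Once the solution is expanded as the sum of
    [expR (- lam n * t) * c n * psi n], its derivative at [x = 1] is the
    Dirichlet series with coefficients [c n * dpsi n 1] and exponents [lam n]
    ([dx_at1_sol]). Equality of the two observations says that a Dirichlet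
    series with pairwise distinct exponents vanishes on [ ]t1, t2[ ]. By
    analyticity it vanishes for all positive times ([dirichlet_vanish]), and its
    behaviour for large times shows that the coefficient of the least exponent
    is zero ([dirichlet_leading]), so that all coefficients are. The zeros of
    [psi n] are simple, so [dpsi n 1] is not zero: every [c n] vanishes, and
    both solutions are zero.

    The expansion rests on the completeness of the eigenfunctions
    ([eigenfunctions_complete]). The key is the inequality [courant]: a C^1
    function [r] that vanishes at 1 and is orthogonal to the first [N]
    eigenfunctions satisfies [l * int r ^ 2 <= int (x - a) * r' ^ 2] for [l]
    between [lam (N - 1)] and [lam N]. For such [l] the function [theta a l] has
    [N] zeros in the interval, so some nonzero combination of [r] and the first
    [N] eigenfunctions vanishes at all of them, and Picone's identity
    ([picone_form_ge0]) makes the quadratic form nonnegative there. By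
    orthogonality the form splits; the eigenfunctions contribute negative terms,
    so the term of [r] is nonnegative. Applied to the residual of a Fourier
    expansion, this bounds the residual by a constant times [1 / lam N]; density
    does the rest.

    Of the semigroup only the generator is known. Green's formula between an
    element of the domain and an eigenfunction ([green_operator]) is proved with
    cut-off functions: finite energy at [a] and the zero trace at 1 make the
    boundary terms vanish. As [S t (psi m)] stays in the domain, Green's formula
    makes it orthogonal to the other eigenfunctions, and by completeness it is a
    multiple of [psi m]. The factor is multiplicative in [t] with derivative
    [- lam m] at 0, hence is an exponential ([multE]), and the Fourier
    coefficients of any solution are known ([coef_S]).

    Passing from equality in the mean to pointwise values uses that the energy
    [pohozaev] is monotone, which bounds [psi n] and its flux, and that the sum
    of the [1 / lam n] is finite. *)

(** * Dirichlet series vanishing on an interval *)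

Lemma quotient_is_derive (R : realType) (f : R -> R) (x l : R) :
  h^-1 * (f (x + h) - f x) @[h --> 0^'] --> l -> is_derive x 1 f l.
Proof.
move=> H.
have c : h^-1 *: ((f \o shift x) (h *: (1 : R)) - f x) @[h --> (0:R)^'] --> l.
  apply: cvg_trans H; apply: near_eq_cvg; near=> h.
  by rewrite /= [h *: 1]mulr1 [h + x]addrC.
apply: DeriveDef; first by apply/cvg_ex; exists l.
exact: cvg_lim c.
Unshelve. all: by end_near. Qed.

Section Series.
Context {R : realType}.
Implicit Types (f g M d nu : R^nat) (t s h : R).

Lemma cvg_series_dominated f M : (forall n, `|f n| <= M n) ->
  cvgn (series M) -> cvgn (series f).
Proof.
move=> fM cM; apply: normed_cvg; apply: series_le_cvg cM => // n.
  exact: normr_ge0.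
exact: le_trans (fM n).
Qed.

Lemma lim_series_tail_le f M N : (forall n, `|f n| <= M n) -> cvgn (series M) ->
  `|limn (series f) - series f N| <= limn (series M) - series M N.
Proof.
move=> fM cM.
have cf := cvg_series_dominated fM cM.
have le1 m : (N <= m)%N ->
    `|series f m - series f N| <= series M m - series M N.
  move=> Nm; rewrite !sub_series_geq//.
  by rewrite (le_trans (ler_norm_sum _ _ _))// ler_sum.
have c1 : `|series f m - series f N| @[m --> \oo] --> `|limn (series f) - series f N|.
  by apply: cvg_norm; apply: cvgB => //; exact: cvg_cst.
have c2 : series M m - series M N @[m --> \oo] --> limn (series M) - series M N.
  by apply: cvgB => //; exact: cvg_cst.
rewrite -(cvg_lim _ c1)// -(cvg_lim _ c2)//; apply: ler_lim.
- by apply/cvg_ex; eexists; exact: c1.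
- by apply/cvg_ex; eexists; exact: c2.
- by exists N => // m /= Nm; exact: le1.
Qed.

Lemma cvg_sum_nat (T : Type) (F : set_system T) {FF : Filter F} (u : T -> R^nat)
    (l : R^nat) N : (forall n, u^~ n @ F --> l n) ->
  \sum_(0 <= n < N) u x n @[x --> F] --> \sum_(0 <= n < N) l n.
Proof.
move=> ul; elim: N => [|N IH].
  by rewrite big_nil; under eq_fun do rewrite big_nil; exact: cvg_cst.
rewrite big_nat_recr//=; under eq_fun do rewrite big_nat_recr//=.
by apply: cvgD; [exact: IH|exact: ul].
Qed.

Lemma is_derive_quotient (f : R -> R) (x l : R) : is_derive x 1 f l ->
  h^-1 * (f (x + h) - f x) @[h --> 0^'] --> l.
Proof.
move=> [/cvg_ex[k hk] <-]; rewrite /derive (cvg_lim _ hk)//.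
apply: cvg_trans hk; apply: near_eq_cvg; near=> h.
by rewrite /= [h%:A]mulr1 [h + x]addrC.
Unshelve. all: by end_near. Qed.

(** Dominated convergence for series: the tails are small uniformly in [x]. *)
Lemma tannery (T : Type) (F : set_system T) {FF : ProperFilter F}
  (u : T -> R^nat) (M l : R^nat) :
  (\forall x \near F, forall n, `|u x n| <= M n) -> cvgn (series M) ->
  (forall n, u^~ n @ F --> l n) ->
  limn (series (u x)) @[x --> F] --> limn (series l).
Proof.
move=> uM cM ul.
have lM n : `|l n| <= M n.
  have c : `|u x n| @[x --> F] --> `|l n| by apply: cvg_norm; exact: ul.
  rewrite -(cvg_lim _ c)//; apply: limr_le.
    by apply/cvg_ex; eexists; exact: c.
  by near=> x; near: x; apply: filterS uM => x; apply.
apply/cvgrPdist_le => /= e e0.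
have [N hN] : exists N, limn (series M) - series M N <= e / 4.
  have /cvgrPdist_le/(_ (e / 4))[|N _ hN] := cM; first by rewrite divr_gt0.
  by exists N; rewrite (le_trans (ler_norm _))// hN //=.
have cN : series (u x) N @[x --> F] --> series l N.
  by rewrite /series/=; exact: cvg_sum_nat.
have /cvgrPdist_le/(_ (e / 4)) := cN; rewrite divr_gt0// => /(_ isT) cN'.
near=> x.
have h1 := lim_series_tail_le N lM cM.
have h2 : `|limn (series (u x)) - series (u x) N| <= limn (series M) - series M N.
  by apply: lim_series_tail_le => // n; move: n; near: x; exact: uM.
have h3 : `|series l N - series (u x) N| <= e / 4 by near: x.
rewrite (_ : _ - _ = (limn (series l) - series l N) +
  ((series l N - series (u x) N) - (limn (series (u x)) - series (u x) N))); last by ring.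
rewrite (le_trans (ler_normD _ _))//.
rewrite (le_trans (lerD h1 (le_trans (ler_normB _ _) (lerD h3 h2))))//.
by lra.
Unshelve. all: by end_near. Qed.

Definition dirichlet d nu (t : R) : R :=
  limn (series (fun n => d n * expR (- (nu n * t)))).

Definition dirichlet_summable d nu :=
  forall t, 0 < t -> cvgn (series (fun n => `|d n| * expR (- (nu n * t)))).

Lemma dirichlet_cvg d nu t : dirichlet_summable d nu -> 0 < t ->
  cvgn (series (fun n => d n * expR (- (nu n * t)))).
Proof.
move=> sd t0; apply: cvg_series_dominated (sd _ t0) => n.
by rewrite normrM (ger0_norm (expR_ge0 _)).
Qed.

(** The factor [nu n] is absorbed by half of the exponential. *)
Lemma dirichlet_summable_mul d nu : (forall n, 0 <= nu n) ->
  dirichlet_summable d nu -> dirichlet_summable (d \* nu) nu.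
Proof.
move=> nu0 sd t t0.
have c : cvgn (series ((2 / t) *: (fun n => `|d n| * expR (- (nu n * (t / 2)))) : R^nat)).
  by apply: is_cvg_seriesZ; apply: sd; rewrite divr_gt0.
apply: series_le_cvg c => n.
- by rewrite mulr_ge0// expR_ge0.
- by apply: mulr_ge0; [rewrite divr_ge0// ltW|rewrite mulr_ge0// expR_ge0].
rewrite (_ : (_ *: _) n = 2 / t * (`|d n| * expR (- (nu n * (t / 2)))))// normrM (ger0_norm (nu0 n)).
have -> : expR (- (nu n * t)) = expR (- (nu n * (t / 2))) * expR (- (nu n * (t / 2))).
  by rewrite -expRD; congr expR; field.
rewrite mulrACA mulrA [leRHS]mulrC -!mulrA ler_wpM2l//.
apply: ler_wpM2l; first exact: expR_ge0.
rewrite expRN ler_pdivrMr ?expR_gt0// mulrC -ler_pdivrMr ?divr_gt0// invf_div.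
have := expR_ge1Dx (nu n * (t / 2)); rewrite mulrA; lra.
Qed.

(** Termwise differentiation: as [1 - expR (- y) <= y], the right difference
    quotients of the terms are dominated by the terms of the derivative. *)
Lemma dirichlet_derive d nu (t1 t2 : R) : (forall n, 0 <= nu n) ->
  dirichlet_summable d nu -> 0 <= t1 ->
  (forall t, t1 < t < t2 -> dirichlet d nu t = 0) ->
  forall t, t1 < t < t2 -> dirichlet (d \* nu) nu t = 0.
Proof.
move=> nu0 sd t10 z t /andP[t1t tt2].
have t0 : 0 < t by exact: le_lt_trans t1t.
pose u (h : R) n := h^-1 * (d n * expR (- (nu n * t)) - d n * expR (- (nu n * (t + h)))).
have cv : limn (series (u h)) @[h --> 0^'+] --> dirichlet (d \* nu) nu t.
  apply: (@tannery _ _ _ u (fun n => `|(d \* nu) n| * expR (- (nu n * t)))).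
  - near=> h => n.
    have h0 : 0 < h by near: h; exact: nbhs_right_gt.
    have -> : u h n = d n * ((1 - expR (- (nu n * h))) / h) * expR (- (nu n * t)).
      rewrite /u (_ : - (nu n * (t + h)) = - (nu n * t) + - (nu n * h)); last by ring.
      by rewrite expRD; ring.
    have : expR (- (nu n * h)) <= 1.
      by rewrite -expR0 ler_expR oppr_le0 mulr_ge0// ltW.
    have := expR_ge1Dx (- (nu n * h)) => e1 e2.
    rewrite !normrM !(ger0_norm (expR_ge0 _)) (ger0_norm (nu0 n)).
    rewrite (@ger0_norm _ (1 - _)) ?subr_ge0// (@ger0_norm _ h^-1) ?invr_ge0 ?(ltW h0)//.
    rewrite ler_wpM2r ?expR_ge0// ler_wpM2l// ler_pdivrMr//; lra.
  - exact: dirichlet_summable_mul.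
  - move=> n.
    have dE : is_derive t 1 (fun s => d n * expR (- (nu n * s))) (- ((d \* nu) n * expR (- (nu n * t)))).
      apply: is_derive_eq; rewrite /GRing.scale/=; ring.
    have /cvg_dnbhs_at_right/cvgN := is_derive_quotient dE.
    rewrite opprK; apply: cvg_trans; apply: near_eq_cvg; near=> h.
    by rewrite fctE /u; ring.
rewrite -(cvg_lim _ cv)//; apply: cvg_lim => //.
apply: cvg_near_cst; near=> h.
have h0 : 0 < h by near: h; exact: nbhs_right_gt.
have ht2 : t + h < t2.
  by rewrite -ltrBrDl; near: h; apply: nbhs_right_lt; rewrite subr_gt0.
have cs s := @dirichlet_cvg _ _ s sd.
have -> : u h = h^-1 *: ((fun n => d n * expR (- (nu n * t))) - (fun n => d n * expR (- (nu n * (t + h))))).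
  by apply/funext => n.
have th0 : 0 < t + h by rewrite addr_gt0.
rewrite lim_seriesZ; last first.
  by rewrite (_ : series _ = series (fun n => d n * expR (- (nu n * t))) - series (fun n => d n * expR (- (nu n * (t + h)))));
    [apply: is_cvgB; exact: cs|rewrite -seriesN -seriesD].
rewrite lim_seriesB; [|exact: cs..].
have zt := z t; have zth := z (t + h); rewrite /dirichlet in zt zth.
rewrite zt ?t1t// zth ?subrr ?scaler0// ht2 andbT.
by rewrite (lt_trans t1t)// ltrDl.
Unshelve. all: by end_near. Qed.

(** All derivatives vanish at [t] by [dirichlet_derive]. As the exponents are
    nonnegative, the Taylor expansion at [t] represents the series at [s] as
    soon as [`|s - t| < t]. *)
Lemma dirichlet_vanish_double d nu (t1 t2 : R) t s : (forall n, 0 <= nu n) ->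
  dirichlet_summable d nu -> 0 <= t1 ->
  (forall t, t1 < t < t2 -> dirichlet d nu t = 0) ->
  t1 < t < t2 -> 0 < s < 2 * t -> dirichlet d nu s = 0.
Proof.
move=> nu0 sd t10 z tt /andP[s0 st].
have mom k : dirichlet_summable (fun n => d n * nu n ^+ k) nu /\
    forall t, t1 < t < t2 -> dirichlet (fun n => d n * nu n ^+ k) nu t = 0.
  elim: k => [|k [IH1 IH2]].
    by under eq_fun do rewrite expr0 mulr1.
  have -> : (fun n => d n * nu n ^+ k.+1) = (fun n => d n * nu n ^+ k) \* nu.
    by apply/funext => n; rewrite exprSr mulrA.
  by split; [exact: dirichlet_summable_mul|exact: dirichlet_derive IH2].
pose r := t - s.
have ltr_ : `|r| < t by rewrite ltr_norml /r; case/andP: tt => *; apply/andP; split; lra.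
(* The Taylor polynomial of degree [K - 1] of the nth term. *)
pose u K n := \sum_(0 <= i < K) (d n * nu n ^+ i * expR (- (nu n * t))) * (r ^+ i / i`!%:R).
have uE K n : u K n = d n * expR (- (nu n * t)) * series (exp_coeff (nu n * r)) K.
  rewrite /u /series/= mulr_sumr; apply: eq_bigr => i _.
  by rewrite /exp_coeff/= exprMn; ring.
have cu : limn (series (u K)) @[K --> \oo] --> dirichlet d nu s.
  apply: (@tannery _ _ _ u (fun n => `|d n| * expR (- (nu n * (t - `|r|))))).
  - apply: nearW => K n; rewrite uE normrM normrM (ger0_norm (expR_ge0 _)) -mulrA ler_wpM2l//.
    rewrite (_ : - (nu n * (t - `|r|)) = - (nu n * t) + nu n * `|r|); last by ring.
    rewrite expRD ler_wpM2l ?expR_ge0//.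
    have le1 : `|series (exp_coeff (nu n * r)) K| <= series (exp_coeff `|nu n * r|) K.
      rewrite /series/= (le_trans (ler_norm_sum _ _ _))// ler_sum// => i _.
      by rewrite /exp_coeff/= normrM normrX (@ger0_norm _ (_^-1)).
    rewrite (le_trans le1)// (_ : nu n * `|r| = `|nu n * r|); last by rewrite normrM ger0_norm.
    apply: nondecreasing_cvgn_le; last exact: is_cvg_series_exp_coeff.
    by apply: nondecreasing_series => i _ _; rewrite exp_coeff_ge0.
  - by apply: sd; rewrite subr_gt0.
  - move=> n; under eq_fun do rewrite uE.
    have -> : d n * expR (- (nu n * s)) = d n * expR (- (nu n * t)) * expR (nu n * r).
      by rewrite -mulrA -expRD /r; congr (_ * expR _); ring.
    by apply: cvgMl_tmp; apply: is_cvg_series_exp_coeff.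
rewrite -(cvg_lim _ cu)//; apply: cvg_lim => //; apply: cvg_near_cst; apply: nearW => K.
have t0 : 0 < t by case/andP: tt => h _; exact: le_lt_trans h.
have cm i : series (fun n => (d n * nu n ^+ i * expR (- (nu n * t))) * (r ^+ i / i`!%:R)) @ \oo --> (0 : R).
  have [sm zm] := mom i.
  have cs : cvgn (series (fun n => d n * nu n ^+ i * expR (- (nu n * t)))).
    exact: dirichlet_cvg sm t0.
  rewrite (_ : series _ = (fun N => series (fun n => d n * nu n ^+ i * expR (- (nu n * t))) N * (r ^+ i / i`!%:R))).
    rewrite -[X in _ --> X](mul0r (r ^+ i / i`!%:R)) -(zm _ tt).
    exact: cvgMr_tmp.
  by apply/funext => N; rewrite /series/= mulr_suml.
apply: cvg_lim => //.
have -> : series (u K) = (fun N => \sum_(0 <= i < K) series (fun n => (d n * nu n ^+ i * expR (- (nu n * t))) * (r ^+ i / i`!%:R)) N).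
  by apply/funext => N; rewrite /series/= exchange_big.
have := cvg_sum_nat (u := fun N i => series (fun n => (d n * nu n ^+ i *
  expR (- (nu n * t))) * (r ^+ i / i`!%:R)) N) (N := K) cm.
by rewrite (@big1 _ _ _ nat _ xpredT (fun=> 0))//; apply.
Qed.

(** The interval of vanishing can be doubled again and again, starting from the
    midpoint of [ ]t1, t2[ ]. *)
Lemma dirichlet_vanish d nu (t1 t2 : R) : (forall n, 0 <= nu n) ->
  dirichlet_summable d nu -> 0 <= t1 -> t1 < t2 ->
  (forall t, t1 < t < t2 -> dirichlet d nu t = 0) ->
  forall t, 0 < t -> dirichlet d nu t = 0.
Proof.
move=> nu0 sd t10 t12 z t tgt0.
pose b := (t1 + t2) / 2.
have b0 : 0 < b by rewrite /b; lra.
have step k : forall s, 0 < s < b * 2 ^+ k -> dirichlet d nu s = 0.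
  elim: k => [|k IH] s /andP[s0 sb].
    apply: (dirichlet_vanish_double nu0 sd t10 z (t := b)); rewrite /b.
      by apply/andP; split; lra.
    by move: sb; rewrite expr0 mulr1 s0/= /b => ?; lra.
  have b2 : 0 < b * 2 ^+ k by rewrite mulr_gt0// exprn_gt0.
  have sb' : s < 2 * (b * 2 ^+ k) by move: sb; rewrite exprS; lra.
  apply: (dirichlet_vanish_double nu0 sd (lexx 0) IH (t := (s / 2 + b * 2 ^+ k) / 2)).
    by apply/andP; split; lra.
  by rewrite s0/=; lra.
have [k hk] : exists k : nat, t < b * 2 ^+ k.
  clearbody b; exists (Num.bound (t / b)); rewrite mulrC -ltr_pdivrMr//.
  rewrite (lt_trans (archi_boundP _)) ?divr_ge0 ?ltW//.
  by rewrite -natrX ltr_nat ltn_expl.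
by apply: (step k); rewrite tgt0.
Qed.

(** Multiplying by [expR (nu n0 * t)] and letting [t] tend to infinity isolates
    the coefficient of the smallest exponent. *)
Lemma dirichlet_leading d nu n0 : (forall n, 0 <= nu n) -> injective nu ->
  dirichlet_summable d nu -> (forall t, 0 < t -> dirichlet d nu t = 0) ->
  (forall n, d n != 0 -> nu n0 <= nu n) -> d n0 = 0.
Proof.
move=> nu0 inu sd z hmin.
pose u (k : nat) n := d n * expR (- ((nu n - nu n0) * k.+1%:R)).
have cu : limn (series (u k)) @[k --> \oo] -->
    limn (series (fun n => if n == n0 then d n0 else 0)).
  apply: (@tannery _ _ _ u (fun n => expR (nu n0) * (`|d n| * expR (- (nu n * 1))))).
  - apply: nearW => k n; rewrite /u normrM (ger0_norm (expR_ge0 _)).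
    have [->|dn0] := eqVneq (d n) 0; first by rewrite normr0 !mul0r mulr0.
    rewrite mulrCA ler_wpM2l// -expRD ler_expR.
    have := hmin _ dn0; have : (1 : R) <= k.+1%:R by rewrite ler1n.
    move=> h1 h2; have := ler_wpM2l (_ : 0 <= nu n - nu n0) h1.
    by rewrite subr_ge0 => /(_ h2); lra.
  - exact: (is_cvg_seriesZ (k := expR (nu n0)) (sd 1 ltr01)).
  - move=> n; have [->|nn0] := eqVneq n n0.
      by rewrite /u; under eq_fun do rewrite subrr mul0r oppr0 expR0 mulr1; exact: cvg_cst.
    have [dn0|dn0] := eqVneq (d n) 0.
      by rewrite /u dn0; under eq_fun do rewrite mul0r; exact: cvg_cst.
    have lt0 : 0 < nu n - nu n0.
      by rewrite subr_gt0 lt_neqAle hmin// andbT; apply: contra nn0 => /eqP/inu ->.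
    have c1 : expR (- (nu n - nu n0)) ^+ k.+1 @[k --> \oo] --> (0 : R).
      rewrite (@cvg_shiftS _ (GRing.exp (expR (- (nu n - nu n0))))).
      by apply: cvg_expr; rewrite ger0_norm ?expR_ge0// expR_lt1 oppr_lt0.
    have -> : u^~ n = (fun k => d n * expR (- (nu n - nu n0)) ^+ k.+1).
      by apply/funext => k; rewrite /u -mulNr expRM_natr.
    by have := cvgMl_tmp (a := d n) c1; rewrite mulr0; apply.
have -> : d n0 = limn (series (fun n => if n == n0 then d n0 else 0)).
  apply/esym/cvg_lim => //; apply: cvg_near_cst; exists n0.+1 => // m /= mn0.
  rewrite /series/= big_mkord (bigD1 (Ordinal mn0))//= eqxx big1 ?addr0// => i.
  by rewrite -val_eqE/= => /negbTE ->.
rewrite -(cvg_lim _ cu)//; apply: cvg_lim => //; apply: cvg_near_cst; apply: nearW => k.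
have -> : u k = expR (nu n0 * k.+1%:R) *: (fun n => d n * expR (- (nu n * k.+1%:R))).
  apply/funext => n; rewrite /u [RHS]mulrCA -expRD; congr (_ * expR _); ring.
have k0 : (0 : R) < k.+1%:R by rewrite ltr0n.
rewrite lim_seriesZ; last exact: dirichlet_cvg sd k0.
by have := z _ k0; rewrite /dirichlet => ->; rewrite scaler0.
Qed.

End Series.

(** * The entire function behind the Bessel function of order 0 *)
Section BesselEntire.
Context {R : realType}.
Implicit Types (s x : R).

Definition bes_coeff m k : R := (-1) ^+ (k + m) / (k`!%:R * (k + m)`!%:R).

(** [(-1) ^ m * s ^ (m / 2) * bes m s] is the Bessel function of order [m] at
    [2 sqrt s]; this normalisation makes [bes m.+1] the derivative of [bes m]. *)
Definition bes m s : R := limn (pseries (bes_coeff m) s).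

Lemma bes_coeff_diffs m : pseries_diffs (bes_coeff m) = bes_coeff m.+1.
Proof.
apply/funext => k; rewrite /pseries_diffs /bes_coeff addSnnS factS natrM.
have k0 : (k`!%:R : R) != 0 by rewrite pnatr_eq0 -lt0n fact_gt0.
have km0 : ((k + m.+1)`!%:R : R) != 0 by rewrite pnatr_eq0 -lt0n fact_gt0.
have k1 : (k.+1%:R : R) != 0 by rewrite pnatr_eq0.
by field; rewrite km0 k0 nat1r.
Qed.

Lemma is_cvg_bes m s : cvgn (pseries (bes_coeff m) s).
Proof.
apply: (@cvg_series_dominated _ _ (exp_coeff `|s|)); last first.
  exact: is_cvg_series_exp_coeff.
move=> k; rewrite /exp_coeff/= normrM normrX mulrC ler_wpM2l ?exprn_ge0//.
rewrite /bes_coeff normrM normrX normrN1 expr1n mul1r ger0_norm ?invr_ge0//.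
rewrite lef_pV2 ?posrE ?mulr_gt0 ?ltr0n ?fact_gt0//.
by rewrite ler_peMr// ler1n fact_gt0.
Qed.

Lemma is_derive_bes m s : is_derive s 1 (bes m) (bes m.+1 s).
Proof.
rewrite /bes -bes_coeff_diffs.
apply: (@pseries_snd_diffs _ _ (`|s| + 1)); rewrite ?bes_coeff_diffs; try exact: is_cvg_bes.
by rewrite [ltRHS]ger0_norm ?addr_ge0// ltrDl.
Qed.

Lemma bes_ode s : s * bes 2 s + bes 1 s + bes 0 s = 0.
Proof.
have H N : s * series (fun i => bes_coeff 2 i * s ^+ i) N +
  series (fun i => bes_coeff 1 i * s ^+ i) N.+1 +
  series (fun i => bes_coeff 0 i * s ^+ i) N.+1 = 0.
  rewrite /series/=; elim: N => [|N IH].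
    rewrite !big_nat1 big_nil /bes_coeff ?(add0n, expr0, expr1, fact0, factS, mulr1, muln1, invr1).
    by ring.
  rewrite big_nat_recr//= (big_nat_recr N.+1)//= (big_nat_recr N.+1)//=.
  rewrite (_ : _ + _ = (s * \sum_(0 <= i < N) bes_coeff 2 i * s ^+ i +
      \sum_(0 <= i < N.+1) bes_coeff 1 i * s ^+ i +
      \sum_(0 <= i < N.+1) bes_coeff 0 i * s ^+ i) +
    (bes_coeff 2 N + bes_coeff 1 N.+1 + bes_coeff 0 N.+1) * s ^+ N.+1); last by rewrite exprS; ring.
  rewrite IH add0r (_ : _ + _ = 0) ?mul0r//.
  rewrite /bes_coeff addn0 addn1 addn2 !factS !natrM.
  have k0 : (N`!%:R : R) != 0 by rewrite pnatr_eq0 -lt0n fact_gt0.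
  have k1 : (N.+1%:R : R) != 0 by rewrite pnatr_eq0.
  have k2 : (N.+2%:R : R) != 0 by rewrite pnatr_eq0.
  have k12 : (N.+2%:R : R) = N.+1%:R + 1 by rewrite -natr1.
  rewrite !exprS k12 in k2 *; field; rewrite k0.
  by rewrite nat1r k1 k2.
have c : s * series (fun i => bes_coeff 2 i * s ^+ i) N +
  series (fun i => bes_coeff 1 i * s ^+ i) N.+1 +
  series (fun i => bes_coeff 0 i * s ^+ i) N.+1 @[N --> \oo] -->
  s * bes 2 s + bes 1 s + bes 0 s.
  apply: cvgD; last by rewrite (cvg_shiftS (series _)); exact: is_cvg_bes.
  apply: cvgD; last by rewrite (cvg_shiftS (series _)); exact: is_cvg_bes.
  by apply: cvgMl_tmp; exact: is_cvg_bes.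
rewrite -(cvg_lim _ c)//; apply: cvg_lim => //.
by under eq_fun do rewrite H; exact: cvg_cst.
Qed.

Lemma bes0_0 : bes 0 0 = 1.
Proof.
apply: cvg_lim => //; apply: cvg_near_cst; exists 1%N => // -[//|n] _ /=.
rewrite /pseries /series/= big_nat_recl//= big1 ?addr0.
  by rewrite /bes_coeff expr0 mulr1 addn0 expr0 fact0 mulr1 divr1.
by move=> i _; rewrite expr0n mulr0.
Qed.

Lemma is_derive_mul_bes1 s : is_derive s 1 (fun s => s * bes 1 s) (- bes 0 s).
Proof.
have d1 := is_derive_bes 1 s.
apply: is_derive_eq.
rewrite /GRing.scale/= mulr1; apply/eqP; rewrite -subr_eq0 opprK.
by apply/eqP; rewrite -(bes_ode s); ring.
Qed.

Lemma bessel0E z : bessel0 z = bes 0 (z ^+ 2 / 4).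
Proof.
congr (limn (series _)); apply/funext => k.
rewrite /bessel0_coeff /= /bes_coeff addn0 -expr2 exprM; congr (_ * _ ^+ _).
by field.
Qed.

End BesselEntire.

(** * Square integrable functions on an interval *)
Section IntervalIntegral.
Context {R : realType}.
Variable a : R.
Implicit Types (f g h u v w : R -> R).

Local Notation leb := (@lebesgue_measure R).
Local Notation I := (`]a, 1[%classic : set R).

Definition itg f := leb.-integrable I (EFin \o f).
Definition integ f : R := \int[leb]_(x in I) f x.
Definition ip f g : R := integ (fun x => f x * g x).

Lemma measurable_I : measurable (I : set (measurableTypeR R)).
Proof. exact: measurable_itv. Qed.
Hint Resolve measurable_I : core.

Lemma integral_leb1 (f : R -> \bar R) : (forall x, (0 <= f x)%E) ->
  measurable_fun setT f ->
  (\int[leb1 a]_x f x = \int[leb]_(x in I) f x)%E.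
Proof.
move=> f0 mf; rewrite -(setUv I) ge0_integral_setU//.
- rewrite [X in (_ + X)%E]null_set_integral ?adde0.
  + apply: eq_measure_integral => A mA AI.
    by rewrite /leb1/= /mrestr setIidl.
  + exact: measurableC.
  + exact: measurable_funS mf.
  + by rewrite /leb1/= /mrestr setICl measure0.
- exact: measurableC.
- exact: measurable_funS mf.
- by apply/disj_setPCl.
Qed.

Lemma ae_leb_imp (P Q : R -> Prop) : (forall x, P x -> Q x) ->
  {ae leb, forall x, P x} -> {ae leb, forall x, Q x}.
Proof. by move=> PQ; apply: filterS; first exact: (ae_filter_ringOfSetsType leb). Qed.

Lemma ae_leb1P (P : R -> Prop) :
  {ae leb1 a, forall x, P x} <-> {ae leb, forall x, I x -> P x}.
Proof.
split=> -[N [mN N0 sN]].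
- exists (N `&` I); split => //; first exact: measurableI.
  by move=> x /= /not_implyP[Ix nP]; split => //; exact: sN.
- exists (N `|` ~` I); split.
  + by apply: measurableU => //; exact: measurableC.
  + rewrite /leb1/= /mrestr setIUl setICl setU0.
    by apply/eqP; rewrite eq_le measure_ge0 andbT -N0 le_measure// inE//; exact: measurableI.
  + move=> x nP; have [Ix|nIx] := pselect (I x); last by right.
    by left; apply: sN => /= h; apply: nP; exact: h.
Qed.

Lemma ae_eq_leb1P f g :
  f = g %[ae leb1 a] <-> {ae leb, forall x, I x -> f x = g x}.
Proof.
rewrite -ae_leb1P; split=> -[N [mN N0 sN]]; exists N; split => // x /= nH.
  by apply: sN => /= H; apply: nH; exact: H.
by apply: sN => /= H; apply: nH => _; exact: H.
Qed.

(** The content of [f \in L2 a] in terms of the real-valued integral. *)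
Definition sqi f := measurable_fun setT f /\ itg (fun x => f x ^+ 2).

Lemma L2P f : f \in L2 a <-> sqi f.
Proof.
have E : measurable_fun setT f ->
    'N[leb1 a]_2%:E[EFin \o f]%E =
    ((\int[leb]_(x in I) (f x ^+ 2)%:E) `^ 2^-1)%E.
  move=> mf; rewrite unlock; congr (_ `^ _)%E.
  rewrite -integral_leb1.
  - apply: eq_integral => x _ /=.
    by rewrite -[LHS]/((`|f x| `^ 2)%:E) powR_mulrn// -normrX ger0_norm// sqr_ge0.
  - by move=> x; rewrite lee_fin sqr_ge0.
  - apply/measurable_EFinP; exact: measurable_funX.
have J0 : (0 <= \int[leb]_(x in I) (f x ^+ 2)%:E)%E.
  by apply: integral_ge0 => x _; rewrite lee_fin sqr_ge0.
split.
- rewrite inE => /andP[]; rewrite !inE/= /finite_norm => mf fin; split => //.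
  apply/integrableP; split.
    apply/measurable_EFinP; apply: measurable_funX; exact: measurable_funS mf.
  under eq_integral => x _ do rewrite /= ger0_norm ?sqr_ge0//.
  by move: fin; rewrite E// => /lty_poweRy; apply; rewrite invr_eq0.
- move=> [mf /integrableP[_ fin]].
  rewrite inE; apply/andP; split; rewrite !inE//= /finite_norm E// poweR_lty//.
  by move: fin; under eq_integral => x _ do rewrite /= ger0_norm ?sqr_ge0//.
Qed.

Lemma itg_fin f : itg f -> (integ f)%:E = (\int[leb]_(x in I) (f x)%:E)%E.
Proof. by move=> If; rewrite /integ /Rintegral fineK//; exact: integrable_fin_num. Qed.

Lemma L2normE f : sqi f -> L2norm a f = (Num.sqrt (ip f f))%:E.
Proof.
move=> [mf i2]; rewrite /L2norm unlock.
have -> : ip f f = integ (fun x => f x ^+ 2) by [].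
have e0 : 0 <= integ (fun x => f x ^+ 2).
  by apply: Rintegral_ge0 => x _; exact: sqr_ge0.
have -> : (Num.sqrt (integ (fun x => f x ^+ 2)))%:E = sqrte (integ (fun x => f x ^+ 2))%:E by [].
rewrite -poweR12_sqrt ?lee_fin// itg_fin// -integral_leb1.
- congr (_ `^ _)%E; apply: eq_integral => x _ /=.
  by rewrite -[LHS]/((`|f x| `^ 2)%:E) powR_mulrn// -normrX ger0_norm// sqr_ge0.
- by move=> x; rewrite lee_fin sqr_ge0.
- apply/measurable_EFinP; exact: measurable_funX.
Qed.

Lemma itg_cst0 : itg (fun=> 0).
Proof. exact: integrable0. Qed.

Lemma int0 : integ (fun=> 0) = 0.
Proof. by rewrite /integ /Rintegral integral0. Qed.

Lemma itgD f g : itg f -> itg g -> itg (fun x => f x + g x).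
Proof. by move=> If Ig; have := integrableD measurable_I If Ig. Qed.

Lemma itgZ k f : itg f -> itg (fun x => k * f x).
Proof. by move=> If; have := integrableZl measurable_I k If. Qed.

Lemma itgN f : itg f -> itg (fun x => - f x).
Proof. by move=> If; have := integrableN If. Qed.

Lemma itgB f g : itg f -> itg g -> itg (fun x => f x - g x).
Proof. by move=> If Ig; apply: itgD => //; exact: itgN. Qed.

Lemma intD f g : itg f -> itg g -> integ (fun x => f x + g x) = integ f + integ g.
Proof. exact: RintegralD. Qed.

Lemma intB f g : itg f -> itg g -> integ (fun x => f x - g x) = integ f - integ g.
Proof. exact: RintegralB. Qed.

Lemma intZ k f : itg f -> integ (fun x => k * f x) = k * integ f.
Proof. by move=> If; rewrite /integ RintegralZl. Qed.

Lemma intN f : itg f -> integ (fun x => - f x) = - integ f.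
Proof.
move=> If; rewrite -mulN1r -intZ//; congr integ.
by apply/funext => x; rewrite mulN1r.
Qed.

Lemma int_ge0 f : (forall x, a < x < 1 -> 0 <= f x) -> 0 <= integ f.
Proof. by move=> f0; apply: Rintegral_ge0 => x /=; rewrite in_itv; exact: f0. Qed.

Lemma le_int f g : itg f -> itg g -> (forall x, a < x < 1 -> f x <= g x) ->
  integ f <= integ g.
Proof. by move=> If Ig fg; apply: le_Rintegral => // x /=; rewrite in_itv; exact: fg. Qed.

Lemma eq_int f g : (forall x, a < x < 1 -> f x = g x) -> integ f = integ g.
Proof. by move=> fg; apply: eq_Rintegral => x; rewrite inE/= in_itv/=; exact: fg. Qed.

Lemma int_norm f : itg f -> `|integ f| <= integ (fun x => `|f x|).
Proof. exact: le_normr_Rintegral. Qed.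

Lemma itg_norm f : itg f -> itg (fun x => `|f x|).
Proof. by move=> If; have := integrable_abse If. Qed.

Lemma itg_measurable f : itg f -> measurable_fun I f.
Proof. by move=> /integrableP[/measurable_EFinP]. Qed.

Lemma itg_le f g : measurable_fun I f -> (forall x, a < x < 1 -> `|f x| <= g x) ->
  itg g -> itg f.
Proof.
move=> mf fg; apply: le_integrable => //; first exact/measurable_EFinP.
move=> x /=; rewrite in_itv/= => xI; rewrite lee_fin (le_trans (fg _ xI))//.
exact: ler_norm.
Qed.

Lemma measurable_funI f : measurable_fun setT f -> measurable_fun I f.
Proof. exact: measurable_funS. Qed.

Lemma sqi_measurable f : sqi f -> measurable_fun I f.
Proof. by move=> [mf _]; exact: measurable_funI. Qed.

Lemma itgM f g : sqi f -> sqi g -> itg (fun x => f x * g x).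
Proof.
move=> sf sg; apply: (itg_le _ _ (itgD sf.2 sg.2)).
  by apply: measurable_funM; exact: sqi_measurable.
move=> x _; rewrite normrM -(real_normK (num_real (f x))) -(real_normK (num_real (g x))).
have := sqr_ge0 (`|f x| - `|g x|); have := mulr_ge0 (normr_ge0 (f x)) (normr_ge0 (g x)).
nra.
Qed.

Lemma sqiZD k f g : sqi f -> sqi g -> sqi (fun x => k * f x + g x).
Proof.
move=> sf sg; split.
  by apply: measurable_funD; [apply: measurable_funM => //; exact: sf.1|exact: sg.1].
have := itgD (itgZ (k ^+ 2) sf.2) (itgD (itgZ (2 * k) (itgM sf sg)) sg.2).
by congr itg; apply/funext => x; ring.
Qed.

Lemma sqiZ k f : sqi f -> sqi (fun x => k * f x).
Proof.
move=> sf; split; first by apply: measurable_funM => //; exact: sf.1.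
by have := itgZ (k ^+ 2) sf.2; congr itg; apply/funext => x; ring.
Qed.

Lemma sqiD f g : sqi f -> sqi g -> sqi (fun x => f x + g x).
Proof. by move=> sf sg; under eq_fun do rewrite -[f _]mul1r; exact: sqiZD. Qed.

Lemma sqiB f g : sqi f -> sqi g -> sqi (fun x => f x - g x).
Proof.
move=> sf sg; under eq_fun do rewrite -mulN1r addrC; exact: sqiZD.
Qed.

Lemma sqi0 : sqi (fun=> 0).
Proof.
split; first exact: measurable_cst.
by have := itg_cst0; congr itg; apply/funext => x; rewrite expr0n.
Qed.

Lemma sqi_sum (N : nat) (F : nat -> R -> R) : (forall n, sqi (F n)) ->
  sqi (fun x => \sum_(0 <= n < N) F n x).
Proof.
move=> sF; elim: N => [|N IH].
  by under eq_fun do rewrite big_nil; exact: sqi0.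
by under eq_fun do rewrite big_nat_recr//=; exact: sqiD.
Qed.

Lemma ipC f g : ip f g = ip g f.
Proof. by congr integ; apply/funext => x; rewrite mulrC. Qed.

Lemma ipDl f g h : sqi f -> sqi g -> sqi h ->
  ip (fun x => f x + g x) h = ip f h + ip g h.
Proof.
move=> sf sg sh; rewrite -intD; [|exact: itgM..].
by congr integ; apply/funext => x; rewrite mulrDl.
Qed.

Lemma ipBl f g h : sqi f -> sqi g -> sqi h ->
  ip (fun x => f x - g x) h = ip f h - ip g h.
Proof.
move=> sf sg sh; rewrite -intB; [|exact: itgM..].
by congr integ; apply/funext => x; rewrite mulrBl.
Qed.

Lemma ipZl k f h : sqi f -> sqi h -> ip (fun x => k * f x) h = k * ip f h.
Proof.
move=> sf sh; rewrite -intZ; last exact: itgM.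
by congr integ; apply/funext => x; rewrite mulrA.
Qed.

Lemma ipZr k f h : sqi f -> sqi h -> ip h (fun x => k * f x) = k * ip h f.
Proof. by move=> sf sh; rewrite ipC ipZl// ipC. Qed.

Lemma ipDr f g h : sqi f -> sqi g -> sqi h ->
  ip h (fun x => f x + g x) = ip h f + ip h g.
Proof. by move=> sf sg sh; rewrite ipC ipDl// !(ipC h). Qed.

Lemma ipBr f g h : sqi f -> sqi g -> sqi h ->
  ip h (fun x => f x - g x) = ip h f - ip h g.
Proof. by move=> sf sg sh; rewrite ipC ipBl// !(ipC h). Qed.

Lemma ip_suml (N : nat) (F : nat -> R -> R) h : (forall n, sqi (F n)) -> sqi h ->
  ip (fun x => \sum_(0 <= n < N) F n x) h = \sum_(0 <= n < N) ip (F n) h.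
Proof.
move=> sF sh; elim: N => [|N IH].
  rewrite big_nil (_ : ip _ _ = integ (fun=> 0)); last first.
    by congr integ; apply/funext => x; rewrite big_nil mul0r.
  by rewrite /integ /Rintegral integral0.
rewrite big_nat_recr//= -IH -ipDl//; last exact: sqi_sum.
by congr ip; apply/funext => x; rewrite big_nat_recr.
Qed.

Lemma ip_ge0 f : 0 <= ip f f.
Proof. by apply: int_ge0 => x _; rewrite -expr2 sqr_ge0. Qed.

Lemma ip_sqB f g : sqi f -> sqi g ->
  ip (fun x => f x - g x) (fun x => f x - g x) = ip f f - 2 * ip f g + ip g g.
Proof.
move=> sf sg; have sfg := sqiB sf sg.
by rewrite ipBl// !ipBr// (ipC g f); ring.
Qed.

Lemma ip_sqD f g : sqi f -> sqi g ->
  ip (fun x => f x + g x) (fun x => f x + g x) = ip f f + 2 * ip f g + ip g g.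
Proof.
move=> sf sg; have sfg := sqiD sf sg.
by rewrite ipDl// !ipDr// (ipC g f); ring.
Qed.

Lemma cauchy_schwarz f g : sqi f -> sqi g -> ip f g ^+ 2 <= ip f f * ip g g.
Proof.
move=> sf sg.
have Q k : 0 <= ip f f - 2 * (k * ip f g) + k ^+ 2 * ip g g.
  have skg := sqiZ k sg.
  have := ip_ge0 (fun x => f x - k * g x); rewrite ip_sqB//.
  by rewrite ipZl// !ipZr// (mulrA k k) -expr2.
have := ip_ge0 g; rewrite le_eqVlt => /predU1P[g0|g0].
  rewrite -g0 mulr0.
  have [->|b0] := eqVneq (ip f g) 0; first by rewrite expr0n.
  have := Q ((ip f f + 1) / (2 * ip f g)); rewrite -g0 mulr0 addr0.
  rewrite (_ : 2 * _ = ip f f + 1); last by field.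
  by lra.
have := Q (ip f g / ip g g).
rewrite (_ : _ + _ = ip f f - ip f g ^+ 2 / ip g g); last first.
  by field; rewrite gt_eqF.
by rewrite subr_ge0 ler_pdivrMr.
Qed.

Lemma ae_ip f g h : measurable_fun setT f -> measurable_fun setT g ->
  measurable_fun setT h -> f = g %[ae leb1 a] -> ip f h = ip g h.
Proof.
move=> mf mg mh fg; rewrite /ip /integ /Rintegral; congr fine.
apply: ae_eq_integral => //.
- by apply/measurable_EFinP; apply: measurable_funM; exact: measurable_funI.
- by apply/measurable_EFinP; apply: measurable_funM; exact: measurable_funI.
- by move/ae_eq_leb1P : fg; apply: ae_leb_imp => x H Ix; rewrite H.
Qed.

Lemma ip_eq0_ae f g : sqi f -> sqi g ->
  ip (fun x => f x - g x) (fun x => f x - g x) = 0 -> f = g %[ae leb1 a].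
Proof.
move=> sf sg z; have [mfg ifg] := sqiB sf sg.
have : (\int[leb]_(x in I) `|((f x - g x) ^+ 2)%:E| = 0)%E.
  transitivity (integ (fun x => (f x - g x) ^+ 2))%:E; last by rewrite [integ _]z.
  rewrite itg_fin//.
  by apply: eq_integral => x _; rewrite gee0_abs// lee_fin sqr_ge0.
move/ae_eq_integral_abs => /=.
have m2 : measurable_fun I (fun x => ((f x - g x) ^+ 2)%:E).
  by apply/measurable_EFinP/measurable_funX; exact: measurable_funI.
move=> /(_ measurable_I m2) H.
apply/ae_eq_leb1P; move: H; apply: ae_leb_imp => x H Ix; have [/eqP] := H Ix.
by rewrite sqrf_eq0 subr_eq0 => /eqP.
Qed.

End IntervalIntegral.

Section Dominated.
Context {R : realType}.
Variable a : R.
Hypothesis a1 : a < 1.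
Implicit Types (f g v w : R -> R).
Local Notation I := (`]a, 1[%classic : set R).

Lemma int_dominated (F : nat -> R -> R) f g :
  (forall n, measurable_fun I (F n)) -> measurable_fun I f ->
  (forall x, a < x < 1 -> F^~ x @ \oo --> f x) ->
  itg a g -> (forall n x, a < x < 1 -> `|F n x| <= g x) ->
  integ a (F n) @[n --> \oo] --> integ a f.
Proof.
move=> mF mf Ff ig Fg.
have inI x : I x -> a < x < 1 by rewrite /= in_itv.
have [] := @dominated_convergence _ (measurableTypeR R) R lebesgue_measure I (measurable_I a)
  (fun n x => (F n x)%:E) (EFin \o f) (EFin \o g) _ _ _ ig _.
- by move=> n; apply/measurable_EFinP; exact: mF.
- by apply/measurable_EFinP; exact: mf.
- by apply: aeW => x /inI xI; apply: cvg_EFin; [exact: nearW|exact: Ff].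
- by apply: aeW => x n /inI xI; rewrite lee_fin Fg.
move=> If _ H; apply: fine_cvg; rewrite fineK; first exact: H.
exact: integrable_fin_num If.
Qed.

End Dominated.

Section Antiderivative.
Context {R : realType}.
Variable g : R -> R.
Hypothesis cg : continuous g.

(** The integrals from [c] to [x], normalised to vanish at 0, do not depend on
    [c] below [min x 0]; letting [c] depend on [x] gives one function on the
    whole line. *)
Lemma antiderivative : exists G : R -> R, forall x : R, is_derive x 1 G (g x).
Proof.
pose Q (c x : R) := \int[lebesgue_measure]_(t in `[c, x]) g t.
have ig (c x : R) : lebesgue_measure.-integrable `[c, x] (EFin \o g).
  apply: continuous_compact_integrable; first exact: segment_compact.
  exact: continuous_subspaceT.
have chasles c d x : c <= d -> d <= x -> Q c x = Q c d + Q d x.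
  move=> cd dx; rewrite /Q -(Rintegral_itv_obnd_cbnd (r := d)); last first.
    apply: integrableS (ig d x) => //.
    by move=> y /=; rewrite !in_itv/= => /andP[/ltW-> ->].
  by rewrite -(Rintegral_itvB (ig c x)) ?bnd_simp// addrC subrK.
pose F (c x : R) := Q c x - Q c 0.
have FF (c d x : R) : c <= d -> d <= x -> d <= 0 -> F c x = F d x.
  move=> cd dx d0; rewrite /F (chasles c d x)// (chasles c d 0)//; ring.
pose G x := F (- (`|x| + 1)) x.
have GF (c x : R) : c < - (`|x| + 1) -> G x = F c x.
  move=> cx; rewrite /G -(FF c)//; first exact: ltW.
  have := ler_norm (- x); rewrite normrN; lra.
exists G => x.
pose c : R := - (`|x| + 3).
have cx : c < x by rewrite /c; have := ler_norm (- x); rewrite normrN; lra.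
have xx : x < x + 1 by rewrite ltrDl.
have [d e] := continuous_FTC1_closed xx (ig c (x + 1)) cx (@cg x).
rewrite derive1E in e.
have dQ : is_derive x 1 (Q c) (g x) by exact: DeriveDef d e.
have dF : is_derive x 1 (F c) (g x).
  by apply: is_derive_eq; rewrite subr0.
apply: (near_eq_is_derive _ dF).
near=> y; apply/esym/GF; rewrite /c ltrN2.
have : `|y - x| < 1 by near: y; apply/nbhs_ballP; exists 1 => //= z; rewrite /ball/= distrC.
have := ler_normD (y - x) x; rewrite subrK; lra.
Unshelve. all: by end_near. Qed.

End Antiderivative.

(** * Eigenfunctions of the degenerate operator *)
Section Smooth.
Context {R : realType}.
Variable a : R.
Hypothesis a1 : a < 1.
Implicit Types (f g h w G : R -> R) (l x y : R).

Lemma is_derive_continuous f df : (forall x, is_derive x 1 f (df x)) ->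
  continuous f.
Proof. by move=> H x; apply/differentiable_continuous/derivable1_diffP; have [] := H x. Qed.

Lemma continuous_sqr f : continuous f -> continuous (fun x => f x ^+ 2).
Proof. by move=> cf x; apply: cvgM; exact: cf. Qed.

Lemma continuous_itg f : continuous f -> itg a f.
Proof.
move=> cf; rewrite /itg; apply: (@integrableS _ (measurableTypeR R) R lebesgue_measure `[a, 1]%classic) => //.
- by move=> x /=; rewrite !in_itv/= => /andP[/ltW-> /ltW->].
- apply: continuous_compact_integrable; first exact: segment_compact.
  exact: continuous_subspaceT.
Qed.

Lemma continuous_sqi f : continuous f -> sqi a f.
Proof.
move=> cf; split; first exact: continuous_measurable_fun.
by apply: continuous_itg; exact: continuous_sqr.
Qed.

Lemma int_derive G g : (forall x, is_derive x 1 G (g x)) -> continuous g ->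
  integ a g = G 1 - G a.
Proof.
move=> dG cg.
have cG := is_derive_continuous dG.
have ig := continuous_itg cg.
apply: EFin_inj; rewrite itg_fin// EFinB -(@continuous_FTC2 _ g)//.
- rewrite (integral_itv_bndo_bndc (r := 1)).
    by rewrite integral_itv_obnd_cbnd//; apply/measurable_EFinP; exact: measurable_funS (continuous_measurable_fun cg).
  by apply/measurable_EFinP; exact: measurable_funS (continuous_measurable_fun cg).
- exact: continuous_subspaceT.
- split.
  + by move=> x _; have [] := dG x.
  + by apply: cvg_at_right_filter; exact: cG.
  + by apply: cvg_at_left_filter; exact: cG.
- by move=> x _; rewrite derive1E; have [] := dG x.
Qed.

Lemma derive_ge0_le G g x y : x <= y -> (forall z, x < z < y -> is_derive z 1 G (g z)) ->
  {within `[x, y], continuous G} -> (forall z, x < z < y -> 0 <= g z) -> G x <= G y.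
Proof.
move=> xy dG cG g0.
move: xy; rewrite le_eqVlt => /predU1P[->//|xy].
have dG' z : z \in `]x, y[ -> is_derive z 1 G (g z) by rewrite in_itv; exact: dG.
have [c] := MVT xy dG' cG; rewrite in_itv/= => cxy E.
by rewrite -subr_ge0 E mulr_ge0 ?g0// subr_ge0 ltW.
Qed.

Definition theta l x := bes 0 (l * (x - a)).
Definition dtheta l x := l * bes 1 (l * (x - a)).
(** The function [theta l] is the solution, regular at [a], of
    [flux' = - l * theta]. *)
Definition flux l x := (x - a) * dtheta l x.

Lemma is_derive_theta l x : is_derive x 1 (theta l) (dtheta l x).
Proof.
have d0 := is_derive_bes 0 (l * (x - a)).
have d1 : is_derive x 1 (fun x => l * (x - a)) l.
  by apply: is_derive_eq; rewrite /GRing.scale/=; ring.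
have := @is_derive1_comp _ (bes 0) (fun x => l * (x - a)) x _ _ d0 d1.
by move=> H; apply: (@is_derive_eq _ _ _ _ _ _ _ _ H); rewrite /dtheta mulrC.
Qed.

Lemma is_derive_flux l x : is_derive x 1 (flux l) (- (l * theta l x)).
Proof.
have d0 := is_derive_mul_bes1 (l * (x - a)).
have d1 : is_derive x 1 (fun x => l * (x - a)) l.
  by apply: is_derive_eq; rewrite /GRing.scale/=; ring.
have := @is_derive1_comp _ (fun s => s * bes 1 s) (fun x => l * (x - a)) x _ _ d0 d1.
rewrite (_ : _ \o _ = flux l); last first.
  by apply/funext => y; rewrite /flux /dtheta /=; ring.
by move=> H; apply: (@is_derive_eq _ _ _ _ _ _ _ _ H); rewrite /theta; ring.
Qed.

Lemma continuous_theta l : continuous (theta l).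
Proof. exact: is_derive_continuous (is_derive_theta l). Qed.

Lemma continuous_flux l : continuous (flux l).
Proof. exact: is_derive_continuous (is_derive_flux l). Qed.

Lemma continuous_dtheta l : continuous (dtheta l).
Proof.
move=> x; apply: cvgMl_tmp; apply: (@continuous_comp _ _ _ (fun x => l * (x - a)) (bes 1)).
  by apply: cvgMl_tmp; apply: cvgB; [exact: cvg_id|exact: cvg_cst].
exact: is_derive_continuous (is_derive_bes 1) _.
Qed.

Lemma theta_a l : theta l a = 1.
Proof. by rewrite /theta subrr mulr0 bes0_0. Qed.

Lemma flux_a l : flux l a = 0.
Proof. by rewrite /flux subrr mul0r. Qed.

Lemma green_theta w dw l : (forall x, is_derive x 1 w (dw x)) -> continuous dw ->
  integ a (fun x => dw x * flux l x) = w 1 * flux l 1 + l * ip a w (theta l).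
Proof.
move=> dW cdw; have cw := is_derive_continuous dW.
have d x : is_derive x 1 (fun x => w x * flux l x)
    (dw x * flux l x - l * (w x * theta l x)).
  have dwx := dW x; have dq := is_derive_flux l x.
  by apply: is_derive_eq; rewrite /GRing.scale/=; ring.
have c1 : continuous (fun x => dw x * flux l x).
  by move=> x; apply: cvgM; [exact: cdw|exact: continuous_flux].
have c2 : continuous (fun x => w x * theta l x).
  by move=> x; apply: cvgM; [exact: cw|exact: continuous_theta].
have c3 : continuous (fun x => l * (w x * theta l x)).
  by move=> x; apply: cvgMl_tmp; exact: c2.
have := int_derive d.
rewrite intB ?intZ; [|exact: continuous_itg..].
rewrite flux_a mulr0 subr0 => <-; first by rewrite subrK.
by move=> x; apply: cvgB; [exact: c1|exact: c3].
Qed.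

(** The derivative [l * theta l ^ 2] of this energy is nonnegative, which yields
    the norm of [theta l], pointwise bounds and the simplicity of the zeros. *)
Definition pohozaev l x := flux l x ^+ 2 + l * (x - a) * theta l x ^+ 2.

Lemma is_derive_pohozaev l x : is_derive x 1 (pohozaev l) (l * theta l x ^+ 2).
Proof.
have d1 := is_derive_theta l x; have d2 := is_derive_flux l x.
rewrite (_ : pohozaev l = (fun x => flux l x * flux l x +
    l * (x - a) * (theta l x * theta l x))); last by apply/funext => y; rewrite -!expr2.
by apply: is_derive_eq; rewrite /GRing.scale/= /flux; ring.
Qed.

Lemma pohozaev_a l : pohozaev l a = 0.
Proof. by rewrite /pohozaev flux_a subrr mulr0 mul0r addr0 expr0n. Qed.

Lemma int_theta_sq l : l * ip a (theta l) (theta l) = pohozaev l 1.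
Proof.
rewrite -[RHS]subr0 -(pohozaev_a l).
have ct : continuous (fun x => l * (theta l x ^+ 2)).
  move=> x; apply: cvgMl_tmp; apply: continuous_sqr; exact: continuous_theta.
rewrite -(int_derive (is_derive_pohozaev l) ct) intZ//.
by apply: continuous_itg => x; apply: continuous_sqr; exact: continuous_theta.
Qed.

Lemma pohozaev_le l x y : 0 <= l -> x <= y -> pohozaev l x <= pohozaev l y.
Proof.
move=> l0 xy.
apply: (derive_ge0_le xy (fun z _ => is_derive_pohozaev l z)).
  by apply: continuous_subspaceT; exact: is_derive_continuous (is_derive_pohozaev l).
by move=> z _; rewrite mulr_ge0// sqr_ge0.
Qed.

(** Zeros of [theta] are simple: where [theta] and its flux vanish together the
    monotone energy vanishes all the way down to [a], where [theta] equals 1. *)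
Lemma flux_neq0 l x : 0 < l -> a < x -> theta l x = 0 -> flux l x != 0.
Proof.
move=> l0 ax tx; apply/negP => /eqP fx.
have px : pohozaev l x = 0 by rewrite /pohozaev tx fx !expr0n/= mulr0 addr0.
have tz z : a < z <= x -> theta l z = 0.
  move=> /andP[az zx]; apply/eqP; rewrite -sqrf_eq0 eq_le sqr_ge0 andbT.
  have := pohozaev_le (ltW l0) zx; rewrite px /pohozaev => H.
  rewrite -(pmulr_rle0 _ (_ : 0 < l * (z - a))); last by rewrite mulr_gt0// subr_gt0.
  by apply: le_trans H; rewrite lerDr sqr_ge0.
have c1 : theta l z @[z --> a^'+] --> (1 : R).
  by rewrite -(theta_a l); apply: cvg_at_right_filter; exact: continuous_theta.
have c0 : theta l z @[z --> a^'+] --> (0 : R).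
  apply: cvg_near_cst; near=> z; apply: tz; apply/andP; split; near: z.
    exact: nbhs_right_gt.
  exact: nbhs_right_le.
have e1 := cvg_lim (@norm_hausdorff _ _) c1.
rewrite (cvg_lim (@norm_hausdorff _ _) c0) in e1.
by have := oner_neq0 R; rewrite -e1 eqxx.
Unshelve. all: by end_near. Qed.

End Smooth.

(** * Picone's identity *)
Section Picone.
Context {R : realType}.
Variable a : R.
Hypothesis a1 : a < 1.
Variables (l : R) (w dw : R -> R).
Hypothesis l0 : 0 < l.
Hypothesis dW : forall x : R, is_derive x 1 w (dw x).
Hypothesis cdw : continuous dw.
Hypothesis w0 : forall x : R, a < x <= 1 -> theta a l x = 0 -> w x = 0.

Let cw : continuous w := is_derive_continuous dW.
Let B x := flux a l x * (w x ^+ 2 / theta a l x).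

(** At a zero of [theta] the numerator has a double zero and, by [flux_neq0],
    the denominator a simple one, so that [B] extends continuously by the
    value 0 of the division. *)
Let B_continuous x : a <= x <= 1 -> {for x, continuous B}.
Proof.
move=> /andP[ax x1].
have [tx|tx] := eqVneq (theta a l x) 0; last first.
  apply: cvgM; first exact: continuous_flux.
  apply: cvgM; first by apply: cvgM; exact: cw.
  by apply: cvgV => //; exact: continuous_theta.
have ax' : a < x.
  rewrite lt_neqAle ax andbT; apply: contra_eqN tx => /eqP <-.
  by rewrite theta_a oner_neq0.
have wx : w x = 0 by apply: w0 => //; rewrite ax' x1.
have qw := is_derive_quotient (dW x).
have qt := is_derive_quotient (is_derive_theta a l x).
have dt0 : dtheta a l x != 0.
  have := flux_neq0 l0 ax' tx; rewrite /flux; apply: contraNneq => ->.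
  by rewrite mulr0.
have Bx : B x = 0 by rewrite /B wx expr0n/= mul0r mulr0.
have c1 : B (x + h) @[h --> 0^'] --> B x.
  have cf (f : R -> R) : continuous f -> f (x + h) @[h --> 0^'] --> f x.
    move=> cf; have c : f (x + h) @[h --> (0 : R)] --> f (x + 0).
      apply: (@continuous_comp _ _ _ (fun h => x + h) f); last exact: cf.
      by apply: cvgD; [exact: cvg_cst|exact: cvg_id].
    by rewrite addr0 in c; exact: cvg_within_filter c.
  have : flux a l (x + h) * (w (x + h) * ((h^-1 * (w (x + h) - w x)) / (h^-1 * (theta a l (x + h) - theta a l x)))) @[h --> 0^'] --> flux a l x * (w x * (dw x / dtheta a l x)).
    apply: cvgM; first by apply: cf; exact: continuous_flux.
    apply: cvgM; first exact: cf.
    by apply: cvgM => //; apply: cvgV.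
  rewrite {2}wx mul0r mulr0 Bx; apply: cvg_trans; apply: near_eq_cvg; near=> h.
  have h0 : h != 0 by near: h; exact: nbhs_dnbhs_neq.
  rewrite wx tx !subr0 /B expr2; congr (_ * _).
  have [->|t0] := eqVneq (theta a l (x + h)) 0; first by rewrite !(mulr0, invr0).
  by field; rewrite h0 t0.
apply/cvgrPdist_le => /= e e0.
have /cvgrPdist_le/(_ e e0)/nbhs_ballP[d /= d0 hd] := c1.
apply/nbhs_ballP; exists d => //= y xy.
have [->|yx] := eqVneq y x; first by rewrite subrr normr0 ltW.
have -> : y = x + (y - x) by rewrite addrCA subrr addr0.
apply: hd; last by rewrite /= subr_eq0.
by rewrite /ball/= sub0r normrN distrC.
Unshelve. all: by end_near. Qed.

Variable P : R -> R.
Hypothesis dP : forall x : R,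
  is_derive x 1 P ((x - a) * dw x ^+ 2 - l * w x ^+ 2).

Let E x := P x - B x.

Let E_continuous x : a <= x <= 1 -> {for x, continuous E}.
Proof.
move=> x1; apply: cvgB; last exact: B_continuous.
exact: is_derive_continuous dP x.
Qed.

(** Picone's identity: off the zeros of [theta] the derivative of [E] is
    [(x - a) * (w' - w theta' / theta) ^ 2]. *)
Lemma picone_le x y : a <= x -> x <= y -> y <= 1 ->
  (forall z, x < z < y -> theta a l z != 0) -> E x <= E y.
Proof.
move=> ax xy y1 tz.
pose e z := (z - a) * (dw z - w z * dtheta a l z / theta a l z) ^+ 2.
apply: (derive_ge0_le xy (g := e)).
- move=> z /andP[xz zy]; have tz0 := tz z; rewrite xz zy in tz0; have {}tz0 := tz0 isT.
  have d1 := is_derive_theta a l z; have d2 := is_derive_flux a l z.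
  have d3 := dW z; have d4 := dP z.
  have d5 : is_derive z 1 (fun x => (theta a l x)^-1) (- (theta a l z) ^- 2 *: dtheta a l z) by exact: is_deriveV.
  rewrite (_ : E = (fun x => P x - flux a l x * ((w x * w x) * (theta a l x)^-1))) //.
  apply: is_derive_eq; rewrite /GRing.scale/= /e /flux; field.
  by rewrite tz0.
- apply: continuous_in_subspaceT => z; rewrite inE/= in_itv/= => /andP[xz zy].
  by apply: E_continuous; rewrite (le_trans ax xz) (le_trans zy).
- by move=> z /andP[xz zy]; rewrite /e mulr_ge0 ?sqr_ge0// subr_ge0 ltW// (le_lt_trans ax).
Qed.

Lemma picone_end : w 1 = 0 -> E 1 = P 1.
Proof. by move=> w1; rewrite /E /B w1 expr0n/= mul0r mulr0 subr0. Qed.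

Lemma picone_start : E a = P a.
Proof. by rewrite /E /B flux_a mul0r subr0. Qed.

(** [E] increases between consecutive zeros of [theta a l], which are listed in
    order by [p], hence on the whole interval; at the two ends it agrees with
    [P], a primitive of the integrand. *)
Lemma picone_form_ge0 (N : nat) (p : nat -> R) : w 1 = 0 -> p 0%N = a ->
  (forall k, (k < N)%N -> p k <= p k.+1) -> p N <= 1 ->
  (forall k x, (k < N)%N -> p k < x < p k.+1 -> theta a l x != 0) ->
  (forall x, p N < x < 1 -> theta a l x != 0) ->
  0 <= integ a (fun x => (x - a) * dw x ^+ 2 - l * w x ^+ 2).
Proof.
move=> w1 p0 pk pN tk tN.
rewrite (int_derive a1 dP); last first.
  move=> x; apply: cvgB; last by apply: cvgMl_tmp; exact: (continuous_sqr cw).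
  apply: cvgM; last exact: (continuous_sqr cdw).
  by apply: cvgB; [exact: cvg_id|exact: cvg_cst].
rewrite subr_ge0 -picone_start -(picone_end w1).
have up k : (k <= N)%N -> a <= p k /\ p k <= p N.
  move=> kN; split.
    elim: k kN => [|k IH] kN; first by rewrite p0.
    by apply: le_trans (pk _ kN); apply: IH; exact: ltnW.
  elim: N kN pk {pN tk tN} => [|n IH] kN pk; first by rewrite leqn0 in kN; rewrite (eqP kN).
  move: kN; rewrite leq_eqVlt => /predU1P[->//|kn].
  apply: le_trans (pk n (ltnSn n)); apply: IH => // i ni.
  by apply: pk; exact: leqW.
have Ek k : (k <= N)%N -> E a <= E (p k).
  elim: k => [|k IH] kN; first by rewrite p0.
  apply: le_trans (IH (ltnW kN)) _.
  have [ak _] := up _ (ltnW kN); have [_ kN'] := up _ kN.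
  apply: picone_le => //; first exact: pk.
  - by rewrite (le_trans kN').
  - by move=> z; exact: tk.
apply: le_trans (Ek N (leqnn N)) _.
apply: picone_le => //.
by have [] := up _ (leqnn N).
Qed.

End Picone.

(** * Completeness of the eigenfunctions *)

(** There are [N.+1] unknowns for [N] linear equations. *)
Lemma exists_combination (R : fieldType) (N : nat) (f : nat -> nat -> R) :
  exists v : nat -> R, (exists2 k, (k <= N)%N & v k != 0) /\
    forall i, (i < N)%N -> \sum_(0 <= k < N.+1) v k * f k i = 0.
Proof.
pose M : 'M[R]_(N.+1, N) := \matrix_(k, i) f k i.
have kM : kermx M != 0.
  rewrite -mxrank_eq0 mxrank_ker subn_eq0 -ltnNge ltnS.
  exact: rank_leq_col.
pose u := nz_row (kermx M).
have u0 : u != 0 by rewrite nz_row_eq0.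
have uM : u *m M = 0 by apply/sub_kermxP; exact: nz_row_sub.
exists (fun k => u 0 (inord k)); split.
  have [k uk] : exists k, u 0 k != 0.
    apply/existsP; apply: contraR u0; rewrite negb_exists => /forallP z.
    by apply/eqP/rowP => k; rewrite mxE; apply/eqP; rewrite -[_ == _]negbK z.
  by exists k; [rewrite -ltnS ltn_ord|rewrite inord_val].
move=> i iN; have := congr1 (fun A : 'rV_N => A 0 (Ordinal iN)) uM.
rewrite !mxE big_mkord => E; rewrite -[RHS]E; apply: eq_bigr => k _.
by rewrite mxE inord_val.
Qed.

Lemma ip_sum_orth (R : realType) (a : R) (N : nat) (v : nat -> R) (F G : nat -> R -> R) :
  (forall k, sqi a (F k)) -> (forall k, sqi a (G k)) ->
  (forall k m, (k < N)%N -> (m < N)%N -> k != m -> ip a (F k) (G m) = 0) ->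
  ip a (fun x => \sum_(0 <= k < N) v k * F k x)
       (fun x => \sum_(0 <= k < N) v k * G k x) =
  \sum_(0 <= k < N) v k ^+ 2 * ip a (F k) (G k).
Proof.
move=> sF sG orth.
have svF k : sqi a (fun x => v k * F k x) by exact: sqiZ.
have svG k : sqi a (fun x => v k * G k x) by exact: sqiZ.
have sG' : sqi a (fun x => \sum_(0 <= k < N) v k * G k x) by exact: (sqi_sum N svG).
rewrite (ip_suml N svF sG'); apply: eq_big_nat => k /andP[_ kN].
rewrite ipZl// ipC (ip_suml N svG (sF k)) (bigD1_seq k) ?mem_index_iota ?iota_uniq//=.
rewrite big1_seq ?addr0.
  by rewrite ipZl// (ipC _ (G k)) mulrA -expr2.
move=> m /andP[mk]; rewrite mem_index_iota => /andP[_ mN].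
by rewrite ipZl// ipC orth ?mulr0// eq_sym.
Qed.

Lemma is_derive_sum_nat (R : realType) (N : nat) (F dF : nat -> R -> R) (x : R) :
  (forall k, is_derive x 1 (F k) (dF k x)) ->
  is_derive x 1 (fun y => \sum_(0 <= k < N) F k y) (\sum_(0 <= k < N) dF k x).
Proof.
move=> dF_; elim: N => [|N IH].
  rewrite big_nil (_ : (fun _ => _) = cst 0); first exact: is_derive_cst.
  by apply/funext => y; rewrite big_nil.
rewrite big_nat_recr//= (_ : (fun _ => _) =
  (fun y => \sum_(0 <= k < N) F k y + F N y)); first exact: is_deriveD.
by apply/funext => y; rewrite big_nat_recr.
Qed.

(** If [v N] were zero, the subtracted sum would be positive. *)
Lemma last_term_ge0 (R : realFieldType) (N : nat) (v p : nat -> R) (q : R) (k0 : nat) :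
  (k0 <= N)%N -> v k0 != 0 -> (forall k, (k < N)%N -> 0 < p k) ->
  0 <= v N ^+ 2 * q - \sum_(0 <= k < N) v k ^+ 2 * p k -> 0 <= q.
Proof.
move=> k0N vk0 p0 H.
have t0 k : (k < N)%N -> 0 <= v k ^+ 2 * p k.
  by move=> kN; rewrite mulr_ge0 ?sqr_ge0// ltW// p0.
have S0 (P : pred nat) : 0 <= \sum_(0 <= k < N | P k) v k ^+ 2 * p k.
  rewrite big_seq_cond; apply: sumr_ge0 => k /andP[].
  by rewrite mem_index_iota => /andP[_ /t0].
have pos k : v k != 0 -> 0 < v k ^+ 2.
  by move=> vk; rewrite lt_neqAle sqr_ge0 andbT eq_sym sqrf_eq0.
have vN : v N != 0.
  apply/negP => /eqP vN0; move: H; rewrite vN0 expr0n/= mul0r sub0r oppr_ge0 leNgt.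
  have k0N' : (k0 < N)%N.
    by rewrite ltn_neqAle k0N andbT; apply: contraNneq vk0 => ->; rewrite vN0.
  move/negP; apply; rewrite (bigD1_seq k0) ?mem_index_iota ?iota_uniq//=.
  by apply: ltr_wpDr; [exact: S0|rewrite mulr_gt0 ?pos ?p0].
by rewrite -(pmulr_rge0 _ (pos _ vN)) (le_trans H)// gerBl; exact: (S0 xpredT).
Qed.

Lemma normr_sqr_le (R : realDomainType) (x y : R) : `|x| <= y -> `|x ^+ 2| <= y ^+ 2.
Proof.
move=> xy; rewrite normrX ler_pXn2r ?nnegrE//.
exact: le_trans (normr_ge0 x) xy.
Qed.

Lemma continuous_bounded_itv (R : realType) (f : R -> R) (b c : R) : b <= c -> continuous f ->
  exists2 M : R, 0 < M & forall x : R, b <= x <= c -> `|f x| <= M.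
Proof.
move=> bc cf.
have [x1 x1I Hx1] := EVT_max bc (continuous_subspaceT (fun x => cvg_norm (cf x)) : {within `[b, c], continuous (fun x => `|f x|)}).
exists (`|f x1| + 1); first by rewrite ltr_wpDl.
by move=> x xI; rewrite (le_trans (Hx1 x _))// ?lerDl// in_itv.
Qed.

Section Truncation.
Context {R : realType}.
Implicit Types (M x y : R).

Definition trunc M y := Num.max (- M) (Num.min y M).

Lemma trunc_bound M y : 0 <= M -> `|trunc M y| <= M.
Proof.
move=> M0; rewrite ler_norml /trunc le_max lexx/= ge_max ge_min lexx orbT andbT.
by rewrite (le_trans _ M0)// oppr_le0.
Qed.

Lemma trunc_id M y : `|y| <= M -> trunc M y = y.
Proof.
by rewrite ler_norml => /andP[h1 h2]; rewrite /trunc (min_idPl h2) (max_idPr h1).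
Qed.

Lemma trunc_dist M x y : `|x| <= M -> `|x - trunc M y| <= `|x - y|.
Proof.
rewrite ler_norml => /andP[h1 h2]; rewrite /trunc.
have [yM|yM] := leP y M; have [My|My] := leP (- M) _ => //.
- rewrite ger0_norm; last by lra.
  by rewrite ger0_norm; lra.
- rewrite ler0_norm; last by lra.
  by rewrite ler0_norm; lra.
- rewrite ler0_norm; last by lra.
  by rewrite ler0_norm; lra.
Qed.

Lemma trunc_resid M y : 0 <= M -> `|y - trunc M y| <= `|y|.
Proof.
move=> M0; have [yM|yM] := leP `|y| M; first by rewrite trunc_id ?subrr ?normr0.
have [y0|y0] := leP 0 y.
  rewrite ger0_norm // in yM; rewrite /trunc (min_idPr (ltW yM)) max_r; last by lra.
  by rewrite !ger0_norm//; lra.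
rewrite ltr0_norm // in yM; rewrite /trunc min_l; last by lra.
rewrite max_l; last by lra.
by rewrite !ler0_norm//; lra.
Qed.

Lemma continuous_trunc M (g : R -> R) : continuous g -> continuous (fun x => trunc M (g x)).
Proof.
move=> cg x; apply: (@continuous_max _ _ (cst (- M)) (fun x => Num.min (g x) M)).
  exact: cvg_cst.
by apply: (@continuous_min _ _ g (cst M)); [exact: cg|exact: cvg_cst].
Qed.

Lemma measurable_trunc M (g : R -> R) : measurable_fun setT g ->
  measurable_fun setT (fun x => trunc M (g x)).
Proof.
move=> mg; apply: measurableT_comp mg => //.
by apply: continuous_measurable_fun; apply: continuous_trunc => x; exact: cvg_id.
Qed.

End Truncation.

Section Spectrum.
Context {R : realType}.
Variable a : R.
Hypothesis a1 : a < 1.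
Variable mu : nat -> R.
Hypothesis mu_gt0 : forall n, 0 < mu n.
Hypothesis mu_lt : forall m n, (m < n)%N -> mu m < mu n.
Hypothesis mu_root : forall n, bes 0 (mu n) = 0.
Hypothesis mu_all : forall s : R, 0 < s -> bes 0 s = 0 -> exists n, s = mu n.

(** Scaled so that [theta a (lam n)] vanishes at 1, the positive zeros of [bes 0]
    being the [mu n]. *)
Definition lam n := mu n / (1 - a).
Definition psi n := theta a (lam n).
Definition dpsi n := dtheta a (lam n).
Definition nsq n := ip a (psi n) (psi n).

Let a10 : 0 < 1 - a. Proof. by rewrite subr_gt0. Qed.

Lemma mu_ltE m n : (mu m < mu n) = (m < n)%N.
Proof.
have [mn|nm|->] := ltngtP m n; rewrite ?ltxx//; first by rewrite mu_lt.
by apply/negbTE; rewrite -leNgt ltW// mu_lt.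
Qed.

Lemma lam_gt0 n : 0 < lam n.
Proof. by rewrite divr_gt0. Qed.

Lemma lam_lt m n : (m < n)%N -> lam m < lam n.
Proof. by move=> mn; rewrite ltr_pM2r ?invr_gt0// mu_lt. Qed.

Lemma lam_inj : injective lam.
Proof.
move=> m n mn; have [/lam_lt|/lam_lt|//] := ltngtP m n; by rewrite mn ltxx.
Qed.

Lemma psi_1 n : psi n 1 = 0.
Proof. by rewrite /psi /theta /lam divfK ?gt_eqF. Qed.

Lemma is_derive_psi n (x : R) : is_derive x 1 (psi n) (dpsi n x).
Proof. exact: is_derive_theta. Qed.

Lemma continuous_psi n : continuous (psi n).
Proof. exact: continuous_theta. Qed.

Lemma continuous_dpsi n : continuous (dpsi n).
Proof. exact: continuous_dtheta. Qed.

Lemma sqi_psi n : sqi a (psi n).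
Proof. by apply: continuous_sqi => //; exact: continuous_psi. Qed.

Lemma green_psi (w dw : R -> R) n : (forall x : R, is_derive x 1 w (dw x)) -> continuous dw ->
  w 1 = 0 -> integ a (fun x => dw x * flux a (lam n) x) = lam n * ip a w (psi n).
Proof. by move=> dW cdw w1; rewrite (green_theta a1 _ dW)// w1 mul0r add0r. Qed.

Lemma ip_psi_orth m n : m != n -> ip a (psi m) (psi n) = 0.
Proof.
move=> mn.
have E1 := green_psi n (is_derive_psi m) (@continuous_dpsi m) (psi_1 m).
have E2 := green_psi m (is_derive_psi n) (@continuous_dpsi n) (psi_1 n).
have E : lam n * ip a (psi m) (psi n) = lam m * ip a (psi m) (psi n).
  rewrite -E1 (ipC _ (psi m)) -E2; congr integ; apply/funext => x.
  by rewrite /flux /dpsi; ring.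
apply/eqP; have /eqP := E; rewrite -subr_eq0 -mulrBl mulf_eq0 subr_eq0.
by case/orP => // /eqP/lam_inj/eqP; rewrite eq_sym (negbTE mn).
Qed.

Lemma nsqE n : lam n * nsq n = flux a (lam n) 1 ^+ 2.
Proof.
rewrite /nsq int_theta_sq// /pohozaev -[theta a (lam n) 1]/(psi n 1) psi_1.
by rewrite expr0n/= mulr0 addr0.
Qed.

Lemma flux_1_neq0 n : flux a (lam n) 1 != 0.
Proof. exact: (flux_neq0 (lam_gt0 n) a1 (psi_1 n)). Qed.

Lemma nsq_gt0 n : 0 < nsq n.
Proof.
rewrite -(pmulr_rgt0 _ (lam_gt0 n)) nsqE lt_neqAle sqr_ge0 andbT eq_sym.
by rewrite sqrf_eq0 flux_1_neq0.
Qed.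

(** Pointwise bounds, from the monotonicity of the energy. *)
Lemma psi_bound n x : a <= x <= 1 -> (x - a) * psi n x ^+ 2 <= nsq n.
Proof.
move=> /andP[ax x1]; rewrite -(ler_pM2l (lam_gt0 n)) nsqE.
have := pohozaev_le a (ltW (lam_gt0 n)) x1.
rewrite {2}/pohozaev -[theta a (lam n) 1]/(psi n 1) psi_1 expr0n/= mulr0 addr0.
by apply: le_trans; rewrite /pohozaev mulrA lerDr sqr_ge0.
Qed.

Lemma flux_bound n x : a <= x <= 1 -> flux a (lam n) x ^+ 2 <= lam n * nsq n.
Proof.
move=> /andP[ax x1]; rewrite nsqE.
have := pohozaev_le a (ltW (lam_gt0 n)) x1.
rewrite {2}/pohozaev -[theta a (lam n) 1]/(psi n 1) psi_1 expr0n/= mulr0 addr0.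
apply: le_trans; rewrite /pohozaev lerDl mulr_ge0 ?sqr_ge0// mulr_ge0 ?subr_ge0//.
exact/ltW/lam_gt0.
Qed.

Lemma int_psi n : lam n * integ a (psi n) = - flux a (lam n) 1.
Proof.
have cl : continuous (fun x => - (lam n * psi n x)).
  by move=> x; apply: cvgN; apply: cvgMl_tmp; exact: continuous_psi.
have := int_derive a1 (is_derive_flux a (lam n)) cl.
rewrite flux_a subr0 => <-; rewrite intN ?opprK ?intZ//.
  by apply: continuous_itg => //; exact: continuous_psi.
by apply: continuous_itg => // x; apply: cvgMl_tmp; exact: continuous_psi.
Qed.

Lemma theta_zero l x : 0 < l -> a < x -> theta a l x = 0 ->
  exists n, x = a + mu n / l.
Proof.
move=> l0 ax tx; have [|n E] := mu_all _ tx; first by rewrite mulr_gt0// subr_gt0.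
by exists n; rewrite -E; field; rewrite gt_eqF.
Qed.

(** For these [l] the zeros of [theta a l] in [ ]a, 1] ] are the [a + mu k / l]
    with [k < N], and [w] vanishes at all of them, so that Picone's identity
    applies. *)
Lemma form_ge0 N l (w dw : R -> R) : 0 < l -> (forall k, (k < N)%N -> mu k < l * (1 - a)) ->
  l * (1 - a) < mu N -> (forall x : R, is_derive x 1 w (dw x)) -> continuous dw ->
  w 1 = 0 -> (forall k, (k < N)%N -> w (a + mu k / l) = 0) ->
  l * ip a w w <= integ a (fun x => (x - a) * dw x ^+ 2).
Proof.
move=> l0 mul muN dW cdw w1 w0.
have cw := is_derive_continuous dW.
have c1 : continuous (fun x => (x - a) * dw x ^+ 2).
  move=> x; apply: cvgM; last exact: (continuous_sqr cdw).
  by apply: cvgB; [exact: cvg_id|exact: cvg_cst].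
have c2 : continuous (fun x => l * w x ^+ 2).
  by move=> x; apply: cvgMl_tmp; exact: (continuous_sqr cw).
have c3 : continuous (fun x => (x - a) * dw x ^+ 2 - l * w x ^+ 2).
  by move=> x; apply: cvgB; [exact: c1|exact: c2].
have [P dP] := antiderivative (@c3).
have l_mu n x : l * (x - a) = mu n -> x = a + mu n / l.
  by move=> <-; field; rewrite gt_eqF.
have zlt x n : x <= 1 -> l * (x - a) = mu n -> (n < N)%N.
  move=> x1 E; rewrite -mu_ltE -E; apply: le_lt_trans muN.
  by rewrite ler_pM2l// lerD2r.
have wz x : a < x <= 1 -> theta a l x = 0 -> w x = 0.
  move=> xI tx; have ax : a < x by case/andP: xI.
  have [n E] := theta_zero l0 ax tx.
  have E' : l * (x - a) = mu n by rewrite E; field; rewrite gt_eqF.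
  by rewrite E w0//; apply: zlt E'; case/andP: xI.
pose p k := if k is k'.+1 then a + mu k' / l else a.
have := @picone_form_ge0 R a a1 l w dw l0 dW cdw wz P dP N p w1 erefl.
rewrite intB; [|exact: continuous_itg..].
rewrite intZ; last by apply: continuous_itg => //; exact: (continuous_sqr cw).
rewrite subr_ge0 => /(_ _ _ _ _)/=; apply.
- move=> [|k] kN /=; first by rewrite lerDl divr_ge0 ?ltW.
  by rewrite lerD2l ler_pM2r ?invr_gt0// ltW// mu_lt.
- rewrite /p; case: (N) mul => [|k] mul; first exact: ltW.
  by rewrite -lerBrDl ler_pdivrMr// mulrC ltW// mul.
- move=> k x kN /andP[px xp]; apply/negP => /eqP tx.
  have ax : a < x.
    by case: k kN px {xp} => [//|k] _; apply: lt_trans; rewrite ltrDl divr_gt0.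
  have [n E] := theta_zero l0 ax tx.
  have kn : (n < k)%N.
    by move: xp; rewrite E ltrD2l ltr_pM2r ?invr_gt0// mu_ltE.
  case: k kn px {kN xp} => // k kn; rewrite /= E ltrD2l ltr_pM2r ?invr_gt0// mu_ltE.
  by rewrite ltnNge -ltnS kn.
- move=> x /andP[px x1]; apply/negP => /eqP tx.
  have ax : a < x.
    by case: (N) px => [//|k]; apply: lt_trans; rewrite ltrDl divr_gt0.
  have [n E] := theta_zero l0 ax tx.
  have nN : (n < N)%N by apply: zlt (ltW x1) _; rewrite E; field; rewrite gt_eqF.
  case: (N) nN px => // k kn; rewrite /= E ltrD2l ltr_pM2r ?invr_gt0// mu_ltE.
  by rewrite ltnNge -ltnS kn.
Qed.

(** The form [int (x - a) * w' ^ 2 - l * int w ^ 2] is nonnegative at a nonzero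
    combination [w] of [r] and the [psi k] that vanishes at the zeros of
    [theta a l]. It splits along the terms of [w], and each [psi k] contributes
    a multiple of [lam k - l < 0], so that the contribution of [r] is
    nonnegative. *)
Lemma courant N l (r dr : R -> R) : 0 < l ->
  (forall k, (k < N)%N -> mu k < l * (1 - a)) -> l * (1 - a) < mu N ->
  (forall x : R, is_derive x 1 r (dr x)) -> continuous dr -> r 1 = 0 ->
  (forall k, (k < N)%N -> ip a r (psi k) = 0) ->
  l * ip a r r <= integ a (fun x => (x - a) * dr x ^+ 2).
Proof.
move=> l0 mul muN dR cdr r1 rpsi; have cr := is_derive_continuous dR.
pose F k := if (k < N)%N then psi k else r.
pose dF k := if (k < N)%N then dpsi k else dr.
have dF_ k (x : R) : is_derive x 1 (F k) (dF k x).
  by rewrite /F /dF; case: ifP => _ //; exact: is_derive_psi.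
have cdF k : continuous (dF k).
  by rewrite /dF; case: (k < N)%N => //; exact: continuous_dpsi.
have F1 k : F k 1 = 0 by rewrite /F; case: ifP => _ //; exact: psi_1.
have cF k : continuous (F k) by exact: is_derive_continuous (dF_ k).
have sF k : sqi a (F k) by exact: continuous_sqi.
have orth k m : (k <= N)%N -> (m < N)%N -> k != m -> ip a (F k) (F m) = 0.
  move=> kN mN km; rewrite /F mN; case: ifP => kN'; first exact: ip_psi_orth.
  exact: rpsi.
have [v [[k0 k0N vk0] vz]] := exists_combination N (fun k i => F k (a + mu i / l)).
pose w x := \sum_(0 <= k < N.+1) v k * F k x.
pose dw x := \sum_(0 <= k < N.+1) v k * dF k x.
have dW (x : R) : is_derive x 1 w (dw x).
  apply: (@is_derive_sum_nat _ _ (fun k x => v k * F k x) (fun k x => v k * dF k x)).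
have cdw : continuous dw.
  move=> x; apply: (@cvg_sum_nat _ _ _ _ (fun y k => v k * dF k y) (fun k => v k * dF k x)) => k.
  by apply: cvgMl_tmp; exact: cdF.
have w1 : w 1 = 0 by rewrite /w big1// => k _; rewrite F1 mulr0.
have := form_ge0 l0 mul muN dW cdw w1 vz.
have cxdF k : continuous (fun x => (x - a) * dF k x).
  move=> x; apply: cvgM; last exact: cdF.
  by apply: cvgB; [exact: cvg_id|exact: cvg_cst].
pose D k m := ip a (dF k) (fun x => (x - a) * dF m x).
have DE k m : (m < N)%N -> D k m = lam m * ip a (F k) (F m).
  move=> mN; rewrite /F mN -[if _ then _ else _]/(F k) -(green_psi m (dF_ k) (cdF k) (F1 k)).
  by congr integ; apply/funext => x; rewrite {2}/dF mN.
have DC k m : D k m = D m k.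
  by rewrite /D [RHS]ipC; congr integ; apply/funext => x; ring.
have DO k m : (k < N.+1)%N -> (m < N.+1)%N -> k != m -> D k m = 0.
  rewrite !ltnS => kN; rewrite leq_eqVlt => /predU1P[->|mN] km; last first.
    by rewrite DE// orth ?mulr0.
  have kN' : (k < N)%N by rewrite ltn_neqAle km.
  by rewrite DC DE// orth ?mulr0// eq_sym.
have FO k m : (k < N.+1)%N -> (m < N.+1)%N -> k != m -> ip a (F k) (F m) = 0.
  rewrite !ltnS => kN; rewrite leq_eqVlt => /predU1P[->|mN] km; last exact: orth.
  have kN' : (k < N)%N by rewrite ltn_neqAle km.
  by rewrite ipC orth// eq_sym.
have -> : integ a (fun x => (x - a) * dw x ^+ 2) = \sum_(0 <= k < N.+1) v k ^+ 2 * D k k.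
  rewrite -(@ip_sum_orth _ a N.+1 v dF (fun k x => (x - a) * dF k x))//.
  - congr integ; apply/funext => x; rewrite /dw expr2 mulrCA; congr (_ * _).
    by rewrite mulr_sumr; apply: eq_bigr => k _; rewrite mulrCA.
  - by move=> k; exact: continuous_sqi.
  - by move=> k; exact: continuous_sqi.
rewrite (@ip_sum_orth _ a N.+1 v F F sF sF FO).
rewrite mulr_sumr -subr_ge0 -sumrB big_nat_recr//= addrC => H.
have : 0 <= D N N - l * ip a (F N) (F N).
  apply: (last_term_ge0 (p := fun k => (l - lam k) * nsq k) k0N vk0).
    by move=> k kN; rewrite mulr_gt0 ?nsq_gt0// subr_gt0 ltr_pdivrMr// mul.
  apply: le_trans H _; rewrite le_eqVlt; apply/orP; left; apply/eqP.
  rewrite -sumrN; congr (_ + _); first by ring.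
  apply: eq_big_nat => k /andP[_ kN]; rewrite DE// /nsq /F kN.
  by ring.
rewrite subr_ge0 /D /F /dF ltnn => /le_trans; apply; rewrite le_eqVlt; apply/orP; left.
by apply/eqP; congr integ; apply/funext => x; ring.
Qed.

Definition coef v n := ip a v (psi n) / nsq n.
Definition proj v N x := \sum_(0 <= n < N) coef v n * psi n x.
Definition resid v N x := v x - proj v N x.
Definition res v N := ip a (resid v N) (resid v N).

Lemma sqi_proj v N : sqi a (proj v N).
Proof. by apply: (@sqi_sum _ _ N (fun n x => coef v n * psi n x)) => n; apply: sqiZ; exact: sqi_psi. Qed.

Lemma sqi_resid v N : sqi a v -> sqi a (resid v N).
Proof. by move=> sv; apply: sqiB => //; exact: sqi_proj. Qed.

Lemma ip_proj v N g : sqi a g ->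
  ip a (proj v N) g = \sum_(0 <= n < N) coef v n * ip a g (psi n).
Proof.
move=> sg; rewrite (@ip_suml _ _ N (fun n x => coef v n * psi n x))//; last first.
  by move=> n; apply: sqiZ; exact: sqi_psi.
by apply: eq_bigr => n _; rewrite ipZl//; [rewrite (ipC _ g)|exact: sqi_psi].
Qed.

Lemma ip_resid_psi v N k : sqi a v -> (k < N)%N -> ip a (resid v N) (psi k) = 0.
Proof.
move=> sv kN; rewrite ipBl//; [|exact: sqi_proj|exact: sqi_psi].
rewrite ip_proj; last exact: sqi_psi.
rewrite (bigD1_seq k) ?mem_index_iota ?iota_uniq//= big1 ?addr0.
  by rewrite /coef divfK ?subrr// gt_eqF ?nsq_gt0.
by move=> n nk; rewrite ip_psi_orth ?mulr0// eq_sym.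
Qed.

Lemma ip_resid_proj v w N : sqi a v -> ip a (resid v N) (proj w N) = 0.
Proof.
move=> sv; rewrite ipC ip_proj; last exact: sqi_resid.
rewrite big_nat; apply: big1 => k /andP[_ kN].
by rewrite ip_resid_psi ?mulr0.
Qed.

Lemma resE v N : sqi a v ->
  res v N = ip a v v - \sum_(0 <= n < N) ip a v (psi n) ^+ 2 / nsq n.
Proof.
move=> sv.
have -> : \sum_(0 <= n < N) ip a v (psi n) ^+ 2 / nsq n = ip a (proj v N) (proj v N).
  have := ip_resid_proj v N sv; rewrite ipBl//; [|exact: sqi_proj..].
  move/subr0_eq => <-; rewrite ipC ip_proj//.
  by apply: eq_bigr => n _; rewrite /coef; ring.
have e : v = (fun x => resid v N x + proj v N x) by apply/funext => x; rewrite /resid subrK.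
rewrite {2 3}e ip_sqD; [|exact: sqi_resid|exact: sqi_proj].
by rewrite ip_resid_proj// mulr0 addr0 addrK.
Qed.

Lemma bessel_ineq v N : sqi a v ->
  \sum_(0 <= n < N) ip a v (psi n) ^+ 2 / nsq n <= ip a v v.
Proof. by move=> sv; rewrite -subr_ge0 -resE//; exact: ip_ge0. Qed.

Lemma res_le v N : sqi a v -> res v N <= ip a v v.
Proof.
move=> sv; rewrite resE// gerBl; apply: sumr_ge0 => n _.
by rewrite mulr_ge0 ?sqr_ge0// invr_ge0 ltW// nsq_gt0.
Qed.

Lemma ip_sqD_le f g : sqi a f -> sqi a g ->
  ip a (fun x => f x + g x) (fun x => f x + g x) <= 2 * ip a f f + 2 * ip a g g.
Proof.
move=> sf sg; have := ip_ge0 a (fun x => f x - g x).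
by rewrite ip_sqB// ip_sqD//; lra.
Qed.

Lemma coefB v w n : sqi a v -> sqi a w -> coef (fun x => v x - w x) n = coef v n - coef w n.
Proof. by move=> sv sw; rewrite /coef ipBl//; [rewrite mulrBl|exact: sqi_psi]. Qed.

(** The projections are contractions, whence [res (v - w) N] is at most the
    squared norm of [v - w]. *)
Lemma res_split v w N : sqi a v -> sqi a w ->
  res v N <= 2 * ip a (fun x => v x - w x) (fun x => v x - w x) + 2 * res w N.
Proof.
move=> sv sw; have svw := sqiB sv sw.
have := ip_sqD_le (sqi_resid N svw) (sqi_resid N sw).
rewrite (_ : (fun x => _ + _) = resid v N); last first.
  apply/funext => x; rewrite /resid /proj.
  rewrite (_ : \sum_(0 <= n < N) coef (fun x => v x - w x) n * psi n x =
    \sum_(0 <= n < N) coef v n * psi n x - \sum_(0 <= n < N) coef w n * psi n x); first by ring.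
  by rewrite -sumrB; apply: eq_bigr => n _; rewrite coefB// mulrBl.
move=> /le_trans; apply; rewrite lerD2r ler_pM2l//.
exact: res_le.
Qed.

(** Bessel's inequality for the constant function 1, whose nth term is exactly
    [1 / lam n]. *)
Lemma series_inv_lam_le N : \sum_(0 <= n < N) (lam n)^-1 <= 1 - a.
Proof.
have c1 : continuous (fun _ : R => 1 : R) by move=> x; exact: cvg_cst.
have s1 : sqi a (fun=> 1) by exact: continuous_sqi.
have -> : 1 - a = ip a (fun=> 1) (fun=> 1).
  rewrite /ip (_ : (fun=> 1 * 1) = (fun=> 1)); last by apply/funext => x; rewrite mulr1.
  by rewrite (@int_derive _ a a1 id)// => x.
apply: le_trans (bessel_ineq N s1).
rewrite le_eqVlt; apply/orP; left; apply/eqP; apply: eq_bigr => n _.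
have l0 := lam_gt0 n; have n0 := nsq_gt0 n.
have -> : ip a (fun=> 1) (psi n) = - flux a (lam n) 1 / lam n.
  rewrite -int_psi mulrC mulKf ?gt_eqF//; congr integ.
  by apply/funext => x; rewrite mul1r.
rewrite exprMn sqrrN -nsqE; field.
by rewrite !gt_eqF.
Qed.

Lemma cvg_series_inv_lam : cvgn (series (fun n => (lam n)^-1)).
Proof.
apply: nondecreasing_is_cvgn.
  by apply: nondecreasing_series => n _ _; rewrite invr_ge0 ltW// lam_gt0.
by exists (1 - a) => _ [N _ <-]; exact: series_inv_lam_le.
Qed.

Lemma inv_lam_cvg0 : (lam n)^-1 @[n --> \oo] --> 0.
Proof. exact: cvg_series_cvg_0 cvg_series_inv_lam. Qed.

Definition complete v := res v N @[N --> \oo] --> 0.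

Lemma complete_approx v : sqi a v ->
  (forall e, 0 < e -> exists w, [/\ sqi a w, complete w &
     ip a (fun x => v x - w x) (fun x => v x - w x) <= e]) -> complete v.
Proof.
move=> sv H; apply/cvgrPdist_le => /= e e0.
have [|w [sw cw vw]] := H (e / 4); first by rewrite divr_gt0.
have /cvgrPdist_le/(_ (e / 4)) := cw; rewrite divr_gt0// => /(_ isT) /= nw.
near=> N.
rewrite sub0r normrN ger0_norm; last exact: ip_ge0.
apply: le_trans (res_split N sv sw) _.
have : `|0 - res w N| <= e / 4 by near: N.
by rewrite sub0r normrN ger0_norm ?ip_ge0//; lra.
Unshelve. all: by end_near. Qed.

Lemma complete_approx_seq v (w : nat -> R -> R) : sqi a v ->
  (forall n, sqi a (w n)) -> (forall n, complete (w n)) ->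
  ip a (fun x => v x - w n x) (fun x => v x - w n x) @[n --> \oo] --> 0 ->
  complete v.
Proof.
move=> sv sw cw vw; apply: complete_approx => // e e0.
have /cvgrPdist_le/(_ e e0) [n _ /(_ n (leqnn n)) /=] := vw.
rewrite sub0r normrN ger0_norm ?ip_ge0// => H.
by exists (w n).
Qed.

(** The residual is orthogonal to the first [N] eigenfunctions, and its energy is
    at most that of [w] because the expansion is orthogonal for the energy form
    too. So [courant] gives a rate [1 / lam N]. *)
Lemma complete_C1 (w dw : R -> R) : (forall x : R, is_derive x 1 w (dw x)) ->
  continuous dw -> w 1 = 0 -> complete w.
Proof.
move=> dW cdw w1; have cw := is_derive_continuous dW.
have sw : sqi a w by exact: continuous_sqi.
pose D := integ a (fun x => (x - a) * dw x ^+ 2).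
suff H N : res w N <= 2 * D * (lam N)^-1.
  apply: (@squeeze_cvgr _ _ _ _ (fun=> 0) (fun N => 2 * D * (lam N)^-1)).
  - by apply: nearW => N; rewrite ip_ge0 H.
  - exact: cvg_cst.
  - by have := cvgMl_tmp (a := 2 * D) inv_lam_cvg0; rewrite mulr0; apply.
pose ds x := \sum_(0 <= n < N) coef w n * dpsi n x.
pose dr x := dw x - ds x.
have dS (x : R) : is_derive x 1 (proj w N) (ds x).
  have h n := is_derive_psi n x.
  exact: (@is_derive_sum_nat _ _ (fun n x => coef w n * psi n x) (fun n x => coef w n * dpsi n x)).
have cds : continuous ds.
  move=> x; apply: (@cvg_sum_nat _ _ _ _ (fun y k => coef w k * dpsi k y) (fun k => coef w k * dpsi k x)) => k.
  by apply: cvgMl_tmp; exact: continuous_dpsi.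
have dR (x : R) : is_derive x 1 (resid w N) (dr x).
  by have h1 := dW x; have h2 := dS x; apply: is_derive_eq.
have cdr : continuous dr by move=> x; apply: cvgB; [exact: cdw|exact: cds].
have r1 : resid w N 1 = 0.
  by rewrite /resid w1 sub0r /proj big1 ?oppr0// => n _; rewrite psi_1 mulr0.
have lN := lam_gt0 N.
have [p [p0 pN pk]] : exists p, [/\ 0 <= p, p < lam N &
    forall k, (k < N)%N -> lam k <= p].
  exists (if N is N'.+1 then lam N' else 0); case: (N) => [|N']; split => //.
  - by rewrite lam_gt0.
  - by rewrite ltW// lam_gt0.
  - exact: lam_lt.
  - by move=> k; rewrite ltnS leq_eqVlt => /predU1P[->//|/lam_lt/ltW].
(* [courant] needs [l] strictly between two eigenvalues; this one is at least
   [lam N / 2]. *)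
pose l := (lam N + p) / 2.
have l0 : 0 < l by rewrite /l; lra.
have lD : l * res w N <= integ a (fun x => (x - a) * dr x ^+ 2).
  apply: (courant l0 _ _ dR cdr r1).
  - by move=> k kN; rewrite -ltr_pdivrMr// -/(lam k) /l; have := pk k kN; lra.
  - rewrite -ltr_pdivlMr// -/(lam N) /l; lra.
  - by move=> k kN; exact: ip_resid_psi.
have cx (f : R -> R) : continuous f -> continuous (fun x => (x - a) * f x).
  move=> cf x; apply: cvgM; last exact: cf.
  by apply: cvgB; [exact: cvg_id|exact: cvg_cst].
have DrD : integ a (fun x => (x - a) * dr x ^+ 2) <= D.
  have -> : D = integ a (fun x => (x - a) * dr x ^+ 2) +
     (2 * ip a dr (fun x => (x - a) * ds x) + integ a (fun x => (x - a) * ds x ^+ 2)).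
    have i1 : itg a (fun x => (x - a) * dr x ^+ 2).
      by apply: continuous_itg => //; apply: cx; exact: continuous_sqr.
    have i2 : itg a (fun x => dr x * ((x - a) * ds x)).
      by apply: continuous_itg => // x; apply: cvgM; [exact: cdr|exact: cx].
    have i3 : itg a (fun x => (x - a) * ds x ^+ 2).
      by apply: continuous_itg => //; apply: cx; exact: continuous_sqr.
    rewrite -intZ// -intD//; last exact: itgZ.
    rewrite -intD//; last by apply: itgD => //; exact: itgZ.
    by congr integ; apply/funext => x; rewrite /dr; ring.
  rewrite lerDl (_ : ip _ _ _ = 0) ?mulr0 ?add0r.
    by apply: int_ge0 => x /andP[ax _]; rewrite mulr_ge0 ?sqr_ge0// subr_ge0 ltW.
  have -> : (fun x => (x - a) * ds x) = (fun x => \sum_(0 <= n < N) coef w n * flux a (lam n) x).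
    by apply/funext => x; rewrite mulr_sumr; apply: eq_bigr => n _; rewrite mulrCA.
  have sf n : sqi a (flux a (lam n)) by apply: continuous_sqi => //; exact: continuous_flux.
  have sdr : sqi a dr by exact: continuous_sqi.
  rewrite ipC (@ip_suml _ _ N (fun n x => coef w n * flux a (lam n) x))//; last first.
    by move=> n; exact: sqiZ.
  rewrite big_nat; apply: big1 => n /andP[_ nN]; rewrite ipZl// ipC.
  by rewrite [ip _ _ _](green_psi n dR cdr r1) ip_resid_psi// !mulr0.
rewrite ler_pdivlMr// mulrC.
have h := le_trans lD DrD.
have : lam N / 2 * res w N <= l * res w N.
  by rewrite ler_wpM2r ?ip_ge0// /l ler_pM2r// lerDl.
by move=> h2; have := le_trans h2 h; lra.
Qed.

(** The difference quotients of a primitive of [g] are C^1 and converge to [g];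
    the factor [1 - expR (n * (x - 1))] makes them vanish at 1. *)
Lemma complete_continuous (g : R -> R) : continuous g -> complete g.
Proof.
move=> cg; have [G dG] := antiderivative cg.
have cG := is_derive_continuous dG.
pose h n : R := n.+1%:R^-1.
have h0 n : 0 < h n by rewrite invr_gt0.
have h1 n : h n <= 1 by rewrite invf_le1// ler1n.
pose q n x := (h n)^-1 * (G (x + h n) - G x).
pose dq n x := (h n)^-1 * (g (x + h n) - g x).
pose c n (x : R) : R := 1 - expR (n%:R * (x - 1)).
pose w n x := c n x * q n x.
have cshift (f : R -> R) n : continuous f -> continuous (fun x => f (x + h n)).
  move=> cf x; apply: (@continuous_comp _ _ _ (fun x => x + h n) f); last exact: cf.
  by apply: cvgD; [exact: cvg_id|exact: cvg_cst].
have dQ n (x : R) : is_derive x 1 (q n) (dq n x).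
  have d1 := dG (x + h n); have d2 := dG x.
  have d0 : is_derive x 1 (fun x => x + h n) 1.
    by apply: is_derive_eq; rewrite addr0.
  have d3 := @is_derive1_comp _ G (fun x => x + h n) x _ _ d1 d0.
  have d4 : is_derive x 1 (fun x => G (x + h n)) (g (x + h n)).
    by apply: (is_derive_eq d3); rewrite mulr1.
  by apply: is_derive_eq; rewrite /GRing.scale/= /dq; ring.
have dC n (x : R) : is_derive x 1 (c n) (- (n%:R * (1 - c n x))).
  by apply: is_derive_eq; rewrite /GRing.scale/= /c; ring.
have cC n : continuous (c n) by exact: is_derive_continuous (dC n).
have cq n : continuous (q n) by exact: is_derive_continuous (dQ n).
have cdq n : continuous (dq n).
  by move=> x; apply: cvgMl_tmp; apply: cvgB; [exact: cshift|exact: cg].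
have dW n (x : R) : is_derive x 1 (w n) (c n x * dq n x - n%:R * (1 - c n x) * q n x).
  have d1 := dC n x; have d2 := dQ n x.
  by apply: is_derive_eq; rewrite /GRing.scale/=; ring.
have cdW n : continuous (fun x => c n x * dq n x - n%:R * (1 - c n x) * q n x).
  move=> x; apply: cvgB; first by apply: cvgM; [exact: cC|exact: cdq].
  apply: cvgM; last exact: cq.
  by apply: cvgM; [exact: cvg_cst|apply: cvgB; [exact: cvg_cst|exact: cC]].
have cw n : continuous (w n) by exact: is_derive_continuous (dW n).
have sg : sqi a g by exact: continuous_sqi.
apply: (@complete_approx_seq g w) => //.
- by move=> n; exact: continuous_sqi.
- move=> n; apply: (complete_C1 (dW n) (cdW n)).
  by rewrite /w /c subrr mulr0 expR0 subrr mul0r.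
have a2 : a <= 2 by rewrite ltW// (lt_le_trans a1)// ler1n.
have [M M0 gM] := continuous_bounded_itv a2 (@cg).
have qM n x : a < x < 1 -> `|q n x| <= M.
  move=> /andP[ax x1]; have hx : x < x + h n by rewrite ltrDl.
  have cGx : {within `[x, x + h n], continuous G} by exact: continuous_subspaceT.
  have [y] := MVT hx (fun z _ => dG z) cGx; rewrite in_itv/= => /andP[xy yx] e.
  rewrite /q e addrAC subrr add0r mulrCA mulVf ?mulr1 ?gt_eqF//.
  have y2 : y <= 2 by rewrite (le_trans (ltW yx))// (le_trans (lerD (ltW x1) (h1 n))).
  by apply: gM; rewrite y2 andbT ltW// (lt_trans ax).
have c01 n x : x < 1 -> 0 <= c n x <= 1.
  move=> x1; rewrite /c subr_ge0 gerBl expR_ge0 andbT expR_le1.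
  by rewrite mulr_ge0_le0// subr_le0 ltW.
have wM n x : a < x < 1 -> `|w n x| <= M.
  move=> xI; have /andP[_ x1] := xI; have /andP[c0 c1] := c01 n x x1.
  rewrite /w normrM (ger0_norm c0) (le_trans (ler_wpM2r _ c1))// mul1r.
  exact: qM.
have wg x : a < x < 1 -> w^~ x @ \oo --> g x.
  move=> /andP[ax x1].
  have c1 : c n x @[n --> \oo] --> (1 : R).
    have e0 : expR (n%:R * (x - 1)) @[n --> \oo] --> (0 : R).
      under eq_fun do rewrite expRM_natl.
      by apply: cvg_expr; rewrite ger0_norm ?expR_ge0// expR_lt1 subr_lt0.
    suff : c n x @[n --> \oo] --> 1 - (0 : R) by rewrite subr0.
    by apply: cvgB; [exact: cvg_cst|exact: e0].
  have q1 : q n x @[n --> \oo] --> g x.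
    have /cvgr_dnbhsP H := is_derive_quotient (dG x).
    apply: (H h); split; first by move=> n; rewrite gt_eqF.
    exact: cvg_harmonic.
  by have := cvgM c1 q1; rewrite mul1r; apply.
have := @int_dominated R a (fun n x => (g x - w n x) * (g x - w n x)) (fun=> 0) (fun=> (2 * M) ^+ 2) _ _ _ _ _.
rewrite int0.
apply.
- move=> n; apply: (@measurable_funI _ a); apply: continuous_measurable_fun => x.
  by apply: cvgM; apply: cvgB; [exact: cg|exact: cw|exact: cg|exact: cw].
- exact: measurable_cst.
- move=> x xI.
  suff : (g x - w n x) * (g x - w n x) @[n --> \oo] --> (g x - g x) * (g x - g x).
    by rewrite subrr mul0r.
  by apply: cvgM; apply: cvgB; [exact: cvg_cst|exact: wg|exact: cvg_cst|exact: wg].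
- by apply: continuous_itg => // x; exact: cvg_cst.
- move=> n x xI; rewrite -expr2; apply: normr_sqr_le.
  rewrite (le_trans (ler_normB _ _))// mulr_natl mulr2n lerD ?wM// gM//.
  by case/andP: xI => ax x1; apply/andP; split; lra.
Qed.

(** Continuous functions are dense in L^1; truncating them at the bound of [v]
    turns approximation in L^1 into approximation in L^2. *)
Lemma complete_bounded (v : R -> R) (M : R) : 0 < M ->
  measurable_fun setT v -> (forall x, `|v x| <= M) ->
  complete v.
Proof.
move=> M0 mv vM.
have sv : sqi a v.
  split => //; apply: (@itg_le _ a _ (fun=> M ^+ 2)).
  - by apply: measurable_funX; exact: measurable_funI.
  - by move=> x _; exact: normr_sqr_le.
  - by apply: continuous_itg => // x; exact: cvg_cst.
have iv : lebesgue_measure.-integrable `]a, 1[ (EFin \o v).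
  apply: (@itg_le _ a _ (fun=> M)) => //.
  - exact: measurable_funI.
  - by apply: continuous_itg => // x; exact: cvg_cst.
have [||g [cg ig vg]] := approximation_continuous_integrable _ _ iv => //.
  by rewrite /= lebesgue_measure_itv/= lte_fin a1 -EFinB ltry.
have ct n : continuous (fun x => trunc M (g n x)) by exact: continuous_trunc.
have st n : sqi a (fun x => trunc M (g n x)) by exact: continuous_sqi.
apply: (@complete_approx_seq v (fun n x => trunc M (g n x))) => // [n|].
  exact: complete_continuous.
have ivg n : itg a (fun x => v x - g n x) by apply: itgB => //; exact: ig.
have vg' : 2 * M * integ a (fun x => `|v x - g n x|) @[n --> \oo] --> (0 : R).
  have := cvgMl_tmp (a := 2 * M) (fine_cvg vg); rewrite mulr0; apply.
apply: (@squeeze_cvgr _ _ _ _ (fun=> 0) _ _ _ _ _ vg'); last exact: cvg_cst.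
apply: nearW => n; rewrite ip_ge0/= -intZ; last by apply: itg_norm; exact: ivg.
apply: le_int.
- by apply: itgM; exact: sqiB.
- by apply: itgZ; apply: itg_norm; exact: ivg.
- move=> x _; have h1 := trunc_dist (g n x) (vM x).
  have h2 : `|v x - trunc M (g n x)| <= 2 * M.
    rewrite (le_trans (ler_normB _ _))// mulr_natl mulr2n lerD//.
    by apply: trunc_bound; exact: ltW.
  rewrite (le_trans (ler_norm _))// normrM.
  by apply: ler_pM.
Qed.

Theorem eigenfunctions_complete v : sqi a v -> complete v.
Proof.
move=> sv.
pose w (n : nat) x := trunc n.+1%:R (v x).
have mw n : measurable_fun setT (w n) by apply: measurable_trunc; exact: sv.1.
have wb n x : `|w n x| <= n.+1%:R by exact: trunc_bound.
have sw n : sqi a (w n).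
  split => //; apply: (@itg_le _ a _ (fun=> n.+1%:R ^+ 2)).
  - by apply: measurable_funX; exact: measurable_funI.
  - by move=> x _; exact: normr_sqr_le.
  - by apply: continuous_itg => // x; exact: cvg_cst.
apply: (@complete_approx_seq v w) => // [n|].
  by apply: (@complete_bounded _ n.+1%:R).
have := @int_dominated R a (fun n x => (v x - w n x) * (v x - w n x)) (fun=> 0) (fun x => v x ^+ 2) _ _ _ _ _.
rewrite int0.
apply.
- by move=> n; apply: measurable_funM; apply: measurable_funI; apply: measurable_funB => //; exact: sv.1.
- exact: measurable_cst.
- move=> x _; apply: cvg_near_cst; exists (Num.bound `|v x|) => // n /= Nn.
  rewrite /w trunc_id ?subrr ?mul0r// (le_trans (ltW (archi_boundP _)))//.
  by rewrite ler_nat leqW.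
- exact: sv.2.
- move=> n x _; rewrite -expr2 normrX -[leRHS]real_normK ?num_real//.
  rewrite ler_pXn2r ?nnegrE//.
  exact: trunc_resid.
Qed.

End Spectrum.

(** * Green's formula on the domain of the operator *)
Section Bump.
Context {R : realType}.
Implicit Types (t x h e : R).

Lemma continuous_max0 : continuous (fun t : R => Num.max t 0).
Proof.
by move=> t; apply: (@continuous_max _ _ idfun (cst 0)); [exact: cvg_id|exact: cvg_cst].
Qed.

Lemma is_derive_max0_sq t : is_derive t 1 (fun s => Num.max s 0 ^+ 2) (2 * Num.max t 0).
Proof.
have [t0|t0|->] := ltgtP t 0.
- apply: (@near_eq_is_derive _ _ _ (cst 0)).
    near=> s; have s0 : s < 0 by near: s; exact: lt_nbhsl.
    by rewrite max_r ?expr0n// ltW.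
  by rewrite mulr0; exact: is_derive_cst.
- apply: (@near_eq_is_derive R R R (fun s : R => s * s)).
    near=> s; have s0 : 0 < s by near: s; exact: lt_nbhsr.
    by rewrite max_l ?ltW.
  by apply: is_derive_eq; rewrite /GRing.scale/=; ring.
- rewrite mulr0.
  apply: quotient_is_derive.
  have c0 : Num.max h 0 @[h --> (0:R)^'] --> (0 : R).
    have := @continuous_max0 0; rewrite /continuous_at maxxx => c0.
    exact: cvg_within_filter c0.
  apply: cvg_trans c0; apply: near_eq_cvg; near=> h.
  have h0 : h != 0 by near: h; exact: nbhs_dnbhs_neq.
  rewrite add0r maxxx expr0n/= subr0.
  have [hp|hn] := leP h 0; first by rewrite expr0n/= mulr0.
  by rewrite expr2 mulKf.
Unshelve. all: by end_near. Qed.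

(** A C^1 step from 0 to 1 on [0, 2]: half the second difference of the square
    of the positive part. *)
Definition step t := (Num.max t 0 ^+ 2 - 2 * Num.max (t - 1) 0 ^+ 2 +
  Num.max (t - 2) 0 ^+ 2) / 2.
Definition dstep t := Num.max t 0 - 2 * Num.max (t - 1) 0 + Num.max (t - 2) 0.

Lemma is_derive_step t : is_derive t 1 step (dstep t).
Proof.
have d0 := is_derive_max0_sq t.
have sh c : is_derive t 1 (fun s => Num.max (s - c) 0 ^+ 2) (2 * Num.max (t - c) 0).
  have d1 := is_derive_max0_sq (t - c).
  have d2 : is_derive t 1 (fun s => s - c) 1 by apply: is_derive_eq; rewrite subr0.
  have d3 := @is_derive1_comp _ _ (fun s => s - c) t _ _ d1 d2.
  by apply: (is_derive_eq d3); rewrite mulr1.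
have d1 := sh 1; have d2 := sh 2.
have -> : step = (fun s => 2^-1 * (Num.max s 0 ^+ 2 + ((- 2) * Num.max (s - 1) 0 ^+ 2 +
    Num.max (s - 2) 0 ^+ 2))).
  by apply/funext => s; rewrite /step; ring.
apply: is_derive_eq; rewrite /GRing.scale/= /dstep; by field.
Qed.

Lemma continuous_dstep : continuous dstep.
Proof.
have sh c : continuous (fun s : R => Num.max (s - c) 0).
  move=> s; apply: (@continuous_comp _ _ _ (fun s => s - c) (fun t => Num.max t 0)).
    by apply: cvgB; [exact: cvg_id|exact: cvg_cst].
  exact: continuous_max0.
move=> s; apply: cvgD; last exact: sh.
apply: cvgB; first exact: continuous_max0.
by apply: cvgMl_tmp; exact: sh.
Qed.

Lemma max0_cases t : Num.max t 0 = t /\ 0 <= t \/ Num.max t 0 = 0 /\ t <= 0.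
Proof. by have [t0|/ltW t0] := leP t 0; [right|left]. Qed.

Lemma dstep_bound t : 0 <= dstep t <= 1.
Proof.
rewrite /dstep; case: (max0_cases t) => -[-> ?]; case: (max0_cases (t - 1)) => -[-> ?];
  case: (max0_cases (t - 2)) => -[-> ?]; apply/andP; split; lra.
Qed.

Lemma dstep_supp t : t <= 0 \/ 2 <= t -> dstep t = 0.
Proof.
rewrite /dstep; case: (max0_cases t) => -[-> ?]; case: (max0_cases (t - 1)) => -[-> ?];
  case: (max0_cases (t - 2)) => -[-> ?] [] ?; lra.
Qed.

Lemma step_le0 t : t <= 0 -> step t = 0.
Proof.
move=> t0; rewrite /step !max_r ?expr0n/= ?mulr0 ?subr0 ?addr0 ?mul0r//; lra.
Qed.

Lemma step_ge2 t : 2 <= t -> step t = 1.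
Proof.
by move=> t2; rewrite /step !max_l; lra.
Qed.

Lemma step_bound t : 0 <= step t <= 1.
Proof.
have cs : continuous step by exact: is_derive_continuous is_derive_step.
have mono x y : x <= y -> step x <= step y.
  move=> xy; apply: (derive_ge0_le xy (fun z _ => is_derive_step z)).
    exact: continuous_subspaceT.
  by move=> z _; case/andP: (dstep_bound z).
apply/andP; split.
  have [t0|t0] := leP t 0; first by rewrite step_le0.
  by rewrite -(step_le0 (lexx 0)); apply: mono; exact: ltW.
have [t2|t2] := leP 2 t; first by rewrite step_ge2.
by rewrite -(step_ge2 (lexx 2)); apply: mono; exact: ltW.
Qed.

End Bump.

Section Green.
Context {R : realType}.
Variable a : R.
Hypothesis a1 : a < 1.
Implicit Types (e x : R) (f g : R -> R).
Local Notation leb := (@lebesgue_measure R).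
Local Notation I := (`]a, 1[%classic : set R).

(** [stepl e] rises from 0 at [a + e] to 1 at [a + 3 * e], and [stepr e] mirrors
    it at 1; the derivatives are nonnegative kernels of size [1 / e] supported
    near the end points. *)
Definition stepl e x := step ((x - a) / e - 1).
Definition dstepl e x := dstep ((x - a) / e - 1) / e.
Definition stepr e x := step ((1 - x) / e - 1).
Definition dstepr e x := dstep ((1 - x) / e - 1) / e.
Definition cut e x := stepl e x * stepr e x.
Definition dcut e x := dstepl e x * stepr e x - stepl e x * dstepr e x.

Lemma is_derive_stepl e x : is_derive x 1 (stepl e) (dstepl e x).
Proof.
have d1 := is_derive_step ((x - a) / e - 1).
have d2 : is_derive x 1 (fun x => (x - a) / e - 1) e^-1.
  by apply: is_derive_eq; rewrite /GRing.scale/=; ring.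
exact: (@is_derive1_comp _ _ (fun x => (x - a) / e - 1) x _ _ d1 d2).
Qed.

Lemma is_derive_stepr e x : is_derive x 1 (stepr e) (- dstepr e x).
Proof.
have d1 := is_derive_step ((1 - x) / e - 1).
have d2 : is_derive x 1 (fun x => (1 - x) / e - 1) (- e^-1).
  by apply: is_derive_eq; rewrite /GRing.scale/=; ring.
have := @is_derive1_comp _ _ (fun x => (1 - x) / e - 1) x _ _ d1 d2.
by move=> H; apply: (is_derive_eq H); rewrite /dstepr mulrN.
Qed.

Lemma is_derive_cut e x : is_derive x 1 (cut e) (dcut e x).
Proof.
have d1 := is_derive_stepl e x; have d2 := is_derive_stepr e x.
by apply: is_derive_eq; rewrite /GRing.scale/= /dcut; ring.
Qed.

Lemma continuous_dstepl e : continuous (dstepl e).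
Proof.
move=> x; apply: cvgMr_tmp.
apply: (@continuous_comp _ _ _ (fun x => (x - a) / e - 1) dstep); last exact: continuous_dstep.
apply: cvgB; last exact: cvg_cst.
by apply: cvgMr_tmp; apply: cvgB; [exact: cvg_id|exact: cvg_cst].
Qed.

Lemma continuous_dstepr e : continuous (dstepr e).
Proof.
move=> x; apply: cvgMr_tmp.
apply: (@continuous_comp _ _ _ (fun x => (1 - x) / e - 1) dstep); last exact: continuous_dstep.
apply: cvgB; last exact: cvg_cst.
by apply: cvgMr_tmp; apply: cvgB; [exact: cvg_cst|exact: cvg_id].
Qed.

Lemma continuous_stepl e : continuous (stepl e).
Proof. exact: is_derive_continuous (is_derive_stepl e). Qed.

Lemma continuous_stepr e : continuous (stepr e).
Proof. exact: is_derive_continuous (is_derive_stepr e). Qed.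

Lemma continuous_cut e : continuous (cut e).
Proof. exact: is_derive_continuous (is_derive_cut e). Qed.

Lemma continuous_dcut e : continuous (dcut e).
Proof.
move=> x; apply: cvgB; apply: cvgM.
- exact: continuous_dstepl.
- exact: continuous_stepr.
- exact: continuous_stepl.
- exact: continuous_dstepr.
Qed.

(** Test functions need a continuous derivative only, so the cut-off of a C^1
    function is one. *)
Lemma cut_test e g (dg : R -> R) : 0 < e -> (forall x : R, is_derive x 1 g (dg x)) ->
  continuous dg ->
  test_function a (fun x => cut e x * g x) /\
  derive1 (fun x => cut e x * g x) = (fun x => dcut e x * g x + cut e x * dg x).
Proof.
move=> e0 dG cdg; have cg := is_derive_continuous dG.
have d (x : R) : is_derive x 1 (fun x => cut e x * g x) (dcut e x * g x + cut e x * dg x).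
  have d1 := is_derive_cut e x; have d2 := dG x.
  by apply: is_derive_eq; rewrite /GRing.scale/=; ring.
have E : derive1 (fun x => cut e x * g x) = (fun x => dcut e x * g x + cut e x * dg x).
  by apply/funext => x; rewrite derive1E; have [_ ->] := d x.
split=> //; split.
- by move=> x; have [] := d x.
- rewrite E => x; apply: cvgD; apply: cvgM.
  + exact: continuous_dcut.
  + exact: cg.
  + exact: continuous_cut.
  + exact: cdg.
- exists (a + e), (1 - e); split; [by rewrite ltrDl|by rewrite gtrBl|].
  move=> x; rewrite in_itv/= negb_and -!ltNge => /orP[xa|x1].
    rewrite /cut /stepl step_le0 ?mul0r// subr_le0 ler_pdivrMr// mul1r; lra.
  rewrite /cut /stepr (@step_le0 _ ((1 - x) / e - 1)) ?mulr0 ?mul0r// subr_le0 ler_pdivrMr// mul1r; lra.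
Qed.

Lemma cut_bound e x : `|cut e x| <= 1.
Proof.
have /andP[l0 l1] := step_bound ((x - a) / e - 1).
have /andP[r0 r1] := step_bound ((1 - x) / e - 1).
by rewrite /cut /stepl /stepr normrM !ger0_norm//; apply: mulr_ile1.
Qed.

Lemma dstepl_ge0 e x : 0 < e -> 0 <= dstepl e x.
Proof.
by move=> e0; apply: divr_ge0; [case/andP: (dstep_bound ((x - a) / e - 1))|exact: ltW].
Qed.

Lemma dstepr_ge0 e x : 0 < e -> 0 <= dstepr e x.
Proof.
by move=> e0; apply: divr_ge0; [case/andP: (dstep_bound ((1 - x) / e - 1))|exact: ltW].
Qed.

Lemma dcut_bound e x : 0 < e -> `|dcut e x| <= dstepl e x + dstepr e x.
Proof.
move=> e0; have l := dstepl_ge0 x e0; have r := dstepr_ge0 x e0.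
have /andP[l0 l1] := step_bound ((x - a) / e - 1).
have /andP[r0 r1] := step_bound ((1 - x) / e - 1).
rewrite -[step _]/(stepl e x) in l0 l1; rewrite -[step _]/(stepr e x) in r0 r1.
rewrite (le_trans (ler_normB _ _))// (normrM (dstepl e x)) (normrM (stepl e x)).
rewrite (ger0_norm l) (ger0_norm r).
by rewrite (ger0_norm l0) (ger0_norm r0) lerD//; [exact: ler_piMr|exact: ler_piMl].
Qed.

(** A factor that vanishes linearly at the end point compensates for the size
    [1 / e] of the kernel. *)
Lemma dstepl_supp e x : 0 < e -> a <= x ->
  (x - a) * dstepl e x <= 3 * \1_(`]-oo, (a + 3 * e)[%classic) x.
Proof.
move=> e0 ax; rewrite indicE; have [xe|xe] := ltP x (a + 3 * e).
  rewrite mem_set /=; last by rewrite in_itv.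
  rewrite mulr1 mulrA ler_pdivrMr//.
  have /andP[d0 d1] := dstep_bound ((x - a) / e - 1).
  rewrite (@le_trans _ _ (x - a))//; last by lra.
  by rewrite ler_piMr// subr_ge0.
rewrite memNset/=; last by rewrite in_itv/= => /lt_geF; rewrite xe.
rewrite /dstepl dstep_supp ?mul0r ?mulr0//; right.
rewrite lerBrDr ler_pdivlMr//; lra.
Qed.

Lemma dstepr_supp e x : 0 < e -> x <= 1 ->
  (1 - x) * dstepr e x <= 3 * \1_(`](1 - 3 * e), +oo[%classic) x.
Proof.
move=> e0 ax; rewrite indicE; have [xe|xe] := ltP (1 - 3 * e) x.
  rewrite mem_set /=; last by rewrite in_itv/= xe.
  rewrite mulr1 mulrA ler_pdivrMr//.
  have /andP[d0 d1] := dstep_bound ((1 - x) / e - 1).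
  rewrite (@le_trans _ _ (1 - x))//; last by lra.
  by rewrite ler_piMr// subr_ge0.
rewrite memNset/=; last by rewrite in_itv/= andbT => /lt_geF; rewrite xe.
rewrite /dstepr dstep_supp ?mul0r ?mulr0//; right.
rewrite lerBrDr ler_pdivlMr//; lra.
Qed.

Lemma dstepr_eq0 e x : 0 < e -> x <= 1 - 3 * e -> dstepr e x = 0.
Proof.
move=> e0 xe; rewrite /dstepr dstep_supp ?mul0r//; right.
rewrite lerBrDr ler_pdivlMr//; lra.
Qed.

Lemma int_dstepl e : integ a (dstepl e) <= 1.
Proof.
rewrite (int_derive a1 (is_derive_stepl e) (@continuous_dstepl e)).
have /andP[_ h1] := step_bound ((1 - a) / e - 1).
have /andP[h2 _] := step_bound ((a - a) / e - 1).
rewrite /stepl; lra.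
Qed.

Lemma int_dstepr e : integ a (dstepr e) <= 1.
Proof.
have d (x : R) : is_derive x 1 (fun x => - stepr e x) (dstepr e x).
  have d1 := is_derive_stepr e x.
  by apply: is_derive_eq; rewrite opprK.
rewrite (int_derive a1 d (@continuous_dstepr e)).
have /andP[_ h1] := step_bound ((1 - a) / e - 1).
have /andP[h2 _] := step_bound ((1 - 1) / e - 1).
rewrite /stepr; lra.
Qed.

Let eps k : R := k.+1%:R^-1.
Let eps_gt0 k : 0 < eps k. Proof. by rewrite invr_gt0. Qed.
Let eps_cvg : eps k @[k --> \oo] --> 0. Proof. exact: cvg_harmonic. Qed.

Lemma int_shrink_left f : itg a f ->
  integ a (fun x => `|f x| * \1_(`]-oo, (a + 3 * eps k)[%classic) x) @[k --> \oo] --> 0.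
Proof.
move=> If; have := @int_dominated R a (fun k x => `|f x| * \1_(`]-oo, (a + 3 * eps k)[%classic) x) (fun=> 0) (fun x => `|f x|) _ _ _ _ _.
rewrite int0.
apply.
- move=> n; apply: measurable_funM; first by apply: itg_measurable; exact: itg_norm.
  by apply: (@measurable_funI _ a); apply: measurable_indic.
- exact: measurable_cst.
- move=> x /andP[ax _]; apply: cvg_near_cst.
  have x0 : 0 < (x - a) / 3 by rewrite divr_gt0 ?subr_gt0.
  near=> k; have ek : eps k < (x - a) / 3 by near: k; exact: (cvgr_lt _ eps_cvg).
  rewrite indicE memNset ?mulr0//= in_itv/= => h.
  move: ek; rewrite ltr_pdivlMr//; lra.
- exact: itg_norm.
- move=> n x _; rewrite indicE normrM normr_id ler_piMr//.
  by case: (_ \in _); rewrite ?normr1 ?normr0.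
Unshelve. all: by end_near. Qed.

Lemma int_shrink_right f : itg a f ->
  integ a (fun x => `|f x| * \1_(`](1 - 3 * eps k), +oo[%classic) x) @[k --> \oo] --> 0.
Proof.
move=> If; have := @int_dominated R a (fun k x => `|f x| * \1_(`](1 - 3 * eps k), +oo[%classic) x) (fun=> 0) (fun x => `|f x|) _ _ _ _ _.
rewrite int0.
apply.
- move=> n; apply: measurable_funM; first by apply: itg_measurable; exact: itg_norm.
  by apply: (@measurable_funI _ a); apply: measurable_indic.
- exact: measurable_cst.
- move=> x /andP[_ x1]; apply: cvg_near_cst.
  have x0 : 0 < (1 - x) / 3 by rewrite divr_gt0 ?subr_gt0.
  near=> k; have ek : eps k < (1 - x) / 3 by near: k; exact: (cvgr_lt _ eps_cvg).
  rewrite indicE memNset ?mulr0//= in_itv/= andbT => h.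
  move: ek; rewrite ltr_pdivlMr//; lra.
- exact: itg_norm.
- move=> n x _; rewrite indicE normrM normr_id ler_piMr//.
  by case: (_ \in _); rewrite ?normr1 ?normr0.
Unshelve. all: by end_near. Qed.

Lemma int_cut_cvg f : itg a f -> integ a (fun x => cut (eps k) x * f x) @[k --> \oo] --> integ a f.
Proof.
move=> If; apply: (@int_dominated _ _ _ _ (fun x => `|f x|)).
- move=> n; apply: measurable_funM; last exact: itg_measurable.
  by apply: measurable_funI; apply: continuous_measurable_fun; exact: continuous_cut.
- exact: itg_measurable.
- move=> x /andP[ax x1].
  have x0 : 0 < (x - a) / 3 by rewrite divr_gt0 ?subr_gt0.
  have x0' : 0 < (1 - x) / 3 by rewrite divr_gt0 ?subr_gt0.
  apply: cvg_near_cst; near=> k.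
  have e0 := eps_gt0 k.
  have h1 : eps k < (x - a) / 3 by near: k; exact: (cvgr_lt _ eps_cvg).
  have h2 : eps k < (1 - x) / 3 by near: k; exact: (cvgr_lt _ eps_cvg).
  rewrite /cut /stepl /stepr !step_ge2 ?mul1r//.
    by rewrite lerBrDr ler_pdivlMr//; lra.
  by rewrite lerBrDr ler_pdivlMr//; lra.
- exact: itg_norm.
- by move=> n x _; rewrite normrM ler_piMl// cut_bound.
Unshelve. all: by end_near. Qed.

Lemma int_ae_eq f g : measurable_fun I f -> measurable_fun I g ->
  {ae leb, forall x, I x -> f x = g x} -> integ a f = integ a g.
Proof.
move=> mf mg fg; rewrite /integ /Rintegral; congr fine.
apply: ae_eq_integral => //; try exact/measurable_EFinP; try exact: measurable_I.
by move: fg; apply: ae_leb_imp => x H Ix; rewrite H.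
Qed.

Lemma measurable_dstepr e : measurable_fun I (dstepr e).
Proof. by apply: measurable_funI; apply: continuous_measurable_fun; exact: continuous_dstepr. Qed.

Lemma itg_mul_continuous f g : sqi a f -> continuous g -> itg a (fun x => f x * g x).
Proof. by move=> sf cg; apply: itgM => //; exact: continuous_sqi. Qed.

Lemma sqi_itg f : sqi a f -> itg a f.
Proof.
move=> sf; rewrite (_ : f = fun x => f x * 1); last by apply/funext => x; rewrite mulr1.
by apply: itg_mul_continuous => // x; exact: cvg_cst.
Qed.

Lemma sqi_norm f : sqi a f -> sqi a (fun x => `|f x|).
Proof.
move=> [mf i]; split; first exact: measurableT_comp.
by move: i; congr itg; apply/funext => x; rewrite real_normK ?num_real.
Qed.

(** Near 1 the continuous representative is small, whereas the kernels have
    integral at most 1. *)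
Lemma int_trace_cvg0 u U : sqi a u -> continuous_representative a u U -> U 1 = 0 ->
  integ a (fun x => `|u x| * dstepr (eps k) x) @[k --> \oo] --> 0.
Proof.
move=> su [/ae_eq_leb1P Uu cU] U1.
have mU : measurable_fun I U.
  apply: (@measurable_funS _ _ _ _ `]a, 1]%classic) => //.
    by move=> x /=; rewrite !in_itv/= => /andP[-> /ltW].
  exact: subspace_continuous_measurable_fun.
have E k : integ a (fun x => `|u x| * dstepr (eps k) x) = integ a (fun x => `|U x| * dstepr (eps k) x).
  apply: int_ae_eq.
  - apply: measurable_funM; last exact: measurable_dstepr.
    by apply: measurableT_comp => //; exact: sqi_measurable.
  - by apply: measurable_funM; [exact: measurableT_comp|exact: measurable_dstepr].
  - by move: Uu; apply: ae_leb_imp => x H Ix; rewrite H.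
apply/cvgrPdist_le => /= e e0.
have cU1 : U x @[x --> within `]a, 1]%classic (nbhs (1 : R))] --> U 1.
  by have /subspace_continuousP := cU; apply; rewrite /= in_itv/= a1 lexx.
have /cvgrPdist_le/(_ e e0) := cU1; rewrite U1 => /nbhs_ballP[d /= d0 hd].
have d3 : 0 < d / 3 by rewrite divr_gt0.
near=> k.
have ek : eps k < d / 3 by near: k; exact: (cvgr_lt _ eps_cvg).
have ek0 := eps_gt0 k.
have pt x : a < x < 1 -> `|U x| * dstepr (eps k) x <= e * dstepr (eps k) x.
  move=> /andP[ax x1]; have [xe|xe] := leP x (1 - 3 * eps k).
    by rewrite dstepr_eq0// !mulr0.
  apply: ler_wpM2r; first exact: dstepr_ge0.
  have := hd x; rewrite /ball/= sub0r normrN; apply.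
    by rewrite ger0_norm; move: ek; rewrite ltr_pdivlMr//; lra.
  by rewrite in_itv/= ax ltW.
have id : itg a (fun x => e * dstepr (eps k) x).
  by apply: itgZ; apply: continuous_itg => //; exact: continuous_dstepr.
rewrite sub0r normrN E ger0_norm; last first.
  by apply: int_ge0 => x _; rewrite mulr_ge0// dstepr_ge0.
apply: le_trans (_ : integ a (fun x => e * dstepr (eps k) x) <= e); last first.
  rewrite intZ; last by apply: continuous_itg => //; exact: continuous_dstepr.
  by rewrite ger_pMr// int_dstepr.
apply: le_int => //.
apply: itg_le id.
  by apply: measurable_funM; [exact: measurableT_comp|exact: measurable_dstepr].
by move=> x xI; rewrite ger0_norm ?pt// mulr_ge0// dstepr_ge0.
Unshelve. all: by end_near. Qed.

(** Finite energy forces the flux [(x - a) * p] to vanish at [a] on average. *)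
Lemma int_flux_cvg0 (p : R -> R) : sqi a (fun x => (x - a) * p x) ->
  itg a (fun x => (x - a) * p x ^+ 2) ->
  integ a (fun x => `|(x - a) * p x| * dstepl (eps k) x) @[k --> \oo] --> 0.
Proof.
move=> sq iE; apply/cvgrPdist_le => /= e e0.
pose K := 2 / e; have K0 : 0 < K by rewrite divr_gt0.
have cE := int_shrink_left iE.
have e2 : 0 < e / (6 * K) by rewrite divr_gt0// mulr_gt0.
near=> k; have ek0 := eps_gt0 k.
have hk : `|0 - integ a (fun x => `|(x - a) * p x ^+ 2| * \1_(`]-oo, (a + 3 * eps k)[%classic) x)| <= e / (6 * K).
  by near: k; move/cvgrPdist_le : cE; apply.
have iA : itg a (dstepl (eps k)) by apply: continuous_itg => //; exact: continuous_dstepl.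
have iL : itg a (fun x => `|(x - a) * p x ^+ 2| * \1_(`]-oo, (a + 3 * eps k)[%classic) x).
  apply: itg_le (itg_norm iE).
    apply: measurable_funM; first by apply: itg_measurable; exact: itg_norm.
    by apply: (@measurable_funI _ a); apply: measurable_indic.
  move=> x _; rewrite normrM normr_id ler_piMr// indicE.
  by case: (_ \in _); rewrite ?normr1 ?normr0.
rewrite sub0r normrN ger0_norm; last first.
  by apply: int_ge0 => x _; rewrite mulr_ge0// dstepl_ge0.
apply: (@le_trans _ _ (integ a (fun x => (3 * K) * (`|(x - a) * p x ^+ 2| * \1_(`]-oo, (a + 3 * eps k)[%classic) x) + K^-1 * dstepl (eps k) x))).
  apply: le_int.
  - by apply: itg_mul_continuous; [exact: sqi_norm|exact: continuous_dstepl].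
  - by apply: itgD; exact: itgZ.
  - move=> x /andP[ax x1]; have A0 := dstepl_ge0 x ek0.
    have As := dstepl_supp ek0 (ltW ax).
    have xa : 0 < x - a by rewrite subr_gt0.
    set t := `|(x - a) * p x|.
    (* Young's inequality; the square is controlled by the energy since
       [t ^ 2 = (x - a) * ((x - a) * p ^ 2)], and [K^-1] is half of [e]. *)
    have tK : t <= K * t ^+ 2 + K^-1.
      rewrite -(ler_pM2l K0) mulrDr mulfV ?gt_eqF//.
      have := sqr_ge0 (K * t - 1 / 2); rewrite expr2; lra.
    apply: (le_trans (ler_wpM2r A0 tK)).
    rewrite mulrDl lerD2r.
    have tE : t ^+ 2 = (x - a) * `|(x - a) * p x ^+ 2|.
      have E0 : 0 <= (x - a) * p x ^+ 2 by rewrite mulr_ge0 ?sqr_ge0 ?(ltW xa).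
      by rewrite /t real_normK ?num_real// (ger0_norm E0); ring.
    rewrite tE; move: (dstepl (eps k) x) As => A As.
    rewrite (_ : K * _ * A = K * (`|(x - a) * p x ^+ 2| * ((x - a) * A))); last by ring.
    rewrite (_ : 3 * K * _ = K * (`|(x - a) * p x ^+ 2| * (3 * \1_(`]-oo, (a + 3 * eps k)[%classic) x))); last by ring.
    by rewrite ler_pM2l// ler_wpM2l.
rewrite intD; [|exact: itgZ..].
rewrite !intZ//.
have h1 : 3 * K * integ a (fun x => `|(x - a) * p x ^+ 2| * \1_(`]-oo, (a + 3 * eps k)[%classic) x) <= e / 2.
  rewrite (_ : e / 2 = 3 * K * (e / (6 * K))); last by field; rewrite gt_eqF.
  have K3 : 0 < 3 * K by rewrite (mulr_gt0 _ K0).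
  rewrite (ler_pM2l K3); apply: le_trans hk.
  by rewrite sub0r normrN ler_norm.
have h2 : K^-1 * integ a (dstepl (eps k)) <= e / 2.
  by rewrite /K invf_div ler_piMr ?int_dstepl// divr_ge0// ltW.
by lra.
Unshelve. all: by end_near. Qed.

Lemma cvg0_le (f g : nat -> R) : (forall k, `|f k| <= g k) ->
  g k @[k --> \oo] --> (0 : R) -> f k @[k --> \oo] --> (0 : R).
Proof.
move=> fg g0; apply/norm_cvg0P.
apply: (@squeeze_cvgr _ _ _ _ (fun=> 0) g); last exact: g0; last exact: cvg_cst.
by apply: nearW => k /=; rewrite normr_ge0 fg.
Qed.

Lemma int_boundary_le (f h : R -> R) k : sqi a f -> continuous h ->
  `|integ a (fun x => f x * (dcut (eps k) x * h x))| <=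
  integ a (fun x => `|f x| * dstepl (eps k) x * `|h x|) +
  integ a (fun x => `|f x| * dstepr (eps k) x * `|h x|).
Proof.
move=> sf ch; have ek := eps_gt0 k.
have cnh : continuous (fun x => `|h x|) by move=> x; apply: cvg_norm; exact: ch.
have il : itg a (fun x => `|f x| * dstepl (eps k) x * `|h x|).
  under [X in itg a X]eq_fun do rewrite -mulrA.
  apply: itg_mul_continuous; first exact: sqi_norm.
  by move=> x; apply: cvgM; [exact: continuous_dstepl|exact: cnh].
have ir : itg a (fun x => `|f x| * dstepr (eps k) x * `|h x|).
  under [X in itg a X]eq_fun do rewrite -mulrA.
  apply: itg_mul_continuous; first exact: sqi_norm.
  by move=> x; apply: cvgM; [exact: continuous_dstepr|exact: cnh].
have iD : itg a (fun x => f x * (dcut (eps k) x * h x)).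
  apply: itg_mul_continuous => // x.
  by apply: cvgM; [exact: continuous_dcut|exact: ch].
rewrite (le_trans (int_norm iD))// -intD//; apply: le_int.
- exact: itg_norm.
- exact: itgD.
- move=> x _; rewrite -mulrDl -mulrDr !normrM -mulrA ler_wpM2l//.
  by rewrite ler_wpM2r// dcut_bound.
Qed.

Lemma cvgD0 (f g : nat -> R) : f k @[k --> \oo] --> (0 : R) ->
  g k @[k --> \oo] --> (0 : R) -> f k + g k @[k --> \oo] --> (0 : R).
Proof. by move=> f0 g0; rewrite -(addr0 (0 : R)); apply: cvgD. Qed.

Lemma int_cvg0_le (f g : nat -> R -> R) (c : R) :
  (forall k x, a < x < 1 -> 0 <= f k x <= c * g k x) ->
  (forall k, itg a (f k)) -> (forall k, itg a (g k)) ->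
  integ a (g k) @[k --> \oo] --> (0 : R) -> integ a (f k) @[k --> \oo] --> (0 : R).
Proof.
move=> fg jf jg g0; apply: (@cvg0_le _ (fun k => c * integ a (g k))) => [k|].
  rewrite ger0_norm; last by apply: int_ge0 => x xI; case/andP: (fg k x xI).
  rewrite -intZ//; apply: le_int => //; first exact: itgZ.
  by move=> x xI; case/andP: (fg k x xI).
suff : c * integ a (g k) @[k --> \oo] --> c * 0 by rewrite mulr0.
exact: cvgMl_tmp.
Qed.

(** Test the weak equation for [u] against the cut-off of [(x - a) * phi'], and
    the one for its flux against the cut-off of [phi]. The boundary terms vanish
    in the limit: at [a] the flux of [u] is small in the mean and that of [phi]
    is [O(x - a)]; at 1 the function [u] is small by its trace and [phi] is
    [O(1 - x)]. *)
Lemma green_operator u w (phi dphi dflux : R -> R) :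
  (forall x : R, is_derive x 1 phi (dphi x)) -> continuous dphi ->
  (forall x : R, is_derive x 1 (fun y => (y - a) * dphi y) (dflux x)) ->
  continuous dflux -> phi 1 = 0 ->
  degenerate_op a u w -> ip a w phi = ip a u dflux.
Proof.
move=> dP cdp dF cdf phi1 [/L2P su [/L2P sw [p [[_ lp wdp] fin [U [UU U1]] /L2P sq [_ _ wdq]]]]].
set q := (fun x => (x - a) * p x) in sq wdq.
have cphi := is_derive_continuous dP; have cfl := is_derive_continuous dF.
set fl := (fun y => (y - a) * dphi y) in dF cfl.
have iE : itg a (fun x => (x - a) * p x ^+ 2).
  have mp : measurable_fun I p by case: lp.
  apply/integrableP; split.
    apply/measurable_EFinP; apply: measurable_funM; last exact: measurable_funX.
    by apply: measurable_funB.
  apply: le_lt_trans fin; rewrite le_eqVlt; apply/orP; left; apply/eqP.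
  apply: eq_integral => x; rewrite inE/= in_itv/= => /andP[ax _].
  by rewrite real_normK ?num_real// ger0_norm// mulr_ge0 ?sqr_ge0// subr_ge0 ltW.
have [C C0 dphiC] := continuous_bounded_itv (ltW a1) cdp.
have flC x : a < x < 1 -> `|fl x| <= C * (x - a).
  move=> /andP[ax x1]; have xa : 0 <= x - a by rewrite subr_ge0 ltW.
  rewrite /fl normrM (ger0_norm xa) mulrC; apply: ler_wpM2r => //.
  by apply: dphiC; rewrite (ltW ax) (ltW x1).
have phiC x : a < x < 1 -> `|phi x| <= C * (1 - x).
  move=> /andP[ax x1]; have x1' : 0 <= 1 - x by rewrite subr_ge0 ltW.
  have [y] := MVT x1 (fun z _ => dP z) (continuous_subspaceT cphi).
  rewrite in_itv/= phi1 sub0r => /andP[xy y1] e.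
  rewrite -normrN e normrM (ger0_norm x1'); apply: ler_wpM2r => //.
  by apply: dphiC; rewrite (ltW y1) andbT (le_trans (ltW ax) (ltW xy)).
pose X k := integ a (fun x => cut (eps k) x * (w x * phi x)).
pose Y k := integ a (fun x => cut (eps k) x * (u x * dflux x)).
pose V k := integ a (fun x => q x * (cut (eps k) x * dphi x)).
pose Z1 k := integ a (fun x => u x * (dcut (eps k) x * fl x)).
pose Z2 k := integ a (fun x => q x * (dcut (eps k) x * phi x)).
have cM (f h : R -> R) : continuous f -> continuous h -> continuous (fun x => f x * h x).
  by move=> cf ch x; apply: cvgM; [exact: cf|exact: ch].
have E1 k : Z2 k + V k = - X k.
  have [tf de] := cut_test (eps_gt0 k) dP cdp.
  have := wdq _ tf; rewrite de => H.
  rewrite /Z2 /V -intD; last 2 first.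
  - by apply: itg_mul_continuous => //; apply: cM => //; exact: continuous_dcut.
  - by apply: itg_mul_continuous => //; apply: cM => //; exact: continuous_cut.
  transitivity (integ a (fun x => q x * (dcut (eps k) x * phi x + cut (eps k) x * dphi x))).
    by congr integ; apply/funext => x; rewrite mulrDr.
  rewrite [LHS]H /X; congr (- _); apply: eq_int => x _; ring.
have E2 k : Z1 k + Y k = - V k.
  have [tf de] := cut_test (eps_gt0 k) dF cdf.
  have := wdp _ tf; rewrite de => H.
  rewrite /Z1 /Y -intD; last 2 first.
  - by apply: itg_mul_continuous => //; apply: cM => //; exact: continuous_dcut.
  - under [X in itg a X]eq_fun do rewrite mulrCA.
    by apply: itg_mul_continuous => //; apply: cM => //; exact: continuous_cut.
  transitivity (integ a (fun x => u x * (dcut (eps k) x * fl x + cut (eps k) x * dflux x))).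
    by congr integ; apply/funext => x; rewrite mulrDr [u x * (cut _ _ * _)]mulrCA.
  rewrite [LHS]H /V; congr (- _); apply: eq_int => x _; rewrite /q /fl; ring.
have cX : X k @[k --> \oo] --> ip a w phi.
  by apply: int_cut_cvg; exact: itg_mul_continuous.
have cY : Y k @[k --> \oo] --> ip a u dflux.
  by apply: int_cut_cvg; exact: itg_mul_continuous.
have isu := sqi_itg su; have isq := sqi_itg sq.
have iabs (f h D : R -> R) : sqi a f -> continuous h -> continuous D -> itg a (fun x => `|f x| * D x * `|h x|).
  move=> sf ch cD; under [X in itg a X]eq_fun do rewrite -mulrA.
  apply: itg_mul_continuous; first exact: sqi_norm.
  by move=> x; apply: cvgM; [exact: cD|apply: cvg_norm; exact: ch].
have iind f (A : set R) : measurable A -> itg a f -> itg a (fun x => `|f x| * \1_A x).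
  move=> mA jf; apply: itg_le (itg_norm jf).
    apply: measurable_funM; first by apply: itg_measurable; exact: itg_norm.
    by apply: (@measurable_funI _ a); apply: measurable_indic.
  move=> x _; rewrite normrM normr_id ler_piMr// indicE.
  by case: (_ \in _); rewrite ?normr1 ?normr0.
have C3 : 0 <= C by exact: ltW.
(* In each boundary term one end is controlled by [u], the other by [phi]. *)
have cZ1 : Z1 k @[k --> \oo] --> (0 : R).
  apply: (cvg0_le (fun k => int_boundary_le k su cfl)).
  apply: cvgD0.
    apply: (int_cvg0_le (c := 3 * C) _ _ _ (int_shrink_left isu)).
    - move=> k x axx; have /andP[ax x1] := axx; have ek := eps_gt0 k.
      have := dstepl_supp ek (ltW ax); have := dstepl_ge0 x ek; have := flC x axx.
      move: (dstepl _ x) (\1_ _ x) => A J; move: (fl x) (u x) => f0 u0 h1 h2 h3.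
      apply/andP; split; first by rewrite !mulr_ge0.
      apply: (@le_trans _ _ (`|u0| * A * (C * (x - a)))).
        by apply: ler_wpM2l => //; rewrite mulr_ge0.
      rewrite (_ : _ * _ * _ = (`|u0| * C) * ((x - a) * A)); last by ring.
      rewrite (_ : 3 * C * _ = (`|u0| * C) * (3 * J)); last by ring.
      by apply: ler_wpM2l => //; rewrite mulr_ge0.
    - by move=> k; apply: iabs => //; exact: continuous_dstepl.
    - by move=> k; apply: iind.
  apply: (int_cvg0_le (c := C * (1 - a)) _ _ _ (int_trace_cvg0 su UU U1)).
  - move=> k x axx; have /andP[ax x1] := axx; have ek := eps_gt0 k.
    have := dstepr_ge0 x ek; have := flC x axx.
    move: (dstepr _ x) => A; move: (fl x) (u x) => f0 u0 h1 h2.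
    apply/andP; split; first by rewrite !mulr_ge0.
    rewrite [leRHS]mulrC; apply: ler_wpM2l; first by rewrite mulr_ge0.
    by apply: (le_trans h1); apply: ler_wpM2l => //; rewrite lerB// ltW.
  - by move=> k; apply: iabs => //; exact: continuous_dstepr.
  - by move=> k; apply: itg_mul_continuous; [exact: sqi_norm|exact: continuous_dstepr].
have cZ2 : Z2 k @[k --> \oo] --> (0 : R).
  apply: (cvg0_le (fun k => int_boundary_le k sq cphi)).
  apply: cvgD0; last first.
    apply: (int_cvg0_le (c := 3 * C) _ _ _ (int_shrink_right isq)).
    - move=> k x axx; have /andP[ax x1] := axx; have ek := eps_gt0 k.
      have := dstepr_supp ek (ltW x1); have := dstepr_ge0 x ek; have := phiC x axx.
      move: (dstepr _ x) (\1_ _ x) => A J; move: (phi x) (q x) => f0 u0 h1 h2 h3.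
      apply/andP; split; first by rewrite !mulr_ge0.
      apply: (@le_trans _ _ (`|u0| * A * (C * (1 - x)))).
        by apply: ler_wpM2l => //; rewrite mulr_ge0.
      rewrite (_ : _ * _ * _ = (`|u0| * C) * ((1 - x) * A)); last by ring.
      rewrite (_ : 3 * C * _ = (`|u0| * C) * (3 * J)); last by ring.
      by apply: ler_wpM2l => //; rewrite mulr_ge0.
    - by move=> k; apply: iabs => //; exact: continuous_dstepr.
    - by move=> k; apply: iind.
  apply: (int_cvg0_le (c := C * (1 - a)) _ _ _ (int_flux_cvg0 sq iE)).
  - move=> k x axx; have /andP[ax x1] := axx; have ek := eps_gt0 k.
    have := dstepl_ge0 x ek; have := phiC x axx; rewrite -/(q x).
    move: (dstepl _ x) => A; move: (phi x) (q x) => f0 u0 h1 h2.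
    apply/andP; split; first by rewrite !mulr_ge0.
    rewrite [leRHS]mulrC; apply: ler_wpM2l; first by rewrite mulr_ge0.
    by apply: (le_trans h1); apply: ler_wpM2l => //; rewrite lerB// ltW.
  - by move=> k; apply: iabs => //; exact: continuous_dstepl.
  - by move=> k; apply: itg_mul_continuous; [exact: sqi_norm|exact: continuous_dstepl].
have XE k : X k = Z1 k + Y k - Z2 k by have := E1 k; have := E2 k; lra.
have c : X k @[k --> \oo] --> 0 + ip a u dflux - 0.
  by under eq_fun do rewrite XE; apply: cvgB => //; apply: cvgD.
have := cvg_unique (@norm_hausdorff _ _) cX c.
by rewrite add0r subr0 => <-.
Qed.

End Green.

(** * The semigroup on the eigenfunctions *)
Section EigenfunctionsInDomain.
Context {R : realType}.
Variable a : R.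
Hypothesis a1 : a < 1.
Local Notation leb := (@lebesgue_measure R).

Lemma weak_derivative_C1 (f df : R -> R) : (forall x : R, is_derive x 1 f (df x)) ->
  continuous df -> weak_derivative a f df.
Proof.
move=> dF cdf; have cf := is_derive_continuous dF.
split.
- by apply: open_integrable_locally; [exact: interval_open|exact: continuous_itg].
- by apply: open_integrable_locally; [exact: interval_open|exact: continuous_itg].
move=> phi [dphi cdphi [c [d [ac d1 supp]]]].
have dP (x : R) : is_derive x 1 phi (derive1 phi x).
  by rewrite derive1E; apply: DeriveDef.
have cphi := is_derive_continuous dP.
have phia : phi a = 0 by apply: supp; rewrite in_itv/= (lt_geF ac).
have phi1 : phi 1 = 0 by apply: supp; rewrite in_itv/= (lt_geF d1) andbF.
have dprod (x : R) : is_derive x 1 (fun x => f x * phi x) (f x * derive1 phi x + df x * phi x).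
  have d1' := dF x; have d2 := dP x.
  by apply: is_derive_eq; rewrite /GRing.scale/=; ring.
have c1 : continuous (fun x => f x * derive1 phi x) by move=> x; apply: cvgM; [exact: cf|exact: cdphi].
have c2 : continuous (fun x => df x * phi x) by move=> x; apply: cvgM; [exact: cdf|exact: cphi].
apply/eqP; rewrite -addr_eq0; apply/eqP.
rewrite -[LHS]/(integ a (fun x => f x * derive1 phi x) + integ a (fun x => df x * phi x)).
rewrite -intD; [|exact: continuous_itg..].
rewrite (int_derive a1 dprod); last by move=> x; apply: cvgD; [exact: c1|exact: c2].
by rewrite phia phi1 !mulr0 subrr.
Qed.

Variable mu : nat -> R.
Hypothesis mu_gt0 : forall n, 0 < mu n.
Hypothesis mu_root : forall n, bes 0 (mu n) = 0.

Lemma degenerate_op_psi n :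
  degenerate_op a (psi a mu n) (fun x => - lam a mu n * psi a mu n x).
Proof.
split; first by apply/L2P; exact: sqi_psi.
split; first by apply/L2P; apply: sqiZ; exact: sqi_psi.
have cflux : continuous (fun x => (x - a) * dpsi a mu n x).
  exact: is_derive_continuous (is_derive_flux a (lam a mu n)).
exists (dpsi a mu n); split.
- apply: weak_derivative_C1; first exact: is_derive_psi.
  exact: continuous_dpsi.
- apply: integral_fune_lt_pinfty.
    exact: measurable_itv.
  have c : continuous (fun x => (x - a) * dpsi a mu n x * dpsi a mu n x).
    by move=> x; apply: cvgM; [exact: cflux|exact: continuous_dpsi].
  have := continuous_itg a (@c); rewrite /itg; congr (is_true (integrable _ _ _)).
  by apply/funext => x /=; rewrite real_normK ?num_real//; congr EFin; ring.
- exists (psi a mu n); split; last exact: psi_1.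
  split; last by apply: continuous_subspaceT; exact: continuous_psi.
  exact: ae_eq_refl.
- by apply/L2P; exact: continuous_sqi.
- apply: weak_derivative_C1.
    move=> x; have := is_derive_flux a (lam a mu n) x.
    by move=> d; apply: (is_derive_eq d); rewrite mulNr.
  by move=> x; apply: cvgMl_tmp; exact: continuous_psi.
Qed.

End EigenfunctionsInDomain.

Section Semigroup.
Context {R : realType}.
Variable a : R.
Implicit Types (f g h : R -> R).

Lemma weak_eq_ip f g : sqi a f -> sqi a g ->
  (forall h, sqi a h -> ip a f h = ip a g h) -> ip a f f = ip a g g.
Proof. by move=> sf sg H; rewrite H// ipC H. Qed.

Lemma ae_ip_sqi f g h : sqi a f -> sqi a g -> sqi a h ->
  f = g %[ae leb1 a] -> ip a f h = ip a g h.
Proof. by move=> [mf _] [mg _] [mh _]; exact: ae_ip. Qed.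

Lemma L2norm_cvg0 (T : Type) (F : set_system T) {FF : Filter F} (f : T -> R -> R) :
  (\forall h \near F, sqi a (f h)) ->
  L2norm a (f h) @[h --> F] --> 0%E <-> ip a (f h) (f h) @[h --> F] --> (0 : R).
Proof.
move=> sf; split => [H|H].
- have H1 : (Num.sqrt (ip a (f h) (f h)))%:E @[h --> F] --> 0%E.
    apply: cvg_trans H; apply: near_eq_cvg; near=> h.
    by rewrite L2normE//; near: h.
  have H2 : Num.sqrt (ip a (f h) (f h)) @[h --> F] --> (0 : R) by exact: fine_cvg H1.
  suff : Num.sqrt (ip a (f h) (f h)) ^+ 2 @[h --> F] --> (0 : R).
    by under eq_fun do rewrite sqr_sqrtr ?ip_ge0//.
  under eq_fun do rewrite expr2.
  by have := cvgM H2 H2; rewrite mulr0; apply.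
- suff H1 : (Num.sqrt (ip a (f h) (f h)))%:E @[h --> F] --> 0%E.
    apply: cvg_trans H1; apply: near_eq_cvg; near=> h.
    by rewrite L2normE//; near: h.
  apply: cvg_EFin; first by apply: nearW.
  rewrite -(sqrtr0 R); apply: (cvg_comp _ _ H).
  exact: sqrt_continuous.
Unshelve. all: by end_near. Qed.

Variable S : R -> (R -> R) -> R -> R.
Hypothesis HS : C0_semigroup a S.

Lemma sqi_S t f : 0 <= t -> sqi a f -> sqi a (S t f).
Proof. by move=> t0 /L2P lf; apply/L2P; exact: semigroup_L2. Qed.

Lemma ip_S_linear t k f g h : 0 <= t -> sqi a f -> sqi a g -> sqi a h ->
  ip a (S t (fun x => k * f x + g x)) h = k * ip a (S t f) h + ip a (S t g) h.
Proof.
move=> t0 sf sg sh.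
have sSf := sqi_S t0 sf; have sSg := sqi_S t0 sg.
rewrite (ae_ip_sqi (g := fun x => k * S t f x + S t g x))//.
- by rewrite ipDl ?ipZl//; exact: sqiZ.
- by apply: sqi_S => //; exact: sqiZD.
- exact: sqiZD.
- by apply: semigroup_linear => //; exact/L2P.
Qed.

Lemma ip_S_scale t k f h : 0 <= t -> sqi a f -> sqi a h ->
  ip a (S t (fun x => k * f x)) h = k * ip a (S t f) h.
Proof.
move=> t0 sf sh; have -> : (fun x => k * f x) = (fun x => (k - 1) * f x + f x).
  by apply/funext => x; ring.
by rewrite ip_S_linear//; ring.
Qed.

Lemma ip_S_add s t f h : 0 <= s -> 0 <= t -> sqi a f -> sqi a h ->
  ip a (S (s + t) f) h = ip a (S s (S t f)) h.
Proof.
move=> s0 t0 sf sh; apply: ae_ip_sqi => //.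
- by apply: sqi_S => //; exact: addr_ge0.
- by do 2 apply: sqi_S => //.
- by apply: semigroupD => //; exact/L2P.
Qed.

Lemma ip_S_bounded t : 0 <= t -> exists2 K : R, 0 <= K & forall f, sqi a f ->
  ip a (S t f) (S t f) <= K * ip a f f.
Proof.
move=> t0; have [M HM] := semigroup_bounded HS t0.
exists (M ^+ 2); first exact: sqr_ge0.
move=> f sf; have := HM f; rewrite L2normE//; last exact: sqi_S.
rewrite L2normE// => /(_ ((L2P a f).2 sf)).
rewrite -EFinM lee_fin => H.
have i0 := ip_ge0 a f; have i1 := ip_ge0 a (S t f).
rewrite -(sqr_sqrtr i1) -[in leRHS](sqr_sqrtr i0) -exprMn.
by rewrite ler_sqr// nnegrE ?sqrtr_ge0// (le_trans _ H)// sqrtr_ge0.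
Qed.

(** The operator [S t] is bounded and commutes with the difference quotients
    that define the generator. *)
Lemma generator_S t f g : 0 <= t -> semigroup_generator a S f g ->
  semigroup_generator a S (S t f) (S t g).
Proof.
move=> t0 [/L2P sf /L2P sg H].
have sSf := sqi_S t0 sf; have sSg := sqi_S t0 sg.
split; [exact/L2P..|].
have sq f' g' (h : R) : 0 < h -> sqi a f' -> sqi a g' -> sqi a (fun x => (S h f' x - f' x) / h - g' x).
  move=> h0 sf' sg'; apply: sqiB => //.
  under [X in sqi a X]eq_fun do rewrite mulrC; apply: sqiZ; apply: sqiB => //.
  by apply: sqi_S => //; exact: ltW.
have n0 : \forall h \near (0:R)^'+, 0 < h by exact: nbhs_right_gt.
have nsq' f' g' : sqi a f' -> sqi a g' ->
    \forall h \near (0:R)^'+, sqi a (fun x => (S h f' x - f' x) / h - g' x).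
  by move=> *; near=> h; apply: sq => //; near: h.
apply/L2norm_cvg0; first exact: nsq'.
have [K K0 HK] := ip_S_bounded t0.
pose E (h x : R) := (S h f x - f x) / h - g x.
have : K * ip a (E h) (E h) @[h --> 0^'+] --> K * 0.
  by apply: cvgMl_tmp; apply/L2norm_cvg0 => //; exact: nsq'.
rewrite mulr0; apply: squeeze_cvgr; last exact: cvg_cst.
near=> h; have h0 : 0 < h by near: h.
have hh := ltW h0.
rewrite ip_ge0/=; apply: le_trans (HK _ (sq _ _ _ h0 sf sg)).
have sSh := sqi_S hh sf.
rewrite (weak_eq_ip (g := S t (E h))) ?lexx//.
- exact: sq.
- by apply: sqi_S => //; exact: sq.
move=> k sk.
have -> : E h = (fun x => h^-1 * S h f x + (- h^-1 * f x + (-1) * g x)).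
  by apply/funext => x; rewrite /E; ring.
have s1 := sqiZ (-1) sg; have s2 := sqiZD (- h^-1) sf s1.
rewrite !ip_S_linear// ip_S_scale// -(ip_S_add t0 hh)//.
rewrite (addrC t) (ip_S_add hh t0)//.
have s3 := sqi_S hh sSf.
have s4 := sqiB s3 sSf; have s5 := sqiZ h^-1 s4.
rewrite (_ : (fun x => _) = (fun x => h^-1 * (S h (S t f) x - S t f x) - S t g x)); last first.
  by apply/funext => x; ring.
rewrite ipBl// ipZl// ipBl//; ring.
Unshelve. all: by end_near. Qed.

End Semigroup.

Section MultiplicativeExp.
Context {R : realType}.
Variables (m : R -> R) (l : R).
Hypothesis mD : forall s t, 0 <= s -> 0 <= t -> m (s + t) = m s * m t.
Hypothesis dm : (m h - 1) / h + l @[h --> 0^'+] --> (0 : R).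

Lemma norm_expr_sub1 (x : R) n : `|x ^+ n - 1| <= (1 + `|x - 1|) ^+ n - 1.
Proof.
elim: n => [|n IH]; first by rewrite !expr0 !subrr normr0.
have -> : x ^+ n.+1 - 1 = (x - 1) * (x ^+ n - 1) + ((x - 1) + (x ^+ n - 1)) by rewrite exprS; ring.
rewrite (le_trans (ler_normD _ _))// (le_trans (lerD (lexx _) (ler_normD _ _)))//.
rewrite normrM exprS; move: IH (normr_ge0 (x - 1)).
move: `|x ^+ n - 1| `|x - 1| ((1 + _) ^+ n) => A y B h y0.
have : y * A <= y * (B - 1) by apply: ler_wpM2l.
lra.
Qed.

(** The multiplicative function [g s = m s * expR (l * s)] has derivative 0 at
    0, hence is close to 1 on [t / N] up to [o(1 / N)], and so is its Nth power. *)
Lemma multiplicative_exp t : 0 < t -> m t = expR (- (l * t)).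
Proof.
move=> t0; pose g s := m s * expR (l * s).
suff g1 : g t = 1.
  by rewrite expRN -[m t](mulfK (lt0r_neq0 (expR_gt0 (l * t)))) -/(g t) g1 mul1r.
have gX s n : 0 <= s -> g (n.+1%:R * s) = g s ^+ n.+1.
  move=> s0; elim: n => [|n IH]; first by rewrite mul1r expr1.
  rewrite exprS -IH (_ : n.+2%:R * s = s + n.+1%:R * s); last by rewrite (natrD _ 1 n.+1) mulrDl mul1r.
  by rewrite /g mD// ?mulr_ge0// mulrDr expRD; ring.
have dg : (g h - 1) / h @[h --> 0^'+] --> (0 : R).
  have dEx (x : R) : is_derive x 1 (fun x : R => expR (l * x)) (l * expR (l * x)).
    by apply: is_derive_eq; rewrite /GRing.scale/=; ring.
  have dE : is_derive (0 : R) 1 (fun x : R => expR (l * x)) l.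
    by have := dEx 0; rewrite mulr0 expR0 mulr1.
  have c1 : h^-1 * (expR (l * h) - 1) @[h --> (0:R)^'+] --> l.
    have := is_derive_quotient dE; under eq_fun do rewrite add0r mulr0 expR0.
    exact: cvg_dnbhs_at_right.
  have c2 : expR (l * h) @[h --> (0:R)^'+] --> (1 : R).
    have : expR (l * h) @[h --> (0:R)] --> expR (l * 0).
      exact: is_derive_continuous dEx 0.
    rewrite mulr0 expR0; exact: cvg_at_right_filter.
  have c3 : ((m h - 1) / h + l) * expR (l * h) + (h^-1 * (expR (l * h) - 1) - l * expR (l * h)) @[h --> (0:R)^'+] --> 0 * 1 + (l - l * 1).
    by apply: cvgD; [exact: cvgM|apply: cvgB => //; exact: cvgMl_tmp].
  move: c3; rewrite mul0r mulr1 subrr addr0; apply: cvg_trans; apply: near_eq_cvg; near=> h.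
  rewrite /g; field; near: h; exact: nbhs_right_neq.
apply/eqP; rewrite -subr_eq0 -normr_le0 leNgt; apply/negP.
set d := `|g t - 1| => d0.
have d2 : 1 < 1 + d / 2 by rewrite ltrDl divr_gt0.
pose e := ln (1 + d / 2) / t.
have e0 : 0 < e by rewrite divr_gt0// ln_gt0.
have tN : t / n.+1%:R @[n --> \oo] --> (0 : R)^'+.
  move=> P HP; have c : t / n.+1%:R @[n --> \oo] --> (0 : R).
    suff : t * n.+1%:R^-1 @[n --> \oo] --> t * 0 by rewrite mulr0.
    by apply: cvgMl_tmp; exact: cvg_harmonic.
  have {}HP : nbhs (0 : R) [set x | 0 < x -> P x] by exact: HP.
  have {}c : \forall n \near \oo, 0 < t / n.+1%:R -> P (t / n.+1%:R) by exact: c _ HP.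
  by apply: filterS c => n; apply; exact: divr_gt0.
have /cvgrPdist_le/(_ e e0) := cvg_comp _ _ tN dg.
move=> [N _ /(_ N (leqnn N))] /=.
set s := t / N.+1%:R; have s0 : 0 < s by rewrite divr_gt0.
rewrite sub0r normrN normrM normfV (gtr0_norm s0) ler_pdivrMr// => H.
have ts : t = N.+1%:R * s by rewrite /s mulrC divfK.
have : d <= d / 2.
  rewrite /d {1}ts gX ?(ltW s0)//.
  apply: (le_trans (norm_expr_sub1 _ _)).
  rewrite lerBlDl.
  rewrite -(@lnK _ (1 + d / 2)); last by rewrite posrE (lt_trans _ d2).
  have -> : ln (1 + d / 2) = e * s *+ N.+1.
    have et : ln (1 + d / 2) = e * t by rewrite /e divfK// gt_eqF.
    by rewrite et {1}ts -mulr_natr; ring.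
  rewrite -mulr_natl expRM_natl lerXn2r ?nnegrE ?addr_ge0// ?expR_ge0//.
  by rewrite (le_trans (expR_ge1Dx _))// ler_expR.
lra.
Unshelve. all: by end_near. Qed.

End MultiplicativeExp.

Section SemigroupSpectrum.
Context {R : realType}.
Variable a : R.
Hypothesis a1 : a < 1.
Variable mu : nat -> R.
Hypothesis mu_gt0 : forall n, 0 < mu n.
Hypothesis mu_lt : forall m n, (m < n)%N -> mu m < mu n.
Hypothesis mu_root : forall n, bes 0 (mu n) = 0.
Hypothesis mu_all : forall s : R, 0 < s -> bes 0 s = 0 -> exists n, s = mu n.
Variable S : R -> (R -> R) -> R -> R.
Hypothesis HS : degenerate_semigroup a S.
Local Notation lam := (lam a mu).
Local Notation psi := (psi a mu).
Local Notation nsq := (nsq a mu).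
Local Notation coef := (coef a mu).
Local Notation proj := (proj a mu).
Local Notation resid := (resid a mu).
Local Notation res := (res a mu).

Let C0 : C0_semigroup a S := HS.1.
Let spsi n : sqi a (psi n). Proof. exact: sqi_psi. Qed.
Let npsi n : 0 < nsq n. Proof. exact: nsq_gt0. Qed.

Lemma generator_psi n : semigroup_generator a S (psi n) (fun x => - lam n * psi n x).
Proof. by apply/HS.2; exact: degenerate_op_psi. Qed.

(** Green's formula makes [S t (psi m)] orthogonal to the other eigenfunctions. *)
Lemma ip_S_psi_orth t m k : 0 <= t -> m != k -> ip a (S t (psi m)) (psi k) = 0.
Proof.
move=> t0 mk; have sS := sqi_S C0 t0 (spsi m).
have /HS.2 H := generator_S C0 t0 (generator_psi m).
have := green_operator a1 (is_derive_psi a mu k) (@continuous_dpsi _ a mu k)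
  (is_derive_flux a (lam k)) _ (psi_1 a1 mu_root k) H.
rewrite (ip_S_scale C0)// => E.
have {}E : - lam m * ip a (S t (psi m)) (psi k) = - lam k * ip a (S t (psi m)) (psi k).
  rewrite E; last first.
    by move=> x; apply: cvgN; apply: cvgMl_tmp; exact: continuous_psi.
  rewrite -ipZr//; congr (ip a _ _); apply/funext => x; by rewrite mulNr.
move/eqP : E; rewrite -subr_eq0 -mulrBl mulf_eq0 => /orP[|/eqP//].
rewrite opprK addrC subr_eq0 => /eqP/(lam_inj a1 mu_lt)/eqP.
by rewrite eq_sym (negbTE mk).
Qed.

Definition mult m t := ip a (S t (psi m)) (psi m) / nsq m.

(** The only nonzero Fourier coefficient of [S t (psi m)] is the one along
    [psi m], so completeness makes it a multiple of [psi m]. *)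
Lemma S_psi t m : 0 <= t -> S t (psi m) = (fun x => mult m t * psi m x) %[ae leb1 a].
Proof.
move=> t0; have sS := sqi_S C0 t0 (spsi m).
apply: ip_eq0_ae => //; first exact: sqiZ.
have pE N : (m < N)%N -> resid (S t (psi m)) N = (fun x => S t (psi m) x - mult m t * psi m x).
  move=> mN; apply/funext => x; rewrite /resid /proj; congr (_ - _).
  rewrite (bigD1_seq m) ?mem_index_iota ?iota_uniq//= big1 ?addr0//.
  by move=> n nm; rewrite /coef ip_S_psi_orth ?mul0r// eq_sym.
have := eigenfunctions_complete a1 mu_gt0 mu_lt mu_root mu_all sS.
move=> c; apply: (cvg_unique (@norm_hausdorff _ _) _ c).
by apply: cvg_near_cst; near=> N; rewrite /res pE//; near: N; exact: nbhs_infty_gt.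
Unshelve. all: by end_near. Qed.

Lemma ip_S_psi t m h : 0 <= t -> sqi a h ->
  ip a (S t (psi m)) h = mult m t * ip a (psi m) h.
Proof.
move=> t0 sh; rewrite -ipZl//.
apply: ae_ip_sqi => //; [exact: sqi_S|exact: sqiZ|exact: S_psi].
Qed.

Lemma multD m s t : 0 <= s -> 0 <= t -> mult m (s + t) = mult m s * mult m t.
Proof.
move=> s0 t0; rewrite {1}/mult (ip_S_add C0)//.
rewrite (ae_ip_sqi (g := S s (fun x => mult m t * psi m x)))//.
- by rewrite (ip_S_scale C0)// /mult; field; rewrite gt_eqF.
- by apply: (sqi_S C0) => //; exact: (sqi_S C0).
- by apply: (sqi_S C0) => //; exact: sqiZ.
- apply: (semigroup_ae C0) => //; [apply/L2P; exact: sqi_S|apply/L2P; exact: sqiZ|exact: S_psi].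
Qed.

(** The derivative of [mult m] at 0 is found by pairing the convergence of the
    difference quotients to [- lam m * psi m] with [psi m]. *)
Lemma multE m t : 0 < t -> mult m t = expR (- (lam m * t)).
Proof.
apply: multiplicative_exp; first exact: multD.
have [_ _ H] := generator_psi m.
pose E (h x : R) := (S h (psi m) x - psi m x) / h - - lam m * psi m x.
have sE (h : R) : 0 < h -> sqi a (E h).
  move=> h0; apply: sqiB; last exact: sqiZ.
  under [X in sqi a X]eq_fun do rewrite mulrC; apply: sqiZ; apply: sqiB => //.
  by apply: (sqi_S C0) => //; exact: ltW.
have cE : ip a (E h) (E h) @[h --> 0^'+] --> (0 : R).
  by apply/L2norm_cvg0 => //; near=> h; apply: sE; near: h; exact: nbhs_right_gt.
have cE2 : Num.sqrt (ip a (E h) (E h) / nsq m) @[h --> 0^'+] --> (0 : R).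
  have c : ip a (E h) (E h) / nsq m @[h --> 0^'+] --> 0 / nsq m by apply: cvgMr_tmp.
  by have := cvg_comp _ _ c (@sqrt_continuous R _); rewrite mul0r sqrtr0.
apply/norm_cvg0P; apply: (@squeeze_cvgr _ _ _ _ (fun=> 0) _ _ _ _ _ cE2); last exact: cvg_cst.
near=> h; have h0 : 0 < h by near: h; exact: nbhs_right_gt.
rewrite normr_ge0/=.
have -> : (mult m h - 1) / h + lam m = ip a (E h) (psi m) / nsq m.
  have sS : sqi a (S h (psi m)) by apply: (sqi_S C0) => //; exact: ltW.
  have -> : E h = (fun x => h^-1 * (S h (psi m) x - psi m x) - - lam m * psi m x).
    by apply/funext => x; rewrite /E; ring.
  have s3 := sqiB sS (spsi m); have s4 := sqiZ h^-1 s3; have s5 := sqiZ (- lam m) (spsi m).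
  rewrite ipBl// ipZl// ipBl// ipZl// -/(nsq m) /mult.
  by field; rewrite !gt_eqF.
rewrite -sqrtr_sqr ler_wsqrtr// expr_div_n ler_pdivrMr ?exprn_gt0//.
rewrite expr2 (mulrA (_ / _)) divfK ?gt_eqF//.
by rewrite -expr2; apply: cauchy_schwarz => //; exact: sE.
Unshelve. all: by end_near. Qed.

Lemma ip_S_proj t v N h : 0 <= t -> sqi a h ->
  ip a (S t (proj v N)) h = \sum_(0 <= n < N) coef v n * ip a (S t (psi n)) h.
Proof.
move=> t0 sh; elim: N => [|N IH].
  rewrite big_geq// (_ : proj v 0 = fun x => 0 * psi 0 x); last first.
    by apply/funext => x; rewrite /proj big_geq// mul0r.
  by rewrite (ip_S_scale C0)// mul0r.
rewrite (_ : proj v N.+1 = fun x => coef v N * psi N x + proj v N x); last first.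
  by apply/funext => x; rewrite /proj big_nat_recr//= addrC.
rewrite (ip_S_linear C0)//; last exact: sqi_proj.
by rewrite IH big_nat_recr//= addrC.
Qed.

(** The identity holds exactly on partial sums of the Fourier expansion of [v],
    and both sides are continuous in [v]. *)
Lemma ip_S t v k : 0 < t -> sqi a v ->
  ip a (S t v) (psi k) = expR (- (lam k * t)) * ip a v (psi k).
Proof.
move=> t0 sv; have tt := ltW t0.
have [K K0 HK] := ip_S_bounded C0 tt.
apply/eqP; rewrite -subr_eq0 -sqrf_eq0.
set D := _ - _.
have DE N : (k < N)%N -> D ^+ 2 <= K * res v N * nsq k.
  move=> kN.
  have sr := sqi_resid mu N sv; have sp := sqi_proj a mu v N.
  have -> : D = ip a (S t (resid v N)) (psi k).
    have -> : resid v N = (fun x => (-1) * proj v N x + v x).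
      by apply/funext => x; rewrite /resid; ring.
    rewrite (ip_S_linear C0)// ip_S_proj// (bigD1_seq k) ?mem_index_iota ?iota_uniq//= big1; last first.
      by move=> n nk; rewrite ip_S_psi_orth ?mulr0.
    rewrite ip_S_psi// multE// -/(nsq k) /coef /D.
    by field; rewrite gt_eqF.
  apply: le_trans (cauchy_schwarz (sqi_S C0 tt sr) (spsi k)) _.
  by apply: ler_wpM2r; [exact: ip_ge0|exact: HK].
have c : K * res v N * nsq k @[N --> \oo] --> K * 0 * nsq k.
  apply: cvgMr_tmp; apply: cvgMl_tmp.
  exact: (eigenfunctions_complete a1 mu_gt0 mu_lt mu_root mu_all sv).
rewrite eq_le sqr_ge0 andbT.
move: c; rewrite mulr0 mul0r => c.
rewrite -(cvg_lim (@norm_hausdorff _ _) c).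
apply: limr_ge; first by apply/cvg_ex; exists 0.
by near=> N; apply: DE; near: N; exact: nbhs_infty_gt.
Unshelve. all: by end_near. Qed.

Lemma coef_S t v k : 0 < t -> sqi a v -> coef (S t v) k = expR (- (lam k * t)) * coef v k.
Proof. by move=> t0 sv; rewrite /coef ip_S// mulrA. Qed.

End SemigroupSpectrum.

(** * Pointwise expansion of the solution *)
Section AlmostEverywhere.
Context {R : realType}.
Variable a : R.
Hypothesis a1 : a < 1.
Local Notation leb := (@lebesgue_measure R).
Local Notation I := (`]a, 1[%classic : set R).

(** Truncating the squared distance at 1 makes dominated convergence apply. *)
Lemma mean_pointwise_limit_ae (f w : R -> R) (F : nat -> R -> R) : sqi a f ->
  (forall N, sqi a (F N)) ->
  ip a (fun x => f x - F N x) (fun x => f x - F N x) @[N --> \oo] --> (0 : R) ->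
  (forall x, a < x < 1 -> F N x @[N --> \oo] --> w x) ->
  {ae leb, forall x, I x -> f x = w x}.
Proof.
move=> sf sF c Fw.
have mw : measurable_fun I w.
  apply: (@measurable_fun_cvg _ _ _ _ F) => [N|x].
    by apply: sqi_measurable; exact: sF.
  by rewrite /= in_itv/=; exact: Fw.
pose G N x := Num.min ((f x - F N x) ^+ 2) 1.
pose g x := Num.min ((f x - w x) ^+ 2) 1.
have mf : measurable_fun I f by exact: sqi_measurable sf.
have mg : measurable_fun I g.
  apply: measurable_minr; last exact: measurable_cst.
  by apply: measurable_funX; exact: measurable_funB.
have mG N : measurable_fun I (G N).
  apply: measurable_minr; last exact: measurable_cst.
  by apply: measurable_funX; apply: measurable_funB => //; apply: sqi_measurable; exact: sF.
have i1 : itg a (fun=> 1) by apply: continuous_itg => // x; exact: cvg_cst.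
have min_bound (y : R) : 0 <= Num.min (y ^+ 2) 1 <= 1.
  by rewrite le_min sqr_ge0 ler01 ge_min lexx orbT.
have bound (y : R) : `|Num.min (y ^+ 2) 1| <= 1.
  by have /andP[h1 h2] := min_bound y; rewrite ger0_norm.
have cG : integ a (G N) @[N --> \oo] --> integ a g.
  apply: (@int_dominated _ _ _ _ (fun=> 1)) => // [x xI|n x _]; last exact: bound.
  apply: (@continuous_cvg _ _ _ _ _ _ (fun y : R => Num.min ((f x - y) ^+ 2) 1)); last exact: Fw.
  apply: (@continuous_min _ _ (fun y : R => (f x - y) ^+ 2) (cst 1)); last exact: cvg_cst.
  have h y : (f x - z) * (f x - z) @[z --> y] --> (f x - y) * (f x - y).
    by apply: cvgM; apply: cvgB; (try exact: cvg_cst); exact: cvg_id.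
  exact: h.
have cG0 : integ a (G N) @[N --> \oo] --> (0 : R).
  apply: (squeeze_cvgr _ (cvg_cst 0) c).
  near=> N; rewrite int_ge0/=; last by move=> x _; case/andP: (min_bound (f x - F N x)).
  apply: le_int.
  - by apply: itg_le i1 => // x _; exact: bound.
  - by have := (sqiB sf (sF N)).2; congr itg; apply/funext => x; rewrite expr2.
  - by move=> x _; rewrite /G expr2 ge_min lexx.
have g0 : integ a g = 0 by rewrite -(cvg_lim (@norm_hausdorff _ _) cG) (cvg_lim (@norm_hausdorff _ _) cG0).
have ig : itg a g by apply: itg_le i1 => // x _; exact: bound.
have : (\int[leb]_(x in I) `|(g x)%:E| = 0)%E.
  transitivity (integ a g)%:E; last by rewrite g0.
  rewrite itg_fin//; apply: eq_integral => x _; rewrite gee0_abs// lee_fin.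
  by case/andP: (min_bound (f x - w x)).
move/ae_eq_integral_abs => /=.
have m2 : measurable_fun I (fun x => (g x)%:E) by exact/measurable_EFinP.
move=> /(_ (measurable_I a) m2); apply: ae_leb_imp => x H Ix.
have [] := H Ix; rewrite /g minEle; case: ifP => _ /eqP; last by rewrite oner_eq0.
by rewrite sqrf_eq0 subr_eq0 => /eqP.
Unshelve. all: by end_near. Qed.

(** A null set contains no interval, in particular none to the left of a point
    where the two functions differ. *)
Lemma ae_eq_within_continuous (f g : R -> R) : {ae leb, forall x, I x -> f x = g x} ->
  {within `]a, 1], continuous f} -> {within `]a, 1], continuous g} ->
  forall x, a < x <= 1 -> f x = g x.
Proof.
move=> fg cf cg x axx; have /andP[ax x1] := axx.
apply/eqP; rewrite -subr_eq0; apply/negP => /negP ne.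
have cD : (f y - g y) @[y --> within `]a, 1]%classic (nbhs x)] --> f x - g x.
  have Ix : (`]a, 1]%classic : set R) x by rewrite /= in_itv.
  by apply: cvgB; [have /subspace_continuousP := cf|have /subspace_continuousP := cg]; apply.
have e0 : 0 < `|f x - g x| by rewrite normr_gt0.
have /cvgrPdist_lt/(_ _ e0) /nbhs_ballP[d /= d0 hd] := cD.
pose b := Num.max a (x - d).
have bx : b < x by rewrite gt_max ax gtrBl.
have sub : `]b, x[%classic `<=` ~` [set y | I y -> f y = g y].
  move=> y; rewrite /= in_itv/= gt_max => /andP[/andP[ay dy] yx] H.
  have Iy : I y by rewrite /= in_itv/= ay (lt_le_trans yx).
  have By : ball x d y by rewrite /ball/= gtr0_norm ?subr_gt0// ltrBlDl -ltrBlDr.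
  have Iy' : y \in `]a, 1] by rewrite in_itv/= ay (ltW (lt_le_trans yx x1)).
  by have := hd y By Iy'; rewrite (H Iy) subrr subr0 ltxx.
have [A [mA A0 sA]] := fg.
have : (leb `]b, x[%classic <= leb A)%E.
  by apply: le_measure; rewrite ?inE//; exact: subset_trans sub sA.
rewrite A0 lebesgue_measure_itv/= lte_fin bx -EFinD lee_fin subr_le0.
by rewrite leNgt bx.
Qed.

End AlmostEverywhere.

Section Solution.
Context {R : realType}.
Variable a : R.
Hypothesis a1 : a < 1.
Variable mu : nat -> R.
Hypothesis mu_gt0 : forall n, 0 < mu n.
Hypothesis mu_lt : forall m n, (m < n)%N -> mu m < mu n.
Hypothesis mu_root : forall n, bes 0 (mu n) = 0.
Hypothesis mu_all : forall s : R, 0 < s -> bes 0 s = 0 -> exists n, s = mu n.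
Variable S : R -> (R -> R) -> R -> R.
Hypothesis HS : degenerate_semigroup a S.
Local Notation lam := (lam a mu).
Local Notation psi := (psi a mu).
Local Notation dpsi := (dpsi a mu).
Local Notation nsq := (nsq a mu).
Local Notation coef := (coef a mu).
Local Notation proj := (proj a mu).
Variables (v : R -> R) (t : R).
Hypothesis sv : sqi a v.
Hypothesis t0 : 0 < t.

Let lam0 n : 0 < lam n. Proof. exact: lam_gt0. Qed.
Let npsi n : 0 < nsq n. Proof. exact: nsq_gt0. Qed.

Lemma coef_sqr_le n : coef v n ^+ 2 * nsq n <= ip a v v.
Proof.
rewrite /coef expr_div_n expr2 invfM mulrA [X in X * _]mulrC mulrA divfK ?gt_eqF//.
rewrite mulrC ler_pdivrMr// -expr2; apply: cauchy_schwarz => //.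
exact: sqi_psi.
Qed.

Lemma norm_le_1Dsqr (y b : R) : y ^+ 2 <= b -> `|y| <= 1 + b.
Proof.
move=> yb; apply: (@le_trans _ _ (1 + y ^+ 2)); last by rewrite lerD2l.
rewrite -real_normK ?num_real//.
have := sqr_ge0 (`|y| - 1 / 2); rewrite expr2; lra.
Qed.

(** Exponential decay, in the form that can be summed since the [1 / lam n] can
    be. *)
Lemma lam_expR n : (1 + lam n) * expR (- (lam n * t)) <= (1 / t + 4 / t ^+ 2) * (lam n)^-1.
Proof.
have l0 := lam0 n.
have y0 : 0 < lam n * t by rewrite mulr_gt0.
have b (y : R) : 0 < y -> expR (- y) <= y^-1.
  move=> yp; rewrite expRN lef_pV2 ?posrE ?expR_gt0//.
  by apply: le_trans (expR_ge1Dx y); lra.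
have h1 := b _ y0.
have h2 : expR (- (lam n * t)) <= 4 / (lam n * t) ^+ 2.
  have -> : - (lam n * t) = - (lam n * t / 2) + - (lam n * t / 2) by field.
  have -> : 4 / (lam n * t) ^+ 2 = (lam n * t / 2)^-1 * (lam n * t / 2)^-1.
    by field; rewrite !gt_eqF.
  have hb := b (lam n * t / 2) (divr_gt0 y0 (ltr0Sn _ 1)).
  by rewrite expRD ler_pM ?expR_ge0.
rewrite mulrDl mul1r mulrDl lerD//.
  by rewrite (le_trans h1)// invfM mul1r mulrC.
apply: (@le_trans _ _ (lam n * (4 / (lam n * t) ^+ 2))); first by rewrite ler_pM2l.
by rewrite le_eqVlt; apply/orP; left; apply/eqP; field; rewrite !gt_eqF.
Qed.

(** Away from [a], the coefficients of [v] are bounded against [psi n] by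
    Bessel's inequality and [psi_bound], and against [dpsi n] up to a factor
    [lam n] by [flux_bound]; the exponential makes both summable. *)
Lemma coef_bound e : 0 < e -> exists B : R, forall n x, a + e <= x <= 1 ->
  `|coef (S t v) n * psi n x| <= B * (lam n)^-1 /\
  `|coef (S t v) n * dpsi n x| <= B * (lam n)^-1.
Proof.
move=> e0; pose V := ip a v v; have V0 : 0 <= V by exact: ip_ge0.
pose B0 := 1 + V / e + V / e ^+ 2.
have Ve1 : 0 <= V / e by rewrite divr_ge0// ltW.
have Ve2 : 0 <= V / e ^+ 2 by rewrite divr_ge0// ltW// exprn_gt0.
exists (B0 * (1 / t + 4 / t ^+ 2)) => n x /andP[aex x1].
have l0 := lam0 n; have n0 := npsi n.
have ex : e <= x - a by rewrite lerBrDl.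
have axx : a <= x <= 1 by rewrite x1 andbT (le_trans _ aex)// lerDl ltW.
have cv := coef_sqr_le n.
have E0 := expR_gt0 (- (lam n * t)).
have key y : `|coef v n * y| <= B0 * (1 + lam n) ->
    `|coef (S t v) n * y| <= B0 * (1 / t + 4 / t ^+ 2) * (lam n)^-1.
  move=> H; rewrite (coef_S a1 mu_gt0 mu_lt mu_root mu_all HS)// -mulrA normrM (gtr0_norm E0).
  apply: (@le_trans _ _ (expR (- (lam n * t)) * (B0 * (1 + lam n)))); first by rewrite ler_pM2l.
  rewrite mulrCA -mulrA ler_wpM2l ?mulr_ge0//; last by rewrite mulrC; exact: lam_expR.
  by rewrite /B0; lra.
have B1 : 1 + V / e <= B0 by rewrite /B0; lra.
have B2 : 1 + V / e ^+ 2 <= B0 by rewrite /B0; lra.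
split; apply: key.
- apply: (@le_trans _ _ B0); last first.
    by rewrite ler_peMr ?lerDl ?(ltW l0)// (le_trans _ B1)// addr_ge0.
  apply: le_trans B1; apply: norm_le_1Dsqr.
  rewrite ler_pdivlMr// exprMn.
  have pb := psi_bound a1 mu_gt0 mu_root n axx.
  have pb' : e * psi n x ^+ 2 <= nsq n.
    by apply: le_trans pb; rewrite ler_wpM2r ?sqr_ge0.
  rewrite -mulrA [_ * e]mulrC.
  by apply: le_trans cv; rewrite ler_wpM2l ?sqr_ge0.
- have fb := flux_bound a1 mu_gt0 mu_root n axx.
  have fb' : e ^+ 2 * dpsi n x ^+ 2 <= lam n * nsq n.
    apply: (@le_trans _ _ ((x - a) ^+ 2 * dpsi n x ^+ 2)); last by rewrite -exprMn.
    apply: ler_wpM2r; first exact: sqr_ge0.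
    by rewrite ler_sqr ?nnegrE// ?(ltW e0)// (le_trans _ ex)// ltW.
  apply: (@le_trans _ _ (1 + lam n * (V / e ^+ 2))); last first.
    have : lam n * (V / e ^+ 2) <= lam n * B0 by rewrite ler_pM2l// /B0; lra.
    by have := le_trans _ B1; rewrite /B0; lra.
  apply: norm_le_1Dsqr; rewrite mulrA ler_pdivlMr ?exprn_gt0// exprMn.
  rewrite -mulrA [_ * e ^+ 2]mulrC.
  apply: (@le_trans _ _ (coef v n ^+ 2 * (lam n * nsq n))); first by rewrite ler_wpM2l ?sqr_ge0.
  by rewrite mulrCA ler_pM2l.
Qed.

(** A pointwise sum, which selects the continuous representative of the class
    [S t v]. *)
Definition sol x := limn (series (fun n => coef (S t v) n * psi n x)).

Lemma cvg_series_lam (B : R) : cvgn (series (fun n => B * (lam n)^-1)).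
Proof.
have := cvg_series_inv_lam a1 mu_gt0 mu_lt mu_root => c.
exact: is_cvg_seriesZ B c.
Qed.

Lemma proj_cvg x : a < x <= 1 -> proj (S t v) N x @[N --> \oo] --> sol x.
Proof.
move=> /andP[ax x1]; have e0 : 0 < x - a by rewrite subr_gt0.
have [B HB] := coef_bound e0.
have c : cvgn (series (fun n => coef (S t v) n * psi n x)); last exact: c.
apply: (@cvg_series_dominated _ _ (fun n => B * (lam n)^-1) _ (@cvg_series_lam B)) => n.
by have [] := HB n x _; rewrite // addrCA subrr addr0 lexx.
Qed.

Lemma S_eq_sol : {ae lebesgue_measure, forall x, `]a, 1[%classic x -> S t v x = sol x}.
Proof.
have sS := sqi_S HS.1 (ltW t0) sv.
have := @mean_pointwise_limit_ae _ a (S t v) sol (proj (S t v)) sS; apply.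
- exact: sqi_proj.
- exact: (eigenfunctions_complete a1 mu_gt0 mu_lt mu_root mu_all sS).
- by move=> x /andP[ax x1]; apply: proj_cvg; rewrite ax ltW.
Qed.

Lemma sol_continuous : {within `]a, 1], continuous sol}.
Proof.
apply/subspace_continuousP => x Ix; have := Ix; rewrite /= in_itv/= => /andP[ax x1].
have F : ProperFilter (within `]a, 1]%classic (nbhs x)).
  by apply: within_nbhs_proper; exact: subset_closure.
have e0 : 0 < (x - a) / 2 by rewrite divr_gt0 ?subr_gt0.
have [B HB] := coef_bound e0.
apply: (tannery (M := fun n => B * (lam n)^-1)).
- rewrite near_withinE; near=> y; rewrite /= in_itv/= => /andP[ay y1] n.
  have aey : a + (x - a) / 2 < y by near: y; apply: lt_nbhsr; lra.
  by have [] := HB n y _; rewrite // y1 ltW.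
- exact: cvg_series_lam.
- move=> n; apply: cvgMl_tmp; apply: cvg_within_filter; exact: continuous_psi.
Unshelve. all: by end_near. Qed.

Lemma solution_eq u : continuous_representative a (S t v) u ->
  forall x, a < x <= 1 -> u x = sol x.
Proof.
move=> [/ae_eq_leb1P uS cu]; apply: ae_eq_within_continuous => //; last exact: sol_continuous.
have FF := ae_filter_ringOfSetsType (@lebesgue_measure R).
have := S_eq_sol; apply: (filterS2 _ _ uS) => x H1 H2 Ix.
by rewrite H1// H2.
Qed.

Lemma sol_1 : sol 1 = 0.
Proof.
rewrite /sol (_ : (fun n => _) = (fun=> 0)); last first.
  by apply/funext => n; rewrite psi_1 ?mulr0.
by apply: cvg_lim => //; apply: cvg_near_cst; apply: nearW => n; rewrite /series/= big1.
Qed.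

Definition obs_coef n := coef v n * dpsi n 1.

(** By the mean value theorem and [coef_bound] the difference quotients of the
    terms are dominated, so the series can be differentiated termwise at 1. *)
Lemma dx_at1_sol : (sol x - sol 1) / (x - 1) @[x --> 1^'-] --> dirichlet obs_coef lam t.
Proof.
have e0 : 0 < (1 - a) / 2 by rewrite divr_gt0 ?subr_gt0.
have [B HB] := coef_bound e0.
have -> : dirichlet obs_coef lam t = limn (series (fun n => coef (S t v) n * dpsi n 1)).
  congr (limn (series _)); apply/funext => n.
  by rewrite (coef_S a1 mu_gt0 mu_lt mu_root mu_all HS)// /obs_coef; ring.
have nx : \forall x \near (1 : R)^'-, a + (1 - a) / 2 <= x < 1.
  near=> x; apply/andP; split; last by near: x; exact: nbhs_left_lt.
  by near: x; apply: nbhs_left_ge; lra.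
have E : \forall x \near (1 : R)^'-,
    limn (series (fun n => coef (S t v) n * (psi n x / (x - 1)))) = (sol x - sol 1) / (x - 1).
  near=> x; have /andP[ax x1] : a + (1 - a) / 2 <= x < 1 by near: x.
  rewrite sol_1 subr0; apply/cvg_lim => //.
  suff : proj (S t v) N x / (x - 1) @[N --> \oo] --> sol x / (x - 1).
    apply: cvg_trans; apply: near_eq_cvg; near=> N.
    by rewrite /proj /series/= mulr_suml; apply: eq_bigr => n _; rewrite mulrA.
  by apply: cvgMr_tmp; apply: proj_cvg; rewrite (ltW x1) andbT; lra.
apply: cvg_trans (near_eq_cvg E) _.
apply: (tannery (M := fun n => B * (lam n)^-1)).
- near=> x => n; have /andP[ax x1] : a + (1 - a) / 2 <= x < 1 by near: x.
  have [y] := MVT x1 (fun z _ => is_derive_psi a mu n z) (continuous_subspaceT (@continuous_psi _ a mu n)).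
  rewrite in_itv/= psi_1// sub0r => /andP[xy y1] e.
  have -> : psi n x / (x - 1) = dpsi n y.
    by rewrite -[psi n x]opprK e -mulrN opprB mulfK// subr_eq0 lt_eqF.
  by have [] := HB n y _; rewrite // (ltW y1) (le_trans ax (ltW xy)).
- exact: cvg_series_lam.
- move=> n; apply: cvgMl_tmp.
  have c0 : (x - 1) @[x --> (1 : R)^'-] --> (0 : R)^'.
    move=> P HP; have {}HP : nbhs (0 : R) [set h | h != 0 -> P h] by exact: HP.
    have c1 : (x - 1) @[x --> (1 : R)] --> (0 : R).
      by rewrite -(subrr (1 : R)); apply: cvgB; [exact: cvg_id|exact: cvg_cst].
    have {}c1 : nbhs (1 : R) [set x | x - 1 != 0 -> P (x - 1)] by exact: c1 _ HP.
    by apply: filterS c1 => y /= H y1; apply: H; rewrite subr_eq0 lt_eqF.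
  have := cvg_comp _ _ c0 (is_derive_quotient (is_derive_psi a mu n 1)).
  apply: cvg_trans; apply: near_eq_cvg; near=> x.
  by rewrite /= psi_1// subr0 (addrC 1) subrK mulrC.
Unshelve. all: by end_near. Qed.

Lemma obs_coef_summable : cvgn (series (fun n => `|obs_coef n| * expR (- (lam n * t)))).
Proof.
have e0 : 0 < 1 - a by rewrite subr_gt0.
have [B HB] := coef_bound e0.
apply: (@cvg_series_dominated _ _ (fun n => B * (lam n)^-1) _ (@cvg_series_lam B)) => n.
have -> : `|obs_coef n| * expR (- (lam n * t)) = `|coef (S t v) n * dpsi n 1|.
  rewrite (coef_S a1 mu_gt0 mu_lt mu_root mu_all HS)// /obs_coef.
  by rewrite -mulrA [RHS]normrM (ger0_norm (expR_ge0 _)) mulrC.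
by rewrite normr_id; have [] := HB n 1 _; rewrite // addrCA subrr addr0 lexx.
Qed.

Lemma sol_eq0 : (forall n, obs_coef n = 0) -> forall x, sol x = 0.
Proof.
move=> d0 x; rewrite /sol (_ : (fun n => _) = (fun=> 0)).
  by apply: cvg_lim => //; apply: cvg_near_cst; apply: nearW => n; rewrite /series/= big1.
apply/funext => n; rewrite (coef_S a1 mu_gt0 mu_lt mu_root mu_all HS)//.
have /eqP := d0 n; rewrite mulf_eq0 => /orP[/eqP->|d1]; first by rewrite mulr0 mul0r.
by have := flux_1_neq0 a1 mu_gt0 mu_root n; rewrite /flux -[dtheta _ _ _]/(dpsi n 1) (eqP d1) mulr0 eqxx.
Qed.

End Solution.

(** * Dirichlet series without common exponents *)
Section TwoDirichletSeries.
Context {R : realType}.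
Implicit Types (d nu : nat -> R).

Definition interleave (T : Type) (f g : nat -> T) n := if odd n then g n./2 else f n./2.

Lemma interleave_double (T : Type) (f g : nat -> T) n : interleave f g n.*2 = f n.
Proof. by rewrite /interleave odd_double doubleK. Qed.

Lemma interleave_doubleS (T : Type) (f g : nat -> T) n : interleave f g n.*2.+1 = g n.
Proof. by rewrite /interleave /= odd_double uphalf_double. Qed.

Lemma interleaveP (T : Type) (f g : nat -> T) (P : T -> Prop) :
  (forall n, P (f n)) -> (forall n, P (g n)) -> forall n, P (interleave f g n).
Proof. by move=> Pf Pg n; rewrite /interleave; case: ifP. Qed.

Lemma series_interleave (f g : nat -> R) N :
  series (interleave f g) N.*2 = series f N + series g N.
Proof.
elim: N => [|N IH]; first by rewrite /series/= !big_geq ?addr0.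
move: IH; rewrite /series/= => IH.
rewrite doubleS !big_nat_recr//= IH interleave_double interleave_doubleS; ring.
Qed.

Lemma cvg_double : (n.*2)@[n --> \oo] --> \oo.
Proof.
move=> P [N _ HN]; exists N => // n /= Nn; apply: HN => /=.
by rewrite (leq_trans Nn)// -addnn leq_addr.
Qed.

Lemma interleave_summable d1 nu1 d2 nu2 : dirichlet_summable d1 nu1 ->
  dirichlet_summable d2 nu2 ->
  dirichlet_summable (interleave d1 d2) (interleave nu1 nu2).
Proof.
move=> s1 s2 t t0; have c1 := s1 t t0; have c2 := s2 t t0.
set f := (fun n => `|d1 n| * expR (- (nu1 n * t))) in c1.
set g := (fun n => `|d2 n| * expR (- (nu2 n * t))) in c2.
have -> : (fun n => `|interleave d1 d2 n| * expR (- (interleave nu1 nu2 n * t))) = interleave f g.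
  by apply/funext => n; rewrite /interleave; case: ifP.
have f0 n : 0 <= f n by rewrite mulr_ge0 ?expR_ge0.
have g0 n : 0 <= g n by rewrite mulr_ge0 ?expR_ge0.
have h0 n : 0 <= interleave f g n by apply: (@interleaveP _ f g (fun x => 0 <= x)).
apply: nondecreasing_is_cvgn; first by apply: nondecreasing_series => n _ _.
exists (limn (series f) + limn (series g)) => _ [N _ <-].
apply: (@le_trans _ _ (series (interleave f g) N.*2)).
  by apply: nondecreasing_series => //; rewrite -addnn leq_addr.
rewrite series_interleave lerD//.
  by apply: nondecreasing_cvgn_le => //; apply: nondecreasing_series => n _ _.
by apply: nondecreasing_cvgn_le => //; apply: nondecreasing_series => n _ _.
Qed.

Lemma dirichlet_interleave d1 nu1 d2 nu2 t : dirichlet_summable d1 nu1 ->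
  dirichlet_summable d2 nu2 -> 0 < t ->
  dirichlet (interleave d1 d2) (interleave nu1 nu2) t =
  dirichlet d1 nu1 t + dirichlet d2 nu2 t.
Proof.
move=> s1 s2 t0.
have c1 := dirichlet_cvg s1 t0; have c2 := dirichlet_cvg s2 t0.
have c := dirichlet_cvg (interleave_summable s1 s2) t0.
have c' := cvg_comp _ _ cvg_double c.
have {}c' := cvg_lim (@norm_hausdorff _ _) c'.
rewrite /dirichlet -c'; apply: cvg_lim => //.
have -> : series (fun n => interleave d1 d2 n * expR (- (interleave nu1 nu2 n * t))) \o double =
    fun N => series (fun n => d1 n * expR (- (nu1 n * t))) N + series (fun n => d2 n * expR (- (nu2 n * t))) N.
  apply/funext => N /=; rewrite -series_interleave; congr (series _ _).
  by apply/funext => n; rewrite /interleave; case: ifP.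
exact: cvgD c1 c2.
Qed.

(** Otherwise, among the indices with nonzero coefficient, one with the least
    exponent would contradict [dirichlet_leading]. *)
Lemma dirichlet_eq0 d nu : (forall n, 0 <= nu n) -> injective nu ->
  dirichlet_summable d nu -> (forall t, 0 < t -> dirichlet d nu t = 0) ->
  (forall P : nat -> Prop, (exists n, P n) ->
    exists2 n0, P n0 & forall n, P n -> nu n0 <= nu n) ->
  forall n, d n = 0.
Proof.
move=> nu0 inu sd z wf n; apply: contrapT => dn.
have [|n0 d0 hmin] := wf (fun n => d n <> 0); first by exists n.
apply: d0; apply: (dirichlet_leading nu0 inu sd z) => m /eqP; exact: hmin.
Qed.

Lemma increasing_wf nu (P : nat -> Prop) : (forall m n, (m < n)%N -> nu m < nu n) ->
  (exists n, P n) -> exists2 n0, P n0 & forall n, P n -> nu n0 <= nu n.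
Proof.
move=> lt [n Pn]; have ex : exists n, `[< P n >] by exists n; apply/asboolP.
have [m /asboolP Pm hm] := ex_minnP ex; exists m => // k /asboolP/hm.
by rewrite leq_eqVlt => /orP[/eqP->//|/lt/ltW].
Qed.

Lemma interleave_wf nu1 nu2 (P : nat -> Prop) : (forall m n, (m < n)%N -> nu1 m < nu1 n) ->
  (forall m n, (m < n)%N -> nu2 m < nu2 n) -> (exists n, P n) ->
  exists2 n0, P n0 & forall n, P n -> interleave nu1 nu2 n0 <= interleave nu1 nu2 n.
Proof.
move=> lt1 lt2 [n Pn].
have par k : k = k./2.*2 \/ k = k./2.*2.+1.
  by have := odd_double_half k; case: (odd k) => /= <-; [right|left]; rewrite ?add0n// ?add1n/= ?uphalf_double ?doubleK.
have sp (Q : nat -> Prop) : (forall k, P k.*2 -> Q k.*2) -> (forall k, P k.*2.+1 -> Q k.*2.+1) ->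
    forall k, P k -> Q k.
  by move=> h1 h2 k; case: (par k) => ->; [exact: h1|exact: h2].
have [e1|n1] := pselect (exists k, P k.*2); have [e2|n2] := pselect (exists k, P k.*2.+1).
- have [m1 P1 h1] := increasing_wf lt1 e1; have [m2 P2 h2] := increasing_wf lt2 e2.
  have [le|/ltW le] := leP (nu1 m1) (nu2 m2).
    exists m1.*2 => //; apply: sp => k Pk; rewrite ?interleave_double ?interleave_doubleS ?h1//.
    by rewrite (le_trans le)// h2.
  exists m2.*2.+1 => //; apply: sp => k Pk; rewrite ?interleave_double ?interleave_doubleS ?h2//.
  by rewrite (le_trans le)// h1.
- have [m1 P1 h1] := increasing_wf lt1 e1.
  exists m1.*2 => //; apply: sp => k Pk; rewrite ?interleave_double ?h1//.
  by case: n2; exists k.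
- have [m2 P2 h2] := increasing_wf lt2 e2.
  exists m2.*2.+1 => //; apply: sp => k Pk; rewrite ?interleave_doubleS ?h2//.
  by case: n1; exists k.
- by case: (par n) Pn => -> Pn; [case: n1|case: n2]; exists n./2.
Qed.

(** The difference of the two series is a single Dirichlet series, with the terms
    of the first at even places and those of the second at odd places; its
    exponents are pairwise distinct. *)
Theorem dirichlet_disjoint d1 nu1 d2 nu2 (t1 t2 : R) :
  (forall n, 0 <= nu1 n) -> (forall n, 0 <= nu2 n) ->
  (forall m n, (m < n)%N -> nu1 m < nu1 n) -> (forall m n, (m < n)%N -> nu2 m < nu2 n) ->
  dirichlet_summable d1 nu1 -> dirichlet_summable d2 nu2 ->
  (forall m n, nu1 m <> nu2 n) -> 0 <= t1 -> t1 < t2 ->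
  (forall t, t1 < t < t2 -> dirichlet d1 nu1 t = dirichlet d2 nu2 t) ->
  (forall n, d1 n = 0) /\ (forall n, d2 n = 0).
Proof.
move=> p1 p2 lt1 lt2 s1 s2 dis t10 t12 E.
have inj nu : (forall m n, (m < n)%N -> nu m < nu n) -> injective nu.
  by move=> lt m n mn; have [/lt|/lt|//] := ltngtP m n; rewrite mn ltxx.
pose d2' n := - d2 n.
have s2' : dirichlet_summable d2' nu2.
  by move=> t t0; under eq_fun do rewrite normrN; exact: s2.
have E2 t : 0 < t -> dirichlet d2' nu2 t = - dirichlet d2 nu2 t.
  move=> t0; apply: cvg_lim => //.
  have -> : series (fun n => d2' n * expR (- (nu2 n * t))) = fun N => - series (fun n => d2 n * expR (- (nu2 n * t))) N.
    by apply/funext => N; rewrite /series/= -sumrN; apply: eq_bigr => n _; rewrite mulNr.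
  by apply: cvgN; exact: dirichlet_cvg.
have nu0 n : 0 <= interleave nu1 nu2 n by apply: (@interleaveP _ nu1 nu2 (fun x => 0 <= x)).
have ss := interleave_summable s1 s2'.
have z t : 0 < t -> dirichlet (interleave d1 d2') (interleave nu1 nu2) t = 0.
  apply: (dirichlet_vanish nu0 ss t10 t12) => s /andP[t1s st2].
  have s0 : 0 < s by exact: le_lt_trans t1s.
  by rewrite dirichlet_interleave// E2// E ?subrr// t1s.
have ij : injective (interleave nu1 nu2).
  have half m n : odd m = odd n -> m./2 = n./2 -> m = n.
    by move=> o h; rewrite -(odd_double_half m) -(odd_double_half n) o h.
  move=> m n; rewrite /interleave; case: ifP => om; case: ifP => on.
  - by move=> /(inj _ lt2)/half; apply; rewrite om on.
  - by move=> /esym/dis.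
  - by move=> /dis.
  - by move=> /(inj _ lt1)/half; apply; rewrite om on.
have d0 := dirichlet_eq0 nu0 ij ss z (fun P => interleave_wf lt1 lt2).
split=> n; first by have := d0 n.*2; rewrite interleave_double.
by have := d0 n.*2.+1; rewrite interleave_doubleS /d2' => /eqP; rewrite oppr_eq0 => /eqP.
Qed.

End TwoDirichletSeries.

(** * Observation at the end point 1 *)
Section Observation.
Context {R : realType}.
Variable mu : nat -> R.
Hypothesis mu_gt0 : forall n, 0 < mu n.
Hypothesis mu_lt : forall m n, (m < n)%N -> mu m < mu n.
Hypothesis mu_root : forall n, bes 0 (mu n) = 0.
Hypothesis mu_all : forall s : R, 0 < s -> bes 0 s = 0 -> exists n, s = mu n.
Variables (a T : R) (v : R -> R) (u : R -> R -> R).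
Hypotheses (a1 : a < 1) (sv : sqi a v) (hu : degenerate_solution a T v u).

Lemma dx_at1_dirichlet t : 0 < t < T -> dx_at1 u t = dirichlet (obs_coef a mu v) (lam a mu) t.
Proof.
move=> tT; have /andP[t0 _] := tT; have [S [HS hS]] := hu.
have E := solution_eq a1 mu_gt0 mu_lt mu_root mu_all HS sv t0 (hS t tT).
have := dx_at1_sol a1 mu_gt0 mu_lt mu_root mu_all HS sv t0 => c.
apply: cvg_lim => //; apply: cvg_trans c; apply: near_eq_cvg; near=> x.
rewrite -!E ?a1 ?lexx//; apply/andP; split; last first.
  by apply/ltW; near: x; exact: nbhs_left_lt.
by near: x; exact: nbhs_left_gt.
Unshelve. all: by end_near. Qed.

Lemma dirichlet_summable_obs : dirichlet_summable (obs_coef a mu v) (lam a mu).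
Proof.
move=> t t0; have [S [HS _]] := hu.
exact: (obs_coef_summable a1 mu_gt0 mu_lt mu_root mu_all HS sv t0).
Qed.

Lemma unobserved_solution x t : (forall n, obs_coef a mu v n = 0) ->
  a < x < 1 -> 0 < t < T -> u x t = 0.
Proof.
move=> d0 /andP[ax x1] tT; have /andP[t0 _] := tT; have [S [HS hS]] := hu.
rewrite (solution_eq a1 mu_gt0 mu_lt mu_root mu_all HS sv t0 (hS t tT)) ?ax ?ltW//.
exact: (sol_eq0 a1 mu_gt0 mu_lt mu_root mu_all HS sv t0 d0).
Qed.

End Observation.

Section Zeros.
Context {R : realType}.
Variable j : nat -> R.
Hypothesis hj : bessel0_zeros j.

(** The shift makes the first zero, [j 1], correspond to index 0. *)
Definition bes0_zero n : R := j n.+1 ^+ 2 / 4.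

Lemma bessel0_zero_gt0 n : 0 < j n.+1.
Proof.
have [_ E] := hj; have : [set z | 0 < z /\ bessel0 z = 0] (j n.+1) by rewrite -E; exists n.+1.
by case.
Qed.

Lemma bes0_zero_gt0 n : 0 < bes0_zero n.
Proof. by rewrite divr_gt0// exprn_gt0// bessel0_zero_gt0. Qed.

Lemma bes0_zero_lt m n : (m < n)%N -> bes0_zero m < bes0_zero n.
Proof.
move=> mn; rewrite ltr_pM2r ?invr_gt0// ltr_sqr ?nnegrE ?ltW ?bessel0_zero_gt0//.
by apply: hj.1.
Qed.

Lemma bes0_zero_root n : bes 0 (bes0_zero n) = 0.
Proof.
have [_ E] := hj; have : [set z | 0 < z /\ bessel0 z = 0] (j n.+1) by rewrite -E; exists n.+1.
by case=> _; rewrite bessel0E.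
Qed.

Lemma bes0_zero_all (s : R) : 0 < s -> bes 0 s = 0 -> exists n, s = bes0_zero n.
Proof.
move=> s0 bs; have [_ E] := hj.
have sE : (2 * Num.sqrt s) ^+ 2 / 4 = s by rewrite exprMn sqr_sqrtr ?ltW//; field.
have : [set z | 0 < z /\ bessel0 z = 0] (2 * Num.sqrt s).
  by split; [rewrite mulr_gt0// sqrtr_gt0|rewrite bessel0E sE].
rewrite -E => -[[//|n] _ jn]; exists n.
by rewrite /bes0_zero jn sE.
Qed.

Lemma lam_inv_zero (a : R) n : a < 1 -> (lam a bes0_zero n)^-1 = 4 * ((1 - a) / j n.+1 ^+ 2).
Proof.
move=> a1; have := bessel0_zero_gt0 n; rewrite /lam /bes0_zero => jn.
by field; rewrite gt_eqF//= subr_eq0 gt_eqF.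
Qed.

End Zeros.

Theorem theorem6p4 (R : realType) (j : nat -> R) (hj : bessel0_zeros j)
  (a1 a2 : R) (ha1 : 0 < a1 < 1) (ha2 : 0 < a2 < 1)
  (T : R) (hT : 0 < T) (t1 t2 : R) (ht1 : 0 < t1) (ht12 : t1 < t2)
  (ht2 : t2 <= T)
  (v1 v2 : R -> R) (hv1 : v1 \in L2 a1) (hv2 : v2 \in L2 a2)
  (u1 u2 : R -> R -> R)
  (hu1 : degenerate_solution a1 T v1 u1)
  (hu2 : degenerate_solution a2 T v2 u2)
  (hobs : forall t, t1 < t < t2 -> dx_at1 u1 t = dx_at1 u2 t)
  (hnz : (exists x t, [/\ a1 < x < 1, 0 < t < T & u1 x t != 0]) \/
         (exists x t, [/\ a2 < x < 1, 0 < t < T & u2 x t != 0])) :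
  exists m1 m2 : nat, [/\ (0 < m1)%N, (0 < m2)%N &
    (1 - a1) / j m1 ^+ 2 = (1 - a2) / j m2 ^+ 2].
Proof.
have /andP[_ a11] := ha1; have /andP[_ a21] := ha2.
have s1 : sqi a1 v1 by exact/L2P. have s2 : sqi a2 v2 by exact/L2P.
pose mu := bes0_zero j.
have mu0 := bes0_zero_gt0 hj : forall n, 0 < mu n.
have mul := bes0_zero_lt hj : forall m n, (m < n)%N -> mu m < mu n.
have mur := bes0_zero_root hj : forall n, bes 0 (mu n) = 0.
have mua := bes0_zero_all hj : forall s : R, 0 < s -> bes 0 s = 0 -> exists n, s = mu n.
apply: contrapT => ne.
have dis m n : lam a1 mu m <> lam a2 mu n.
  move=> e; apply: ne; exists m.+1, n.+1; split => //.
  have := congr1 GRing.inv e; rewrite !lam_inv_zero//.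
  by apply: mulfI.
have [d1 d2] : (forall n, obs_coef a1 mu v1 n = 0) /\ (forall n, obs_coef a2 mu v2 n = 0).
  apply: (@dirichlet_disjoint _ _ (lam a1 mu) _ (lam a2 mu) t1 t2) => //.
  - by move=> n; apply/ltW/lam_gt0.
  - by move=> n; apply/ltW/lam_gt0.
  - exact: lam_lt.
  - exact: lam_lt.
  - exact: (dirichlet_summable_obs mu0 mul mur mua a11 s1 hu1).
  - exact: (dirichlet_summable_obs mu0 mul mur mua a21 s2 hu2).
  - exact: ltW.
  - move=> t tt; have tT : 0 < t < T.
      by case/andP: tt => h1 h2; rewrite (lt_trans ht1 h1) (lt_le_trans h2 ht2).
    rewrite -(dx_at1_dirichlet mu0 mul mur mua a11 s1 hu1 tT).
    by rewrite -(dx_at1_dirichlet mu0 mul mur mua a21 s2 hu2 tT) hobs.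
case: hnz => -[x [t [xI tT /eqP]]]; apply.
  exact: (unobserved_solution mu0 mul mur mua a11 s1 hu1 d1).
exact: (unobserved_solution mu0 mul mur mua a21 s2 hu2 d2).
Qed.
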